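(* The geometric compactification $\Sigma\cup S_\infty(\Sigma)$ of $\Sigma$ is homeomorphic to the closed half disk $D=\{(u,v):u^2+v^2\le1,\ v\ge0\}$, with $S_\infty(\Sigma)$ corresponding to the boundary of $D$ (the segment $[-1,1]\times\{0\}$ together with the upper semicircle), in such a way that: (1) the asymptotic classes of geodesic rays whose points converge (in $\mathbb{R}^2$) to a point $(\xi,0)$, $\xi\in\mathbb{R}$, correspond homeomorphically to the points of $\{(u,0):-1<u<1\}$; (2) the class of the vertical rays $\{x=\text{const},\,y\to\infty\}$ corresponds to $(0,1)$; (3) the classes of geodesics given (up to translation in $x$) by $x=\pm\frac{1}{\sqrt3}(\cosh y-\cosh a)$, $y\to\infty$ ($a>0$), correspond to $(\pm1,0)$; (4) for $a>0$ and $m>\sqrt3/\sinh a$, the class of the geodesic $x=\pm(F(y)-F(a))$, $y\to\infty$, where $$F(y)=\frac{\sqrt{3+\sinh^2a}}{\sqrt{m^2\sinh^2a-3}}\log\Big\{(m^2\sinh^2a-3)\cosh y+\sqrt{m^2\sinh^2a-3}\,\sqrt{(m^2\sinh^2a-3)\cosh^2y+3\cosh^2a+2m^2\sinh^2a}\Big\},$$ corresponds to $(\cos\theta,\sin\theta)$, where $\theta\in(0,\pi/2)\cup(\pi/2,\pi)$ is determined by $\tan\theta=\pm\dfrac{\sqrt{m^2\sinh^2a-3}}{\sqrt{3+\sinh^2a}}$ (these geodesics are asymptotic to the Euclidean rays $y=x\tan\theta$).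
   Context: $\Sigma=\mathbb{R}\times(0,\infty)$ with the complete metric $ds^2=P(y)(dx^2+dy^2)$, $P(y)=\frac{e^{4y}+10e^{2y}+1}{4(e^{2y}-1)^2}$; it is a Cartan–Hadamard surface (simply connected, complete, negative curvature). $S_\infty(\Sigma)$ is its geometric boundary: the set of equivalence classes of unit speed geodesic rays, two rays being equivalent if their distance stays bounded, with the cone topology on $\Sigma\cup S_\infty(\Sigma)$. *)

(* Defs.v *)
From Stdlib Require Import Reals Lra.
Open Scope R_scope.

(* ---------- The surface Sigma = R x (0,oo), ds^2 = P(y)(dx^2+dy^2) ---------- *)

Definition P (y : R) : R :=
  (exp (4 * y) + 10 * exp (2 * y) + 1) / (4 * (exp (2 * y) - 1) ^ 2).

Definition in_Sigma (q : R * R) : Prop := 0 < snd q.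

(* A (complete, unit speed) geodesic of Sigma, parametrised by all of R, given
   in the coordinates (x,y).  Geodesic equations of the conformal metric
   P(y)(dx^2+dy^2):  x'' + (P'/P) x' y' = 0,  y'' + (P'/(2P)) (y'^2 - x'^2) = 0. *)
Definition geodesic (g : R -> R * R) : Prop :=
  exists (dP vx vy ax ay : R -> R),
    (forall y, 0 < y -> derivable_pt_lim P y (dP y)) /\
    forall t,
      0 < snd (g t) /\
      derivable_pt_lim (fun s => fst (g s)) t (vx t) /\
      derivable_pt_lim (fun s => snd (g s)) t (vy t) /\
      derivable_pt_lim vx t (ax t) /\
      derivable_pt_lim vy t (ay t) /\
      ax t + dP (snd (g t)) / P (snd (g t)) * vx t * vy t = 0 /\
      ay t + dP (snd (g t)) / (2 * P (snd (g t))) * (vy t ^ 2 - vx t ^ 2) = 0 /\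
      P (snd (g t)) * (vx t ^ 2 + vy t ^ 2) = 1.

(* The unit speed geodesic ray of g is its restriction to [0,oo). *)

Definition curve_len_le (q1 q2 : R * R) (L : R) : Prop :=
  exists (c : R -> R * R) (dc1 dc2 : R -> R),
    c 0 = q1 /\ c 1 = q2 /\
    (forall s, 0 <= s <= 1 ->
        0 < snd (c s) /\
        derivable_pt_lim (fun u => fst (c u)) s (dc1 s) /\
        derivable_pt_lim (fun u => snd (c u)) s (dc2 s) /\
        continuity_pt dc1 s /\ continuity_pt dc2 s) /\
    exists pr : Riemann_integrable
                  (fun s => sqrt (P (snd (c s)) * (dc1 s ^ 2 + dc2 s ^ 2))) 0 1,
      RiemannInt pr <= L.

Definition dist_le (q1 q2 : R * R) (r : R) : Prop :=
  forall e, 0 < e -> curve_len_le q1 q2 (r + e).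

Definition asymptotic (g1 g2 : R -> R * R) : Prop :=
  exists B, forall t, 0 <= t -> dist_le (g1 t) (g2 t) B.

(* Pt q : a point of Sigma;  Inf g : the asymptotic class of the ray of g. *)
Inductive cpt : Type :=
| Pt  : R * R -> cpt
| Inf : (R -> R * R) -> cpt.

Definition valid (z : cpt) : Prop :=
  match z with
  | Pt q => in_Sigma q
  | Inf g => geodesic g
  end.

(* equality in Sigma u S_oo(Sigma) *)
Definition same (z1 z2 : cpt) : Prop :=
  match z1, z2 with
  | Pt q1, Pt q2 => q1 = q2
  | Inf g1, Inf g2 => asymptotic g1 g2
  | _, _ => False
  end.

Definition is_inf (z : cpt) : Prop :=
  match z with Inf _ => True | Pt _ => False end.

(* ---------- cone topology (Eberlein-O'Neill), base point p0 = (0,1) ---------- *)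

Definition p0 : R * R := (0, 1).

(* Angle at p0 between tangent vectors v and w (the metric is conformal, so
   this is the Euclidean angle of the coordinate vectors). *)
Definition angle (v w : R * R) : R :=
  acos ((fst v * fst w + snd v * snd w) /
        (sqrt (fst v ^ 2 + snd v ^ 2) * sqrt (fst w ^ 2 + snd w ^ 2))).

Definition starts_in_cone (v : R * R) (eps : R) (sg : R -> R * R) : Prop :=
  geodesic sg /\ sg 0 = p0 /\
  exists w1 w2, derivable_pt_lim (fun s => fst (sg s)) 0 w1 /\
                derivable_pt_lim (fun s => snd (sg s)) 0 w2 /\
                angle v (w1, w2) < eps.

Definition in_trunc_cone (v : R * R) (eps Rad : R) (z : cpt) : Prop :=
  match z with
  | Pt q => ~ dist_le p0 q Rad /\
            exists sg T, 0 < T /\ sg T = q /\ starts_in_cone v eps sg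
  | Inf g => exists sg, asymptotic sg g /\ starts_in_cone v eps sg
  end.

(* Open sets of the cone topology: generated by the open subsets of Sigma and the
   truncated cones. *)
Definition cone_open (S : cpt -> Prop) : Prop :=
  forall z, valid z -> S z ->
    match z with
    | Pt q => exists r, 0 < r /\
        forall q', in_Sigma q' ->
          (fst q' - fst q) ^ 2 + (snd q' - snd q) ^ 2 < r ^ 2 -> S (Pt q')
    | Inf g => exists v eps Rad, v <> (0, 0) /\ 0 < eps /\ 0 < Rad /\
        in_trunc_cone v eps Rad z /\
        forall z', valid z' -> in_trunc_cone v eps Rad z' -> S z'
    end.

Definition inD (w : R * R) : Prop := fst w ^ 2 + snd w ^ 2 <= 1 /\ 0 <= snd w.

Definition bdD (w : R * R) : Prop :=
  (fst w ^ 2 + snd w ^ 2 = 1 /\ 0 <= snd w) \/ (snd w = 0 /\ -1 <= fst w <= 1).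

Definition open_in_D (V : R * R -> Prop) : Prop :=
  forall w, inD w -> V w -> exists r, 0 < r /\
    forall w', inD w' -> (fst w' - fst w) ^ 2 + (snd w' - snd w) ^ 2 < r ^ 2 -> V w'.

Definition conv_to (g : R -> R * R) (q : R * R) : Prop :=
  forall e, 0 < e -> exists T, forall t, T <= t ->
    Rabs (fst (g t) - fst q) < e /\ Rabs (snd (g t) - snd q) < e.

Definition y_to_infty (g : R -> R * R) : Prop :=
  forall M, exists T, forall t, T <= t -> M < snd (g t).

Definition eventually_on (g : R -> R * R) (x0 : R) (f : R -> R) : Prop :=
  exists T, forall t, T <= t -> fst (g t) = x0 + f (snd (g t)).

Definition Fm (a m y : R) : R :=
  sqrt (3 + sinh a ^ 2) / sqrt (m ^ 2 * sinh a ^ 2 - 3) *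
  ln ((m ^ 2 * sinh a ^ 2 - 3) * cosh y +
      sqrt (m ^ 2 * sinh a ^ 2 - 3) *
      sqrt ((m ^ 2 * sinh a ^ 2 - 3) * cosh y ^ 2 + 3 * cosh a ^ 2
            + 2 * m ^ 2 * sinh a ^ 2)).

(* Main.v *)
Require Import Defs.
From Stdlib Require Import Reals Lra Lia ClassicalEpsilon.
From Coquelicot Require Import Coquelicot.
Open Scope R_scope.

(** In the coordinates [x] and [u = cosh y], with Clairaut constant [c] and the parameter [s]
    given by [ds/dt = 2 (u^2 - 1) / (u^2 + 2)], the geodesics are [x = x0 + 2 c s],
    [u'' = (1 - 4 c^2) u], and the arc length is an elementary function of [s], [u], [u'].
    Hence a ray either has [1 - 4 c^2 >= 0] and goes up, with direction tending to
    [(2 c, sqrt (1 - 4 c^2))], or it goes down and reaches the line [y = 0] at a point [xi].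
    The compactification is that of the closed Euclidean half plane by directions,
    [(x, y) |-> (x, y) / sqrt (1 + x^2 + y^2)], and a ray is sent to the limit of its points.

    Rays with different ends diverge, because half the Euclidean coordinates and half the
    hyperbolic Busemann functions are 1-Lipschitz for the metric; rays with the same end are
    joined by straight segments of bounded length. Continuity on truncated cones comes from
    Gronwall's inequality at a fixed time followed by trapping near the end. The inverse is
    continuous by compactness of the circle of directions at [p0], once every point is known to lie
    on a ray from [p0] (a boundary value problem for [u]) and the end of a ray from [p0] is known to
    determine its direction (Sturm comparison). The vertical, critical and oblique classes are read off
    from the slope of the given curves, which determines [c]. *)

(** * Real analysis *)

Lemma is_derive_eq (f : R -> R) (x l l' : R) : is_derive f x l -> l = l' -> is_derive f x l'.
Proof. intros Df <-. exact Df. Qed.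

Lemma is_derive_const_R (k t : R) : is_derive (fun _ : R => k) t 0.
Proof. apply (is_derive_const k t). Qed.

Lemma is_derive_id_R (t : R) : is_derive (fun t : R => t) t 1.
Proof. apply (is_derive_id t). Qed.

Lemma is_derive_opp_R (f : R -> R) (t df : R) : is_derive f t df ->
  is_derive (fun t => - f t) t (- df).
Proof. apply (is_derive_opp f). Qed.

Lemma is_derive_plus_R (f g : R -> R) (t df dg : R) : is_derive f t df -> is_derive g t dg ->
  is_derive (fun t => f t + g t) t (df + dg).
Proof. apply (is_derive_plus f g). Qed.

Lemma is_derive_minus_R (f g : R -> R) (t df dg : R) : is_derive f t df -> is_derive g t dg ->
  is_derive (fun t => f t - g t) t (df - dg).
Proof. apply (is_derive_minus f g). Qed.

Lemma is_derive_scal_R (f : R -> R) (k t df : R) : is_derive f t df ->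
  is_derive (fun t => k * f t) t (k * df).
Proof. apply (is_derive_scal f). Qed.

Lemma is_derive_mult_R (f g : R -> R) (t df dg : R) : is_derive f t df -> is_derive g t dg ->
  is_derive (fun t => f t * g t) t (df * g t + f t * dg).
Proof. intros. apply (is_derive_mult f g); auto. intros; apply Rmult_comm. Qed.

Lemma is_derive_comp_R (f g : R -> R) (t df dg : R) : is_derive f (g t) df -> is_derive g t dg ->
  is_derive (fun t => f (g t)) t (dg * df).
Proof. apply (is_derive_comp f g). Qed.

Lemma is_derive_ln_comp (f : R -> R) (t df : R) : 0 < f t -> is_derive f t df ->
  is_derive (fun t => ln (f t)) t (df / f t).
Proof. intros pos Df. exact (is_derive_comp_R ln f t _ _ (is_derive_ln _ pos) Df). Qed.

Lemma is_derive_sq (f : R -> R) (t df : R) : is_derive f t df ->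
  is_derive (fun t => f t ^ 2) t (2 * f t * df).
Proof.
  intros Df. apply is_derive_eq with (INR 2 * df * f t ^ 1); [now apply is_derive_pow|].
  simpl. ring.
Qed.

(* Differentiates along the outer sums and products, leaving the value of the derivative to be
   checked; [simple eapply] keeps it from unfolding the constituents. *)
Ltac derive_by_rules :=
  eapply is_derive_eq;
  [ repeat first
      [ eassumption
      | match goal with D : forall t, is_derive _ t _ |- _ => simple apply D end
      | simple apply is_derive_const_R
      | simple apply is_derive_id_R
      | simple eapply is_derive_opp_R
      | simple eapply is_derive_plus_R
      | simple eapply is_derive_minus_R
      | simple eapply is_derive_scal_R
      | simple eapply is_derive_mult_R
      | simple eapply is_derive_sq ]
  | cbv beta ].

Lemma is_derive_continuity_pt (f : R -> R) (t df : R) : is_derive f t df -> continuity_pt f t.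
Proof. intros D. apply derivable_continuous_pt. exists df. now apply is_derive_Reals. Qed.

Lemma derive_continuity (f df : R -> R) : (forall t : R, is_derive f t (df t)) -> continuity f.
Proof. intros D t. exact (is_derive_continuity_pt _ _ _ (D t)). Qed.

Lemma ex_derive_continuity (f : R -> R) : (forall t : R, ex_derive f t) -> continuity f.
Proof. intros D t. destruct (D t) as [df Df]. exact (is_derive_continuity_pt _ _ _ Df). Qed.

Lemma mean_value (f df : R -> R) a b : a < b ->
  (forall t : R, a <= t <= b -> is_derive f t (df t)) ->
  exists t, a < t < b /\ f b - f a = df t * (b - a).
Proof.
  intros Hab D. destruct (MVT_cor2 f df a b Hab) as (t & E & Ht).
  - intros t Ht. apply is_derive_Reals, D, Ht.
  - now exists t.
Qed.

Lemma derive_nonneg_le (f df : R -> R) a b : a <= b ->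
  (forall t : R, a <= t <= b -> is_derive f t (df t)) ->
  (forall t, a < t < b -> 0 <= df t) -> f a <= f b.
Proof.
  intros [Hab| ->] D nonneg; [|lra]. destruct (mean_value f df a b Hab D) as (t & Ht & E).
  specialize (nonneg t Ht). nra.
Qed.

Lemma derive_pos_lt (f df : R -> R) a b : a < b ->
  (forall t : R, a <= t <= b -> is_derive f t (df t)) ->
  (forall t, a < t < b -> 0 < df t) -> f a < f b.
Proof.
  intros Hab D pos. destruct (mean_value f df a b Hab D) as (t & Ht & E).
  specialize (pos t Ht). nra.
Qed.

Lemma derive_zero_const (f : R -> R) : (forall t : R, is_derive f t 0) -> forall a b, f a = f b.
Proof.
  intros D.
  assert (incr : forall a b, a < b -> f a = f b).
  { intros a b Hab. apply (eq_is_derive f a b); auto. }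
  intros a b. destruct (Rtotal_order a b) as [Hab|[->|Hba]]; auto. symmetry. auto.
Qed.

Lemma gronwall (f df : R -> R) (K a b : R) : a <= b ->
  (forall t : R, a <= t <= b -> is_derive f t (df t)) ->
  (forall t, a <= t <= b -> df t <= K * f t) -> f b <= f a * exp (K * (b - a)).
Proof.
  intros Hab D growth.
  assert (decay : - (f a * exp (- K * (a - a))) <= - (f b * exp (- K * (b - a)))).
  { apply (derive_nonneg_le (fun t => - (f t * exp (- K * (t - a))))
      (fun t => (K * f t - df t) * exp (- K * (t - a)))); auto.
    - intros t Ht. specialize (D t Ht).
      assert (is_derive (fun t => exp (- K * (t - a))) t ((- K * (1 - 0)) * exp (- K * (t - a)))).
      { apply (is_derive_comp_R exp); [apply is_derive_exp|]. derive_by_rules. reflexivity. }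
      derive_by_rules. ring.
    - intros t Ht. specialize (growth t ltac:(lra)). apply Rmult_le_pos; [lra|]. left.
      apply exp_pos. }
  rewrite Rminus_diag, Rmult_0_r, exp_0 in decay.
  replace (- K * (b - a)) with (- (K * (b - a))) in decay by ring. rewrite exp_Ropp in decay.
  apply Rle_div_l; [apply exp_pos|]. unfold Rdiv. lra.
Qed.

Lemma continuity_at (f : R -> R) m e : continuity f -> 0 < e ->
  exists d, 0 < d /\ forall r, Rabs (r - m) < d -> Rabs (f r - f m) < e.
Proof.
  intros C He. destruct (C m e He) as [d [Hd near]]. exists d. split; auto. intros r Hr.
  destruct (Req_dec r m) as [->|N]; [rewrite Rminus_diag, Rabs_R0; auto|].
  apply (near r). split; [split; [exact I|auto]|exact Hr].
Qed.

Lemma nonvanishing_same_sign (f : R -> R) a b : continuity f ->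
  (forall t, Rmin a b <= t <= Rmax a b -> f t <> 0) -> 0 < f a * f b.
Proof.
  intros C nz. apply Rnot_le_lt. intros opposite.
  destruct (IVT_gen f a b 0 C) as [z [Hz Ez]]; [|now apply (nz z)].
  unfold Rmin, Rmax. destruct (Rle_dec (f a) (f b)); split; nra.
Qed.

Lemma first_zero (f : R -> R) a b : continuity f -> a <= b -> 0 < f a -> f b <= 0 ->
  exists m, a < m <= b /\ f m = 0 /\ forall r, a <= r < m -> 0 < f r.
Proof.
  intros C Hab Ha Hb.
  set (positive_up_to := fun s => a <= s /\ forall r, a <= r <= s -> 0 < f r).
  assert (start : positive_up_to a). { split; [lra|]. intros r Hr. now replace r with a by lra. }
  assert (bounded : forall s, positive_up_to s -> s < b).
  { intros s [_ Hs]. apply Rnot_le_lt. intro. specialize (Hs b ltac:(lra)). lra. }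
  destruct (completeness positive_up_to) as [m [upper least]].
  { exists b. intros s Hs. left. auto. } { now exists a. }
  assert (before : forall r, a <= r < m -> 0 < f r).
  { intros r Hr. apply Rnot_le_lt. intro. assert (m <= r); [|lra].
    apply least. intros s [_ Hs]. apply Rnot_lt_le. intro. specialize (Hs r ltac:(lra)). lra. }
  assert (Ham : a <= m) by auto.
  assert (Hmb : m <= b) by (apply least; intros s Hs; left; auto).
  destruct (Rtotal_order (f m) 0) as [neg|[zero|pos]].
  - exfalso. destruct (continuity_at f m (- f m) C ltac:(lra)) as (d & Hd & near).
    assert (a < m). { destruct Ham as [|<-]; auto. lra. }
    assert (Rmax a (m - d / 2) < m) by (apply Rmax_lub_lt; lra).
    pose proof (Rmax_l a (m - d / 2)). pose proof (Rmax_r a (m - d / 2)).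
    specialize (near (Rmax a (m - d / 2)) ltac:(apply Rabs_def1; lra)).
    apply Rabs_def2 in near. specialize (before (Rmax a (m - d / 2)) ltac:(lra)). lra.
  - exists m. split; [split; auto|auto]. destruct Ham as [|<-]; auto. lra.
  - exfalso. destruct (continuity_at f m (f m) C ltac:(lra)) as (d & Hd & near).
    assert (m + d / 2 <= m); [|lra]. apply upper. split; [lra|]. intros r Hr.
    destruct (Rlt_dec r m); [apply before; lra|].
    specialize (near r ltac:(apply Rabs_def1; lra)). apply Rabs_def2 in near. lra.
Qed.

Lemma derive_nonpos_at_zero (f : R -> R) a m D : is_derive f m D -> a < m -> f m = 0 ->
  (forall r, a <= r < m -> 0 < f r) -> D <= 0.
Proof.
  intros Df Ham fm pos. apply Rnot_lt_le. intro HD. apply is_derive_Reals in Df.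
  destruct (Df D HD) as [d Hd]. pose proof (cond_pos d).
  set (h := Rmin (d / 2) (m - a)). assert (Hh : 0 < h) by (apply Rmin_pos; lra).
  assert (h <= d / 2) by apply Rmin_l. assert (h <= m - a) by apply Rmin_r.
  specialize (Hd (- h) ltac:(lra)). rewrite Rabs_Ropp, Rabs_right in Hd by lra.
  specialize (Hd ltac:(lra)). apply Rabs_def2 in Hd. specialize (pos (m + - h) ltac:(lra)).
  rewrite fm, Rminus_0_r in Hd.
  replace (f (m + - h) / - h) with (- (f (m + - h) / h)) in Hd by (field; lra).
  pose proof (Rdiv_lt_0_compat _ _ pos Hh). lra.
Qed.

Lemma barrier (f df : R -> R) B a b : (forall t : R, is_derive f t (df t)) ->
  (forall t, a <= t <= b -> B < f t -> df t <= 0) -> a <= b -> f a <= B -> f b <= B.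
Proof.
  intros D decr Hab Ha. apply Rnot_lt_le. intro Hb.
  destruct (first_zero (fun r => f (- r) - B) (- b) (- a)) as (m & Hm & Em & above).
  - apply (derive_continuity _ (fun r => -1 * df (- r) - 0)). intro r.
    apply is_derive_minus_R; [|apply is_derive_const_R].
    apply (is_derive_comp_R f (fun r => - r)); auto. auto_derive; auto.
  - lra.
  - rewrite Ropp_involutive. lra.
  - rewrite Ropp_involutive. lra.
  - assert (crossing : - f (- m) <= - f b); [|lra].
    apply (derive_nonneg_le (fun t => - f t) (fun t => - df t)); [lra| |].
    + intros t _. derive_by_rules. ring.
    + intros t Ht. specialize (above (- t) ltac:(lra)). rewrite Ropp_involutive in above.
      specialize (decr t ltac:(lra) ltac:(lra)). lra.
Qed.

Lemma is_derive_inverse (f s : R -> R) (t0 D : R) : is_derive f (s t0) D -> D <> 0 ->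
  (forall t, f (s t) = t) -> continuity_pt s t0 -> is_derive s t0 (/ D).
Proof.
  intros Df HD inverse Cs. apply is_derive_Reals in Df. apply is_derive_Reals. intros e He.
  pose proof (Rabs_pos_lt D HD) as A. assert (Heta : 0 < Rmin (Rabs D / 2) (e * Rabs D ^ 2 / 2)).
  { apply Rmin_pos; [lra|]. assert (0 < Rabs D ^ 2) by nra. nra. }
  destruct (Df _ Heta) as [d quot]. destruct (Cs d (cond_pos d)) as (d' & Hd' & near).
  exists (mkposreal d' Hd'). intros h Nh Hh. simpl in Hh. set (z := s (t0 + h) - s t0).
  assert (Ez : f (s t0 + z) - f (s t0) = h).
  { unfold z. replace (s t0 + (s (t0 + h) - s t0)) with (s (t0 + h)) by ring. rewrite !inverse.
    ring. }
  assert (Nz : z <> 0). { intro Z. rewrite Z, Rplus_0_r in Ez. lra. }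
  assert (Hz : Rabs z < d).
  { apply (near (t0 + h)). split; [split; [exact I|lra]|]. simpl. unfold R_dist.
    now replace (t0 + h - t0) with h by ring. }
  specialize (quot z Nz Hz). rewrite Ez in quot.
  pose proof (Rmin_l (Rabs D / 2) (e * Rabs D ^ 2 / 2)).
  pose proof (Rmin_r (Rabs D / 2) (e * Rabs D ^ 2 / 2)).
  assert (slope : Rabs D / 2 <= Rabs (h / z)).
  { pose proof (Rabs_triang_inv D (D - h / z)) as T.
    replace (D - (D - h / z)) with (h / z) in T by ring.
    rewrite (Rabs_minus_sym D) in T. lra. }
  replace (z / h - / D) with (- ((h / z - D) / (D * (h / z)))) by (field; repeat split; auto).
  rewrite Rabs_Ropp, Rabs_div, Rabs_mult.
  2:{ apply Rmult_integral_contrapositive_currified; auto.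
      apply Rmult_integral_contrapositive_currified; auto.
      now apply Rinv_neq_0_compat. }
  apply <- Rlt_div_l; [|nra].
  assert (e * Rabs D * (Rabs D / 2) <= e * Rabs D * Rabs (h / z)); [|lra].
  apply Rmult_le_compat_l; nra.
Qed.

Lemma ln_le_inv x y : 0 < x -> 0 < y -> ln x <= ln y -> x <= y.
Proof.
  intros Hx Hy H. apply Rnot_lt_le. intro L. pose proof (ln_increasing y x Hy L). lra.
Qed.

Lemma Rabs_div_le (a b m n : R) : 0 < n -> n <= b -> Rabs a <= m -> Rabs (a / b) <= m / n.
Proof.
  intros Hn Hb Ha. rewrite Rabs_div, (Rabs_right b) by lra.
  apply Rmult_le_compat; auto using Rabs_pos.
  - left. apply Rinv_0_lt_compat. lra.
  - apply Rinv_le_contravar; lra.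
Qed.

Lemma linear_diff_eq a b K : (forall t, 0 <= t -> Rabs (a * t - b * t) <= K) -> a = b.
Proof.
  intros bounded. destruct (Req_dec a b) as [|N]; auto. exfalso.
  assert (gap : 0 < Rabs (a - b)) by (apply Rabs_pos_lt; lra).
  assert (HK : 0 <= K). { eapply Rle_trans; [apply Rabs_pos|apply (bounded 0); lra]. }
  specialize (bounded ((K + 1) / Rabs (a - b)) ltac:(apply Rdiv_le_0_compat; lra)).
  rewrite <- Rmult_minus_distr_r, Rabs_mult, (Rabs_right (_ / _)) in bounded
    by (apply Rle_ge, Rdiv_le_0_compat; lra).
  replace (Rabs (a - b) * ((K + 1) / Rabs (a - b))) with (K + 1) in bounded by (field; lra). lra.
Qed.

(** * Convergence in the plane *)

Definition close_to (q w : R * R) (e : R) : Prop :=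
  Rabs (fst q - fst w) < e /\ Rabs (snd q - snd w) < e.

Lemma close_to_of_sq q w e : 0 < e -> (fst q - fst w) ^ 2 + (snd q - snd w) ^ 2 < e ^ 2 ->
  close_to q w e.
Proof.
  intros He H. pose proof (pow2_ge_0 (fst q - fst w)). pose proof (pow2_ge_0 (snd q - snd w)).
  split; apply Rabs_def1; apply Rnot_le_lt; intro; nra.
Qed.

Lemma sq_lt_of_close_to q w e : close_to q w (e / 2) ->
  (fst q - fst w) ^ 2 + (snd q - snd w) ^ 2 < e ^ 2.
Proof. intros [Hx Hy]. apply Rabs_def2 in Hx, Hy. nra. Qed.

Lemma close_to_weaken q w d e : close_to q w d -> d <= e -> close_to q w e.
Proof. unfold close_to. lra. Qed.

Lemma close_to_trans q v w d e : close_to q v d -> close_to v w e -> close_to q w (d + e).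
Proof.
  intros [Hx Hy] [Hx' Hy']. apply Rabs_def2 in Hx, Hy, Hx', Hy'.
  split; apply Rabs_def1; lra.
Qed.

Lemma close_to_sym q w e : close_to q w e -> close_to w q e.
Proof. intros [Hx Hy]. split; now rewrite Rabs_minus_sym. Qed.

Lemma close_to_eq q w : (forall e, 0 < e -> close_to q w e) -> q = w.
Proof.
  intros near. rewrite (surjective_pairing q), (surjective_pairing w).
  f_equal; apply cond_eq; intros e He; now apply near.
Qed.

Definition ultimately (Q : R -> Prop) : Prop := exists T, forall t, T <= t -> Q t.

Lemma ultimately_and (Q Q' : R -> Prop) :
  ultimately Q -> ultimately Q' -> ultimately (fun t => Q t /\ Q' t).
Proof.
  intros [T HT] [T' HT']. exists (Rmax T T'). intros t Ht.
  pose proof (Rmax_l T T'). pose proof (Rmax_r T T'). split; [apply HT|apply HT']; lra.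
Qed.

Lemma ultimately_exists (Q : R -> Prop) T0 : ultimately Q -> exists t, T0 <= t /\ Q t.
Proof. intros [T HT]. exists (Rmax T0 T). split; [apply Rmax_l|apply HT, Rmax_r]. Qed.

Lemma conv_to_close g w v d e T : conv_to g w -> d < e ->
  (forall t, T <= t -> close_to (g t) v d) -> close_to w v e.
Proof.
  intros C Hde near. destruct (C (e - d) ltac:(lra)) as [T' HT'].
  replace e with ((e - d) + d) by ring. apply close_to_trans with (g (Rmax T T')).
  - apply close_to_sym, HT', Rmax_r.
  - apply near, Rmax_l.
Qed.

(** * Hyperbolic functions *)

Lemma exp_mult_opp y : exp y * exp (- y) = 1.
Proof. rewrite <- exp_plus, Rplus_opp_r. apply exp_0. Qed.

Lemma exp_le a b : a <= b -> exp a <= exp b.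
Proof. intros [H| ->]; [left; now apply exp_increasing|lra]. Qed.

Lemma cosh_sq y : cosh y ^ 2 = 1 + sinh y ^ 2.
Proof. unfold cosh, sinh. pose proof (exp_mult_opp y). nra. Qed.

Lemma sinh_pos y : 0 < y -> 0 < sinh y.
Proof. intros H. rewrite <- sinh_0. apply sinh_lt, H. Qed.

Lemma cosh_ge_1 y : 1 <= cosh y.
Proof.
  unfold cosh. pose proof (exp_mult_opp y). pose proof (exp_pos y).
  pose proof (pow2_ge_0 (exp y - exp (- y))). apply Rnot_lt_le. intro. nra.
Qed.

Lemma cosh_gt_1 y : 0 < y -> 1 < cosh y.
Proof.
  intros H. pose proof (sinh_pos y H). pose proof (cosh_sq y). pose proof (cosh_ge_1 y). nra.
Qed.

Lemma is_derive_cosh y : is_derive cosh y (sinh y).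
Proof. apply is_derive_Reals, derivable_pt_lim_cosh. Qed.

Lemma is_derive_sinh y : is_derive sinh y (cosh y).
Proof. apply is_derive_Reals, derivable_pt_lim_sinh. Qed.

Lemma cosh_lt a b : 0 <= a -> a < b -> cosh a < cosh b.
Proof.
  intros Ha Hab. apply (derive_pos_lt cosh sinh); auto.
  - intros t _. apply is_derive_cosh.
  - intros t Ht. apply sinh_pos. lra.
Qed.

Lemma cosh_le a b : 0 <= a -> a <= b -> cosh a <= cosh b.
Proof. intros Ha [H| ->]; [left; now apply cosh_lt|lra]. Qed.

Lemma cosh_lt_inv a b : 0 <= b -> cosh a < cosh b -> a < b.
Proof.
  intros Hb H. apply Rnot_le_lt. intro Hba. pose proof (cosh_le b a Hb Hba). lra.
Qed.

Lemma sinh_le_cosh y : sinh y <= cosh y.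
Proof. unfold sinh, cosh. pose proof (exp_pos (- y)). lra. Qed.

Lemma sinh_ge_id y : 0 <= y -> y <= sinh y.
Proof.
  intros Hy. enough (sinh 0 - 0 <= sinh y - y) by (rewrite sinh_0 in *; lra).
  apply (derive_nonneg_le (fun y => sinh y - y) (fun y => cosh y - 1)); auto.
  - intros t _. pose proof (is_derive_sinh t). derive_by_rules. reflexivity.
  - intros t _. pose proof (cosh_ge_1 t). lra.
Qed.

Lemma sinh_le_id_cosh y : 0 <= y -> sinh y <= y * cosh y.
Proof.
  intros Hy. enough (0 * cosh 0 - sinh 0 <= y * cosh y - sinh y) by (rewrite sinh_0 in *; lra).
  apply (derive_nonneg_le (fun y => y * cosh y - sinh y) (fun y => y * sinh y)); auto.
  - intros t _. pose proof (is_derive_sinh t). pose proof (is_derive_cosh t).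
    derive_by_rules. ring.
  - intros t Ht. pose proof (sinh_pos t ltac:(lra)). nra.
Qed.

Lemma cosh_minus_1_le y U : 0 < y -> cosh y <= U -> cosh y - 1 <= U ^ 2 * y.
Proof.
  intros Hy HU. pose proof (cosh_sq y). pose proof (cosh_gt_1 y Hy). pose proof (sinh_pos y Hy).
  pose proof (sinh_le_id_cosh y ltac:(lra)).
  assert (sinh y * sinh y <= U * (U * y)) by (apply Rmult_le_compat; nra). nra.
Qed.

Definition acosh (u : R) : R := ln (u + sqrt (u ^ 2 - 1)).

Lemma exp_acosh u : 1 <= u -> exp (acosh u) = u + sqrt (u ^ 2 - 1).
Proof. intros H. apply exp_ln. pose proof (sqrt_pos (u ^ 2 - 1)). lra. Qed.

Lemma exp_opp_acosh u : 1 <= u -> exp (- acosh u) = u - sqrt (u ^ 2 - 1).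
Proof.
  intros H. pose proof (exp_pos (acosh u)) as pos. pose proof (exp_mult_opp (acosh u)) as E.
  pose proof (pow2_sqrt (u ^ 2 - 1) ltac:(nra)). rewrite exp_acosh in * by auto.
  apply (Rmult_eq_reg_l (u + sqrt (u ^ 2 - 1))); [|lra]. rewrite E. nra.
Qed.

Lemma cosh_acosh u : 1 <= u -> cosh (acosh u) = u.
Proof. intros H. unfold cosh. rewrite exp_acosh, exp_opp_acosh by auto. field. Qed.

Lemma sinh_acosh u : 1 <= u -> sinh (acosh u) = sqrt (u ^ 2 - 1).
Proof. intros H. unfold sinh. rewrite exp_acosh, exp_opp_acosh by auto. field. Qed.

Lemma acosh_cosh y : 0 <= y -> acosh (cosh y) = y.
Proof.
  intros Hy. unfold acosh. rewrite cosh_sq.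
  replace (1 + sinh y ^ 2 - 1) with (sinh y ^ 2) by ring.
  rewrite sqrt_pow2 by (pose proof (sinh_ge_id y Hy); lra).
  rewrite <- (ln_exp y) at 3. f_equal. unfold cosh, sinh. field.
Qed.

Lemma cosh_inj a b : 0 <= a -> 0 <= b -> cosh a = cosh b -> a = b.
Proof. intros Ha Hb E. rewrite <- (acosh_cosh a), <- (acosh_cosh b), E; auto. Qed.

Lemma acosh_pos u : 1 < u -> 0 < acosh u.
Proof.
  intros H. unfold acosh. rewrite <- ln_1. pose proof (sqrt_pos (u ^ 2 - 1)).
  apply ln_increasing; lra.
Qed.

Lemma acosh_ln_bounds u : 1 <= u -> ln u <= acosh u <= ln 2 + ln u.
Proof.
  intros H. unfold acosh. rewrite <- ln_mult by lra.
  assert (sqrt (u ^ 2 - 1) <= u).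
  { rewrite <- (sqrt_pow2 u) at 2 by lra. apply sqrt_le_1_alt. lra. }
  pose proof (sqrt_pos (u ^ 2 - 1)). split; apply ln_le; lra.
Qed.

Lemma is_derive_acosh u : 1 < u -> is_derive acosh u (/ sqrt (u ^ 2 - 1)).
Proof.
  intros H. assert (pos : 0 < u ^ 2 - 1) by nra. pose proof (sqrt_lt_R0 _ pos).
  unfold acosh. apply is_derive_eq with ((1 + 2 * u * 1 / (2 * sqrt (u ^ 2 - 1))) / (u + sqrt (u ^ 2 - 1))).
  - apply (is_derive_ln_comp (fun u => u + sqrt (u ^ 2 - 1))); [lra|].
    apply is_derive_plus_R; [apply is_derive_id_R|].
    apply (is_derive_sqrt (fun u => u ^ 2 - 1)); auto. derive_by_rules. ring.
  - field. lra.
Qed.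

(** * The conformal factor *)

Lemma P_sinh y : 0 < y -> P y = (3 + sinh y ^ 2) / (4 * sinh y ^ 2).
Proof.
  intros H. pose proof (sinh_pos y H) as Hs. unfold P, sinh in *.
  pose proof (exp_mult_opp y) as E. rewrite exp_Ropp in *.
  replace (4 * y) with (y + y + y + y) by ring. replace (2 * y) with (y + y) by ring.
  rewrite !exp_plus. pose proof (exp_pos y). set (a := exp y) in *. clearbody a.
  assert (Ha : 1 < a) by nra. field. repeat split; nra.
Qed.

Lemma is_derive_P y : 0 < y -> is_derive P y (- (3 / 2) * cosh y / sinh y ^ 3).
Proof.
  intros H. apply is_derive_ext_loc with (f := fun y => (3 + sinh y ^ 2) / (4 * sinh y ^ 2)).
  - exists (mkposreal y H). intros z Hz. symmetry. apply P_sinh.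
    change (Rabs (z - y) < y) in Hz. apply Rabs_def2 in Hz. lra.
  - pose proof (sinh_pos y H). auto_derive.
    + intro E. nra.
    + field. lra.
Qed.

Lemma P_split y : 0 < y -> P y = 1 / 4 + 3 / 4 * (/ sinh y) ^ 2.
Proof. intros H. rewrite P_sinh by auto. pose proof (sinh_pos y H). field. lra. Qed.

Lemma P_ge_quarter y : 0 < y -> 1 / 4 <= P y.
Proof. intros H. rewrite P_split by auto. pose proof (pow2_ge_0 (/ sinh y)). lra. Qed.

Lemma P_ge_hyperbolic y : 0 < y -> / (4 * y ^ 2) <= P y.
Proof.
  intros H. rewrite P_sinh by auto. pose proof (sinh_pos y H) as Hs.
  pose proof (sinh_le_id_cosh y ltac:(lra)). pose proof (cosh_sq y).
  assert (sinh y ^ 2 <= y ^ 2 * (1 + sinh y ^ 2)).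
  { replace (1 + sinh y ^ 2) with (cosh y ^ 2) by auto. rewrite <- Rpow_mult_distr.
    apply pow_incr. lra. }
  apply Rle_div_r; [nra|]. apply (Rmult_le_reg_l (y ^ 2)); [nra|].
  replace (y ^ 2 * (/ (4 * y ^ 2) * (4 * sinh y ^ 2))) with (sinh y ^ 2) by (field; lra). nra.
Qed.

Lemma P_le_sq y : 0 < y -> P y <= (1 / 2 + / y) ^ 2.
Proof.
  intros H. rewrite P_split by auto. pose proof (sinh_ge_id y ltac:(lra)).
  pose proof (Rinv_0_lt_compat (sinh y) ltac:(lra)).
  assert (/ sinh y <= / y) by (apply Rinv_le_contravar; lra). nra.
Qed.

(** * The equation [u'' = l u] *)

Definition gcos (l s : R) : R :=
  if Rlt_dec l 0 then cos (sqrt (- l) * s) else cosh (sqrt l * s).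

Definition gsin (l s : R) : R :=
  if Rlt_dec l 0 then sin (sqrt (- l) * s) / sqrt (- l)
  else if Rlt_dec 0 l then sinh (sqrt l * s) / sqrt l else s.

Lemma gcos_0 l : gcos l 0 = 1.
Proof. unfold gcos. rewrite !Rmult_0_r, cos_0, cosh_0. now destruct Rlt_dec. Qed.

Lemma gsin_0 l : gsin l 0 = 0.
Proof.
  unfold gsin. rewrite !Rmult_0_r, sin_0, sinh_0.
  repeat destruct Rlt_dec; unfold Rdiv; ring.
Qed.

Lemma is_derive_gcos l s : is_derive (gcos l) s (l * gsin l s).
Proof.
  unfold gcos, gsin. destruct Rlt_dec as [neg|nonneg]; [|destruct Rlt_dec as [pos|npos]].
  - pose proof (sqrt_lt_R0 (- l) ltac:(lra)). pose proof (sqrt_sqrt (- l) ltac:(lra)) as E.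
    auto_derive; auto. replace l with (- (sqrt (- l) * sqrt (- l))) at 3 by lra. field. lra.
  - pose proof (sqrt_lt_R0 l pos). pose proof (sqrt_sqrt l ltac:(lra)) as E.
    auto_derive; auto. rewrite <- E at 3. field. lra.
  - replace l with 0 by lra. rewrite sqrt_0. auto_derive; auto. ring.
Qed.

Lemma is_derive_gsin l s : is_derive (gsin l) s (gcos l s).
Proof.
  unfold gcos, gsin. destruct Rlt_dec as [neg|nonneg]; [|destruct Rlt_dec as [pos|npos]].
  - pose proof (sqrt_lt_R0 (- l) ltac:(lra)). auto_derive; auto. field. lra.
  - pose proof (sqrt_lt_R0 l pos). auto_derive; auto. field. lra.
  - replace l with 0 by lra. rewrite sqrt_0, Rmult_0_l, cosh_0. apply is_derive_id_R.
Qed.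

Lemma gcos_neg_sq n s : 0 < n -> gcos (- n ^ 2) s = cos (n * s).
Proof.
  intros Hn. unfold gcos. destruct Rlt_dec; [|nra].
  now rewrite Ropp_involutive, sqrt_pow2 by lra.
Qed.

Lemma gsin_neg_sq n s : 0 < n -> gsin (- n ^ 2) s = sin (n * s) / n.
Proof.
  intros Hn. unfold gsin. destruct Rlt_dec; [|nra].
  now rewrite Ropp_involutive, sqrt_pow2 by lra.
Qed.

Lemma gcos_sq_arg n s : 0 <= n -> gcos (n ^ 2) s = cosh (n * s).
Proof. intros Hn. unfold gcos. destruct Rlt_dec; [nra|]. now rewrite sqrt_pow2. Qed.

Lemma gcos_sq l s : gcos l s ^ 2 = 1 + l * gsin l s ^ 2.
Proof.
  enough (gcos l s ^ 2 - l * gsin l s ^ 2 = gcos l 0 ^ 2 - l * gsin l 0 ^ 2)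
    by (rewrite gcos_0, gsin_0 in *; lra).
  apply (derive_zero_const (fun s => gcos l s ^ 2 - l * gsin l s ^ 2)). intro t.
  pose proof (is_derive_gcos l t). pose proof (is_derive_gsin l t). derive_by_rules. ring.
Qed.

Lemma gcos_le_1 l s : l <= 0 -> gcos l s <= 1.
Proof. intros Hl. pose proof (gcos_sq l s). nra. Qed.

Lemma gsin_pos l s : - PI ^ 2 < l -> 0 < s <= 1 -> 0 < gsin l s.
Proof.
  intros Hl Hs. pose proof PI_RGT_0. unfold gsin.
  destruct Rlt_dec as [neg|nonneg]; [|destruct Rlt_dec as [pos|npos]].
  - pose proof (sqrt_lt_R0 (- l) ltac:(lra)).
    assert (sqrt (- l) < PI).
    { rewrite <- (sqrt_pow2 PI) by lra. apply sqrt_lt_1_alt. lra. }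
    apply Rdiv_lt_0_compat; auto. apply sin_gt_0; nra.
  - pose proof (sqrt_lt_R0 l pos). apply Rdiv_lt_0_compat; auto. apply sinh_pos. nra.
  - lra.
Qed.

Lemma gsin_nonneg l s : 0 <= l -> 0 <= s -> 0 <= gsin l s.
Proof.
  intros Hl Hs. unfold gsin. destruct Rlt_dec; [lra|]. destruct Rlt_dec as [pos|]; [|auto].
  pose proof (sqrt_lt_R0 l pos). apply Rdiv_le_0_compat; auto.
  pose proof (sinh_ge_id (sqrt l * s)). nra.
Qed.

Lemma gcos_nonneg l s : 0 <= l -> 0 <= gcos l s.
Proof.
  intros Hl. unfold gcos. destruct Rlt_dec; [lra|]. pose proof (cosh_ge_1 (sqrt l * s)). lra.
Qed.

(* The solution of [u'' = l u] with [u 0 = a] and [u' 0 = b], and its derivative. *)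
Definition osc (l a b s : R) : R := a * gcos l s + b * gsin l s.

Definition dosc (l a b s : R) : R := l * a * gsin l s + b * gcos l s.

Lemma osc_0 l a b : osc l a b 0 = a.
Proof. unfold osc. rewrite gcos_0, gsin_0. ring. Qed.

Lemma dosc_0 l a b : dosc l a b 0 = b.
Proof. unfold dosc. rewrite gcos_0, gsin_0. ring. Qed.

Lemma is_derive_osc l a b s : is_derive (osc l a b) s (dosc l a b s).
Proof.
  unfold osc, dosc. pose proof (is_derive_gcos l s). pose proof (is_derive_gsin l s).
  derive_by_rules. ring.
Qed.

Lemma is_derive_dosc l a b s : is_derive (dosc l a b) s (l * osc l a b s).
Proof.
  unfold osc, dosc. pose proof (is_derive_gcos l s). pose proof (is_derive_gsin l s).
  derive_by_rules. ring.
Qed.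

Lemma continuity_osc l a b : continuity (osc l a b).
Proof. exact (derive_continuity _ _ (is_derive_osc l a b)). Qed.

Lemma continuity_dosc l a b : continuity (dosc l a b).
Proof. exact (derive_continuity _ _ (is_derive_dosc l a b)). Qed.

Lemma osc_energy l a b s : dosc l a b s ^ 2 - l * osc l a b s ^ 2 = b ^ 2 - l * a ^ 2.
Proof.
  replace (dosc l a b s ^ 2 - l * osc l a b s ^ 2) with
    ((b ^ 2 - l * a ^ 2) * (gcos l s ^ 2 - l * gsin l s ^ 2)) by (unfold osc, dosc; ring).
  rewrite gcos_sq. ring.
Qed.

(* The rate [m] allows for a change of time [s] along which the equation is solved. *)
Lemma osc_time_change l (s m u v : R -> R) : (forall t : R, is_derive s t (m t)) ->
  (forall t : R, is_derive u t (v t * m t)) -> (forall t : R, is_derive v t (l * u t * m t)) ->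
  s 0 = 0 ->
  forall t, u t = osc l (u 0) (v 0) (s t) /\ v t = dosc l (u 0) (v 0) (s t).
Proof.
  intros Ds Du Dv s0 t.
  assert (Dcos : forall t : R, is_derive (fun t => gcos l (s t)) t (m t * (l * gsin l (s t)))).
  { intro r. apply is_derive_comp_R; [apply is_derive_gcos|auto]. }
  assert (Dsin : forall t : R, is_derive (fun t => gsin l (s t)) t (m t * gcos l (s t))).
  { intro r. apply is_derive_comp_R; [apply is_derive_gsin|auto]. }
  assert (first_integral : u t * gcos l (s t) - v t * gsin l (s t) = u 0).
  { transitivity (u 0 * gcos l (s 0) - v 0 * gsin l (s 0)).
    - apply (derive_zero_const (fun t => u t * gcos l (s t) - v t * gsin l (s t))).
      intro r. derive_by_rules. ring.
    - rewrite s0, gcos_0, gsin_0. ring. }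
  assert (second_integral : v t * gcos l (s t) - l * (u t * gsin l (s t)) = v 0).
  { transitivity (v 0 * gcos l (s 0) - l * (u 0 * gsin l (s 0))).
    - apply (derive_zero_const (fun t => v t * gcos l (s t) - l * (u t * gsin l (s t)))).
      intro r. derive_by_rules. ring.
    - rewrite s0, gcos_0, gsin_0. ring. }
  pose proof (gcos_sq l (s t)) as E. rewrite <- first_integral, <- second_integral.
  unfold osc, dosc. split.
  - transitivity (u t * (gcos l (s t) ^ 2 - l * gsin l (s t) ^ 2)); [rewrite E|]; ring.
  - transitivity (v t * (gcos l (s t) ^ 2 - l * gsin l (s t) ^ 2)); [rewrite E|]; ring.
Qed.

Lemma osc_affine l a b s0 k r :
  osc l a b (s0 + k * r) = osc (k ^ 2 * l) (osc l a b s0) (k * dosc l a b s0) r /\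
  k * dosc l a b (s0 + k * r) = dosc (k ^ 2 * l) (osc l a b s0) (k * dosc l a b s0) r.
Proof.
  assert (Daff : forall r : R, is_derive (fun r => s0 + k * r) r k).
  { intro t. derive_by_rules. ring. }
  pose proof (osc_time_change (k ^ 2 * l) (fun r => r) (fun _ => 1) (fun r => osc l a b (s0 + k * r))
    (fun r => k * dosc l a b (s0 + k * r))) as H. cbv beta in H.
  rewrite Rmult_0_r, Rplus_0_r in H. apply H; auto using is_derive_id_R.
  - intro t. rewrite Rmult_1_r. apply is_derive_comp_R; auto. apply is_derive_osc.
  - intro t. apply is_derive_eq with (k * (k * (l * osc l a b (s0 + k * t)))); [|ring].
    apply is_derive_scal_R, (is_derive_comp_R (dosc l a b)); auto. apply is_derive_dosc.
Qed.

Lemma gsin_affine_unit l s k r : k ^ 2 = 1 ->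
  gsin l (s + k * r) = gsin l s * gcos l r + k * gcos l s * gsin l r.
Proof.
  intros Hk. destruct (osc_affine l 0 1 s k r) as [E _]. rewrite Hk, Rmult_1_l in E.
  unfold osc, dosc in E. lra.
Qed.

Lemma sturm_comparison k l a b c X : k < l -> 0 < a -> b <= c -> 0 < X ->
  (forall r, 0 <= r <= X -> 0 < osc k a b r) -> (forall r, 0 <= r <= X -> 0 < osc l a c r) ->
  osc k a b X < osc l a c X.
Proof.
  intros Hkl Ha Hbc HX pos_k pos_l.
  set (u := osc k a b) in *. set (v := osc l a c) in *. set (du := dosc k a b).
  set (dv := dosc l a c).
  pose proof (is_derive_osc k a b : forall r, is_derive u r (du r)) as Du.
  pose proof (is_derive_osc l a c : forall r, is_derive v r (dv r)) as Dv.
  pose proof (is_derive_dosc k a b : forall r, is_derive du r (k * u r)) as Ddu.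
  pose proof (is_derive_dosc l a c : forall r, is_derive dv r (l * v r)) as Ddv.
  assert (E0 : u 0 = a /\ v 0 = a /\ du 0 = b /\ dv 0 = c).
  { unfold u, v, du, dv. now rewrite !osc_0, !dosc_0. }
  destruct E0 as (u0 & v0 & du0 & dv0). clearbody u v du dv.
  assert (wronskian_pos : forall r, 0 < r <= X -> 0 < dv r * u r - v r * du r).
  { intros r Hr. apply Rle_lt_trans with (dv 0 * u 0 - v 0 * du 0).
    { rewrite u0, v0, du0, dv0. nra. }
    apply (derive_pos_lt (fun r => dv r * u r - v r * du r) (fun r => (l - k) * (u r * v r))); [lra| |].
    - intros t _. derive_by_rules. ring.
    - intros t Ht. pose proof (pos_k t ltac:(lra)). pose proof (pos_l t ltac:(lra)).
      apply Rmult_lt_0_compat; nra. }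
  assert (log_ratio : ln (v 0) - ln (u 0) < ln (v X) - ln (u X)).
  { apply (derive_pos_lt (fun r => ln (v r) - ln (u r)) (fun r => dv r / v r - du r / u r)); auto.
    - intros t Ht. apply is_derive_minus_R; apply is_derive_ln_comp; auto.
    - intros t Ht. pose proof (pos_k t ltac:(lra)). pose proof (pos_l t ltac:(lra)).
      replace (dv t / v t - du t / u t) with ((dv t * u t - v t * du t) / (u t * v t)) by (field; lra).
      apply Rdiv_lt_0_compat; [apply wronskian_pos; lra|nra]. }
  rewrite u0, v0 in log_ratio. apply ln_lt_inv; [apply pos_k|apply pos_l|]; lra.
Qed.

Lemma gcos_gsin_bound l K s : Rabs l <= K -> 0 <= s <= 1 ->
  gcos l s ^ 2 + gsin l s ^ 2 <= exp (1 + K).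
Proof.
  intros Hl Hs. apply Rabs_le_between in Hl.
  assert (G : gcos l s ^ 2 + gsin l s ^ 2 <= (gcos l 0 ^ 2 + gsin l 0 ^ 2) * exp ((1 + K) * (s - 0))).
  { apply (gronwall (fun s => gcos l s ^ 2 + gsin l s ^ 2)
      (fun s => 2 * (1 + l) * (gcos l s * gsin l s))); [lra| |].
    - intros t _. pose proof (is_derive_gcos l t). pose proof (is_derive_gsin l t).
      derive_by_rules. ring.
    - intros t _. pose proof (pow2_ge_0 (gcos l t - gsin l t)).
      pose proof (pow2_ge_0 (gcos l t + gsin l t)). nra. }
  rewrite gcos_0, gsin_0 in G. eapply Rle_trans; [exact G|].
  rewrite pow1, pow_i, Rplus_0_r, Rmult_1_l by lia. apply exp_le. nra.
Qed.

(* Duhamel's formula: [gcos l s * gcos k (1 - s) + l * gsin l s * gsin k (1 - s)] interpolates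
   between [gcos k 1] and [gcos l 1], and similarly for [gsin]. *)
Lemma gcos_gsin_lipschitz k l K : Rabs k <= K -> Rabs l <= K ->
  Rabs (gcos l 1 - gcos k 1) <= exp (1 + K) * Rabs (l - k) /\
  Rabs (gsin l 1 - gsin k 1) <= exp (1 + K) * Rabs (l - k).
Proof.
  intros Hk Hl.
  assert (Dcos : forall s : R, is_derive (gcos l) s (l * gsin l s)) by apply is_derive_gcos.
  assert (Dsin : forall s : R, is_derive (gsin l) s (gcos l s)) by apply is_derive_gsin.
  assert (Drev : forall s : R, is_derive (fun s => 1 - s) s (-1)).
  { intro s. derive_by_rules. ring. }
  assert (Dcos' : forall s : R, is_derive (fun s => gcos k (1 - s)) s (-1 * (k * gsin k (1 - s)))).
  { intro s. apply is_derive_comp_R; auto. apply is_derive_gcos. }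
  assert (Dsin' : forall s : R, is_derive (fun s => gsin k (1 - s)) s (-1 * gcos k (1 - s))).
  { intro s. apply is_derive_comp_R; auto. apply is_derive_gsin. }
  split.
  - destruct (mean_value (fun s => gcos l s * gcos k (1 - s) + l * (gsin l s * gsin k (1 - s)))
      (fun s => (l - k) * (gcos l s * gsin k (1 - s))) 0 1 ltac:(lra)) as (s & Hs & E).
    { intros s _. derive_by_rules. ring. }
    rewrite Rminus_0_r, Rminus_diag, !gcos_0, !gsin_0 in E.
    pose proof (gcos_gsin_bound l K s Hl ltac:(lra)).
    pose proof (gcos_gsin_bound k K (1 - s) Hk ltac:(lra)).
    replace (gcos l 1 - gcos k 1) with ((gcos l s * gsin k (1 - s)) * (l - k)) by lra.
    rewrite Rabs_mult. apply Rmult_le_compat_r; [apply Rabs_pos|]. apply Rabs_le. nra.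
  - destruct (mean_value (fun s => gsin l s * gcos k (1 - s) + gcos l s * gsin k (1 - s))
      (fun s => (l - k) * (gsin l s * gsin k (1 - s))) 0 1 ltac:(lra)) as (s & Hs & E).
    { intros s _. derive_by_rules. ring. }
    rewrite Rminus_0_r, Rminus_diag, !gcos_0, !gsin_0 in E.
    pose proof (gcos_gsin_bound l K s Hl ltac:(lra)).
    pose proof (gcos_gsin_bound k K (1 - s) Hk ltac:(lra)).
    replace (gsin l 1 - gsin k 1) with ((gsin l s * gsin k (1 - s)) * (l - k)) by lra.
    rewrite Rabs_mult. apply Rmult_le_compat_r; [apply Rabs_pos|]. apply Rabs_le. nra.
Qed.

Lemma lipschitz_on_bounded_continuity (f : R -> R) :
  (forall K, exists M, forall k l, Rabs k <= K -> Rabs l <= K -> Rabs (f l - f k) <= M * Rabs (l - k)) ->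
  continuity f.
Proof.
  intros lipschitz k e He. destruct (lipschitz (Rabs k + 1)) as [M HM].
  pose proof (Rabs_pos M). pose proof (Rle_abs M).
  exists (Rmin 1 (e / (Rabs M + 1))). split; [apply Rmin_pos; [lra|apply Rdiv_lt_0_compat; lra]|].
  intros l [_ Hl]. simpl in *. unfold R_dist in *.
  pose proof (Rmin_l 1 (e / (Rabs M + 1))). pose proof (Rmin_r 1 (e / (Rabs M + 1))).
  assert (close : Rabs (l - k) * (Rabs M + 1) < e) by (apply <- Rlt_div_r; lra).
  assert (Rabs l <= Rabs k + 1).
  { replace l with (k + (l - k)) by ring. eapply Rle_trans; [apply Rabs_triang|lra]. }
  specialize (HM k l ltac:(lra) ltac:(lra)). pose proof (Rabs_pos (l - k)). nra.
Qed.

Lemma gcos_continuity_param : continuity (fun l => gcos l 1).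
Proof.
  apply lipschitz_on_bounded_continuity. intro K. exists (exp (1 + K)). intros k l Hk Hl.
  now apply gcos_gsin_lipschitz.
Qed.

Lemma gsin_continuity_param : continuity (fun l => gsin l 1).
Proof.
  apply lipschitz_on_bounded_continuity. intro K. exists (exp (1 + K)). intros k l Hk Hl.
  now apply gcos_gsin_lipschitz.
Qed.

(** * A boundary value problem *)

Lemma osc_gt_1_of_nonneg k a v x r : 0 <= k -> - x ^ 2 < k -> 1 < a ->
  v ^ 2 = 3 * x ^ 2 + k * (a ^ 2 + 2) -> 1 <= osc k a v 1 -> 0 <= r < 1 -> 1 < osc k a v r.
Proof.
  intros Hk Hxk Ha Ev H1 Hr.
  assert (nz : forall s, dosc k a v s <> 0).
  { intros s Z. pose proof (osc_energy k a v s) as E. rewrite Z in E.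
    assert (0 <= k * osc k a v s ^ 2) by nra. nra. }
  assert (same_sign : forall s, 0 < v * dosc k a v s).
  { intro s. rewrite <- (dosc_0 k a v) at 1.
    apply nonvanishing_same_sign; auto using continuity_dosc. }
  destruct (Rlt_dec 0 v) as [rising|falling].
  - apply Rlt_le_trans with (osc k a v 0); [now rewrite osc_0|].
    apply (derive_nonneg_le _ (dosc k a v)); [lra|intros; apply is_derive_osc|].
    intros s _. specialize (same_sign s). nra.
  - apply Rle_lt_trans with (osc k a v 1); auto. apply Ropp_lt_cancel.
    apply (derive_pos_lt (fun s => - osc k a v s) (fun s => - dosc k a v s)); [lra| |].
    + intros s _. apply is_derive_opp_R, is_derive_osc.
    + intros s _. specialize (same_sign s). nra.
Qed.

Lemma osc_gt_1_of_neg k a v r : - PI ^ 2 < k <= 0 -> 1 < a -> 1 <= osc k a v 1 ->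
  0 <= r < 1 -> 1 < osc k a v r.
Proof.
  intros Hk Ha H1 Hr.
  assert (interpolation : osc k a v r * gsin k 1 = a * gsin k (1 - r) + osc k a v 1 * gsin k r).
  { replace (1 - r) with (1 + -1 * r) by ring. rewrite gsin_affine_unit by ring. unfold osc. ring. }
  pose proof (gsin_pos k 1 ltac:(lra) ltac:(lra)) as S1.
  pose proof (gsin_pos k (1 - r) ltac:(lra) ltac:(lra)) as Sr'.
  assert (Sr : 0 <= gsin k r).
  { destruct (Req_dec r 0) as [->|]; [rewrite gsin_0; lra|]. left. apply gsin_pos; lra. }
  assert (subadditive : gsin k 1 <= gsin k (1 - r) + gsin k r).
  { replace 1 with ((1 - r) + 1 * r) at 1 by ring. rewrite gsin_affine_unit by ring.
    pose proof (gcos_le_1 k r ltac:(lra)). pose proof (gcos_le_1 k (1 - r) ltac:(lra)). nra. }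
  apply (Rmult_lt_reg_r (gsin k 1)); auto. nra.
Qed.

(* The value prescribed by [osc k a v 1 = b] and [v ^ 2 = 3 * x ^ 2 + k * (a ^ 2 + 2)] is
   [a ^ 2 + b ^ 2]. *)
Definition chord_function (a b x k : R) : R :=
  (3 * x ^ 2 + 2 * k) * gsin k 1 ^ 2 + 2 * a * b * gcos k 1.

Lemma chord_function_continuity a b x : continuity (chord_function a b x).
Proof.
  intro k. unfold chord_function. pose proof (gcos_continuity_param k).
  pose proof (gsin_continuity_param k).
  assert (lin : continuity_pt (fun k => 3 * x ^ 2 + 2 * k) k).
  { apply (is_derive_continuity_pt _ _ (0 + 2 * 1)). derive_by_rules. reflexivity. }
  apply (continuity_pt_plus (fun k => (3 * x ^ 2 + 2 * k) * gsin k 1 ^ 2) (fun k => 2 * a * b * gcos k 1)).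
  - apply (continuity_pt_mult (fun k => 3 * x ^ 2 + 2 * k) (fun k => gsin k 1 ^ 2)); auto.
    apply (continuity_pt_comp (fun k => gsin k 1) (fun z => z ^ 2)); auto.
    apply derivable_continuous_pt, derivable_pt_pow.
  - now apply (continuity_pt_scal (fun k => gcos k 1)).
Qed.

Lemma chord_function_low a b x : 1 < a -> 1 <= b -> (x, b) <> (0, a) ->
  chord_function a b x (- Rmin (x ^ 2) (PI ^ 2)) < a ^ 2 + b ^ 2.
Proof.
  intros Ha Hb N. pose proof PI_RGT_0. unfold chord_function.
  assert (1 < a * b) by nra. pose proof (pow2_ge_0 (a - b)).
  unfold Rmin. destruct Rle_dec as [small|large].
  - destruct (Req_dec x 0) as [->|Nx].
    + assert (a <> b) by congruence.
      replace (- 0 ^ 2) with (0 ^ 2) by ring. rewrite gcos_sq_arg, Rmult_0_l, cosh_0 by lra. nra.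
    + rewrite <- (pow2_abs x) in *. pose proof (Rabs_pos_lt x Nx). set (n := Rabs x) in *.
      rewrite gcos_neg_sq, gsin_neg_sq, Rmult_1_r by auto.
      assert (cos n < 1). { rewrite <- cos_0. apply cos_decreasing_1; nra. }
      pose proof (sin2_cos2 n) as E. unfold Rsqr in E.
      replace ((3 * n ^ 2 + 2 * - n ^ 2) * (sin n / n) ^ 2) with (sin n * sin n) by (field; lra).
      nra.
  - rewrite gcos_neg_sq, gsin_neg_sq, Rmult_1_r, cos_PI, sin_PI by auto. nra.
Qed.

Lemma chord_function_high a b x : 1 < a -> 1 <= b ->
  a ^ 2 + b ^ 2 <= chord_function a b x ((a ^ 2 + b ^ 2) ^ 2).
Proof.
  intros Ha Hb. unfold chord_function. set (n := a ^ 2 + b ^ 2). assert (0 < n) by (unfold n; nra).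
  rewrite gcos_sq_arg, Rmult_1_r by lra.
  pose proof (sinh_ge_id n ltac:(lra)). pose proof (sinh_le_cosh n).
  assert (0 <= (3 * x ^ 2 + 2 * n ^ 2) * gsin (n ^ 2) 1 ^ 2) by (apply Rmult_le_pos; nra).
  assert (n * 1 <= cosh n * (2 * a * b)) by (apply Rmult_le_compat; nra). lra.
Qed.

Theorem boundary_value_problem a b x : 1 < a -> 1 <= b -> (x, b) <> (0, a) ->
  exists k v, - x ^ 2 < k /\ v ^ 2 = 3 * x ^ 2 + k * (a ^ 2 + 2) /\ osc k a v 1 = b /\
    forall r, 0 <= r < 1 -> 1 < osc k a v r.
Proof.
  intros Ha Hb N. set (low := - Rmin (x ^ 2) (PI ^ 2)).
  pose proof (Rmin_l (x ^ 2) (PI ^ 2)). pose proof (Rmin_r (x ^ 2) (PI ^ 2)).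
  pose proof (chord_function_low a b x Ha Hb N) as Hlow. fold low in Hlow.
  pose proof (chord_function_high a b x Ha Hb) as Hhigh.
  assert (low <= 0). { unfold low. pose proof (pow2_ge_0 x). pose proof (pow2_ge_0 PI).
    apply Ropp_le_cancel. rewrite Ropp_involutive, Ropp_0. now apply Rmin_glb. }
  destruct (IVT_gen (chord_function a b x) low ((a ^ 2 + b ^ 2) ^ 2) (a ^ 2 + b ^ 2)
    (chord_function_continuity a b x)) as (k & Hk & Ek).
  { rewrite Rmin_left, Rmax_right; lra. }
  rewrite Rmin_left, Rmax_right in Hk by nra.
  assert (Hlk : low < k). { destruct Hk as [[|Z] _]; auto. rewrite Z in Hlow. lra. }
  assert (S1 : 0 < gsin k 1) by (apply gsin_pos; unfold low in Hlk; lra).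
  set (v := (b - a * gcos k 1) / gsin k 1).
  assert (Ev : v ^ 2 = 3 * x ^ 2 + k * (a ^ 2 + 2)).
  { apply (Rmult_eq_reg_r (gsin k 1 ^ 2)); [|nra]. rewrite <- Rpow_mult_distr.
    replace (v * gsin k 1) with (b - a * gcos k 1) by (unfold v; field; lra).
    unfold chord_function in Ek. pose proof (gcos_sq k 1) as E.
    transitivity (b ^ 2 - 2 * a * b * gcos k 1 + a ^ 2 * gcos k 1 ^ 2); [ring|]. rewrite E. lra. }
  assert (Eb : osc k a v 1 = b) by (unfold osc, v; field; lra).
  exists k, v. split; [unfold low in Hlk; lra|]. split; auto. split; auto. intros r Hr.
  destruct (Rle_dec 0 k).
  - apply (osc_gt_1_of_nonneg k a v x); auto; unfold low in Hlk; lra.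
  - apply osc_gt_1_of_neg; auto; unfold low in Hlk; lra.
Qed.

(** * Geodesics as trajectories of a first order system *)

Definition xcoord (g : R -> R * R) (t : R) : R := fst (g t).

Definition ycoord (g : R -> R * R) (t : R) : R := snd (g t).

Definition ucoord (g : R -> R * R) (t : R) : R := cosh (ycoord g t).

Lemma coords_eq (g g' : R -> R * R) t : g' t = g t ->
  xcoord g' t = xcoord g t /\ ycoord g' t = ycoord g t /\ ucoord g' t = ucoord g t.
Proof. unfold ucoord, ycoord, xcoord. now intros ->. Qed.

(* [ds/dt] as a function of [u = cosh y]. *)
Definition srate (u : R) : R := 2 * (u ^ 2 - 1) / (u ^ 2 + 2).

Definition lam (c : R) : R := 1 - 4 * c ^ 2.

Definition unit_speed (c u p : R) : Prop := p ^ 2 = 3 + lam c * (u ^ 2 - 1).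

(* [c] is the Clairaut constant and [p] is [du/ds]. *)
Definition trajectory (c : R) (g : R -> R * R) (p : R -> R) : Prop :=
  forall t, 0 < ycoord g t /\
    is_derive (xcoord g) t (2 * c * srate (ucoord g t)) /\
    is_derive (ucoord g) t (p t * srate (ucoord g t)) /\
    is_derive p t (lam c * ucoord g t * srate (ucoord g t)) /\
    unit_speed c (ucoord g t) (p t).

Lemma lam_le_1 c : lam c <= 1.
Proof. unfold lam. nra. Qed.

Lemma sqrt_lam_le_1 c : sqrt (lam c) <= 1.
Proof. rewrite <- sqrt_1. apply sqrt_le_1_alt, lam_le_1. Qed.

Lemma lam_opp c : lam (- c) = lam c.
Proof. unfold lam. ring. Qed.

Lemma lam_nonneg_Rabs c : 0 <= lam c -> Rabs (2 * c) <= 1.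
Proof. unfold lam. intros H. apply Rabs_le. nra. Qed.

Lemma continuity_lam : continuity lam.
Proof. apply ex_derive_continuity. intro c. unfold lam. auto_derive. auto. Qed.

Lemma srate_pos u : 1 < u -> 0 < srate u.
Proof. intros H. unfold srate. apply Rdiv_lt_0_compat; nra. Qed.

Lemma srate_split u : srate u = 2 - 6 * / (u ^ 2 + 2).
Proof. unfold srate. field. nra. Qed.

Lemma srate_lt_2 u : srate u < 2.
Proof. rewrite srate_split. pose proof (Rinv_0_lt_compat (u ^ 2 + 2) ltac:(nra)). lra. Qed.

Lemma srate_le a b : 1 < a -> a <= b -> srate a <= srate b.
Proof.
  intros Ha Hab. rewrite !srate_split.
  pose proof (Rinv_le_contravar (a ^ 2 + 2) (b ^ 2 + 2) ltac:(nra) ltac:(nra)). lra.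
Qed.

Lemma is_derive_srate u : is_derive srate u (12 * u / (u ^ 2 + 2) ^ 2).
Proof. unfold srate. auto_derive; [nra|]. field. nra. Qed.

Lemma srate_lipschitz a b : Rabs (srate a - srate b) <= 2 * Rabs (a - b).
Proof.
  apply (bounded_variation srate (fun u => 12 * u / (u ^ 2 + 2) ^ 2)).
  intros t _. split; [apply is_derive_srate|].
  pose proof (pow2_ge_0 (t - 3 / 4)). pose proof (pow2_ge_0 (t + 3 / 4)).
  assert (0 < (t ^ 2 + 2) ^ 2) by nra.
  apply Rabs_le. split; [apply -> Rle_div_r|apply <- Rle_div_l]; nra.
Qed.

Lemma srate_cosh y : srate (cosh y) = 2 * sinh y ^ 2 / (3 + sinh y ^ 2).
Proof. unfold srate. rewrite cosh_sq. field. nra. Qed.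

Section GeodesicEquations.

Variables (g : R -> R * R) (dP vx vy ax ay : R -> R).

Hypothesis derive_P : forall y, 0 < y -> derivable_pt_lim P y (dP y).
Hypothesis equations : forall t, 0 < ycoord g t /\
  derivable_pt_lim (xcoord g) t (vx t) /\ derivable_pt_lim (ycoord g) t (vy t) /\
  derivable_pt_lim vx t (ax t) /\ derivable_pt_lim vy t (ay t) /\
  ax t + dP (ycoord g t) / P (ycoord g t) * vx t * vy t = 0 /\
  ay t + dP (ycoord g t) / (2 * P (ycoord g t)) * (vy t ^ 2 - vx t ^ 2) = 0 /\
  P (ycoord g t) * (vx t ^ 2 + vy t ^ 2) = 1.

Let c := P (ycoord g 0) * vx 0.
Let p t := 2 * sinh (ycoord g t) * P (ycoord g t) * vy t.

Lemma derive_along_geodesic : forall t : R,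
  is_derive (xcoord g) t (vx t) /\ is_derive (ycoord g) t (vy t) /\ is_derive vx t (ax t) /\
  is_derive vy t (ay t) /\ is_derive (fun t => P (ycoord g t)) t (vy t * dP (ycoord g t)).
Proof.
  intro t. destruct (equations t) as (Hy & Dx & Dy & Dvx & Dvy & _).
  apply is_derive_Reals in Dx, Dy, Dvx, Dvy.
  split; [auto|split; [auto|split; [auto|split; [auto|]]]].
  apply is_derive_comp_R; auto. now apply is_derive_Reals, derive_P.
Qed.

Lemma dP_explicit t : dP (ycoord g t) = - (3 / 2) * cosh (ycoord g t) / sinh (ycoord g t) ^ 3.
Proof.
  destruct (equations t) as [Hy _]. rewrite <- (is_derive_unique P _ _ (is_derive_P _ Hy)).
  symmetry. now apply is_derive_unique, is_derive_Reals, derive_P.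
Qed.

Lemma clairaut t : P (ycoord g t) * vx t = c.
Proof.
  apply (derive_zero_const (fun t => P (ycoord g t) * vx t)). intro r.
  destruct (equations r) as (Hy & _ & _ & _ & _ & E & _).
  destruct (derive_along_geodesic r) as (_ & _ & Dvx & _ & DP). pose proof (P_ge_quarter _ Hy).
  derive_by_rules. replace (ax r) with (- (dP (ycoord g r) / P (ycoord g r) * vx r * vy r)) by lra.
  field. lra.
Qed.

Lemma horizontal_velocity t : vx t = 2 * c * srate (ucoord g t).
Proof.
  destruct (equations t) as [Hy _]. pose proof (sinh_pos _ Hy). rewrite <- (clairaut t).
  unfold ucoord. rewrite srate_cosh, P_sinh by auto. field. split; nra.
Qed.

Lemma vertical_velocity t : vy t * sinh (ycoord g t) = p t * srate (ucoord g t).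
Proof.
  destruct (equations t) as [Hy _]. pose proof (sinh_pos _ Hy).
  unfold p, ucoord. rewrite srate_cosh, P_sinh by auto. field. split; nra.
Qed.

Lemma vertical_energy t : P (ycoord g t) * vy t ^ 2 = 1 - c ^ 2 / P (ycoord g t).
Proof.
  destruct (equations t) as (Hy & _ & _ & _ & _ & _ & _ & E).
  rewrite <- (clairaut t). field_simplify_eq; nra.
Qed.

Lemma unit_speed_of_geodesic t : unit_speed c (ucoord g t) (p t).
Proof.
  destruct (equations t) as [Hy _]. pose proof (sinh_pos _ Hy). unfold unit_speed, p.
  transitivity (4 * sinh (ycoord g t) ^ 2 * P (ycoord g t) * (P (ycoord g t) * vy t ^ 2)); [ring|].
  rewrite vertical_energy, P_sinh by auto. unfold ucoord, lam. rewrite cosh_sq.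
  field. split; nra.
Qed.

Lemma derive_momentum t : is_derive p t (lam c * ucoord g t * srate (ucoord g t)).
Proof.
  destruct (equations t) as (Hy & _ & _ & _ & _ & _ & E & speed).
  destruct (derive_along_geodesic t) as (_ & Dy & _ & Dvy & DP).
  pose proof (sinh_pos _ Hy). pose proof (P_ge_quarter _ Hy).
  assert (Dsinh : is_derive (fun t => sinh (ycoord g t)) t (vy t * cosh (ycoord g t))).
  { apply is_derive_comp_R; auto. apply is_derive_sinh. }
  unfold p. derive_by_rules. unfold ucoord. set (y := ycoord g t) in *.
  transitivity (2 * cosh y * (P y * vy t ^ 2) + sinh y * dP y / P y * (P y * (vx t ^ 2 + vy t ^ 2))).
  - replace (ay t) with (- (dP y / (2 * P y) * (vy t ^ 2 - vx t ^ 2))) by lra. field. lra.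
  - unfold y in *. rewrite speed, vertical_energy, dP_explicit, srate_cosh, P_sinh by auto.
    unfold lam. field. split; nra.
Qed.

Lemma trajectory_of_equations : trajectory c g p.
Proof.
  intro t. destruct (derive_along_geodesic t) as (Dx & Dy & _). split; [apply equations|].
  split; [now rewrite <- horizontal_velocity|]. split.
  - rewrite <- vertical_velocity. apply (is_derive_comp_R cosh (ycoord g)); auto.
    apply is_derive_cosh.
  - split; [apply derive_momentum|apply unit_speed_of_geodesic].
Qed.

End GeodesicEquations.

Lemma geodesic_trajectory g : geodesic g -> exists c p, trajectory c g p.
Proof.
  intros (dP & vx & vy & ax & ay & derive_P & equations). do 2 eexists.
  exact (trajectory_of_equations g dP vx vy ax ay derive_P equations).
Qed.

Section Trajectory.

Context {c : R} {g : R -> R * R} {p : R -> R}.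
Hypothesis traj : trajectory c g p.

Lemma ycoord_pos t : 0 < ycoord g t.
Proof. apply traj. Qed.

Lemma ucoord_gt_1 t : 1 < ucoord g t.
Proof. apply cosh_gt_1, ycoord_pos. Qed.

Lemma acosh_ucoord t : acosh (ucoord g t) = ycoord g t.
Proof. apply acosh_cosh. pose proof (ycoord_pos t). lra. Qed.

Lemma derive_xcoord (t : R) : is_derive (xcoord g) t (2 * c * srate (ucoord g t)).
Proof. apply traj. Qed.

Lemma derive_ucoord (t : R) : is_derive (ucoord g) t (p t * srate (ucoord g t)).
Proof. apply traj. Qed.

Lemma derive_p (t : R) : is_derive p t (lam c * ucoord g t * srate (ucoord g t)).
Proof. apply traj. Qed.

Lemma trajectory_unit_speed t : unit_speed c (ucoord g t) (p t).
Proof. apply traj. Qed.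

Lemma continuity_p : continuity p.
Proof. exact (derive_continuity _ _ derive_p). Qed.

Lemma trajectory_srate_pos t : 0 < srate (ucoord g t).
Proof. apply srate_pos, ucoord_gt_1. Qed.

Lemma derive_ycoord (t : R) :
  is_derive (ycoord g) t (p t * srate (ucoord g t) / sinh (ycoord g t)).
Proof.
  apply is_derive_ext with (fun t => acosh (ucoord g t)); [apply acosh_ucoord|].
  apply is_derive_eq with (p t * srate (ucoord g t) * / sqrt (ucoord g t ^ 2 - 1)).
  - apply is_derive_comp_R; [apply is_derive_acosh, ucoord_gt_1|apply derive_ucoord].
  - pose proof (ucoord_gt_1 t). now rewrite <- sinh_acosh, acosh_ucoord by lra.
Qed.

Lemma trajectory_geodesic : geodesic g.
Proof.
  pose proof derive_xcoord as Dx. pose proof derive_ycoord as Dy. pose proof derive_p as Dp.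
  set (dsrate := fun t => p t * srate (ucoord g t) * (12 * ucoord g t / (ucoord g t ^ 2 + 2) ^ 2)).
  assert (Ds : forall t : R, is_derive (fun t => srate (ucoord g t)) t (dsrate t)).
  { intro t. apply is_derive_comp_R; [apply is_derive_srate|apply derive_ucoord]. }
  exists (fun y => - (3 / 2) * cosh y / sinh y ^ 3), (fun t => 2 * c * srate (ucoord g t)),
    (fun t => p t * srate (ucoord g t) / sinh (ycoord g t)), (fun t => 2 * c * dsrate t),
    (fun t => ((lam c * ucoord g t * srate (ucoord g t) * srate (ucoord g t) + p t * dsrate t) *
        sinh (ycoord g t) - p t * srate (ucoord g t) *
        (p t * srate (ucoord g t) / sinh (ycoord g t) * ucoord g t)) / sinh (ycoord g t) ^ 2).
  split; [intros y Hy; now apply is_derive_Reals, is_derive_P|]. intro t.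
  pose proof (ycoord_pos t) as Hy. pose proof (sinh_pos _ Hy) as Hs.
  split; [exact Hy|]. split; [now apply is_derive_Reals|]. split; [now apply is_derive_Reals|].
  split; [exact (proj1 (is_derive_Reals _ _ _) (is_derive_scal_R _ (2 * c) _ _ (Ds t)))|]. split.
  { apply is_derive_Reals.
    apply (is_derive_div (fun t => p t * srate (ucoord g t)) (fun t => sinh (ycoord g t))); [| |lra].
    - derive_by_rules. reflexivity.
    - apply (is_derive_comp_R sinh (ycoord g)); auto. apply is_derive_sinh. }
  change (snd (g t)) with (ycoord g t). rewrite P_sinh by auto.
  pose proof (trajectory_unit_speed t) as speed. unfold unit_speed, dsrate, ucoord, lam in *.
  rewrite srate_cosh. rewrite cosh_sq in *.
  set (s := sinh (ycoord g t)) in *. set (u := cosh (ycoord g t)). clearbody s u. split; [|split].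
  - field. split; nra.
  - transitivity (4 * u * s ^ 3 / (3 + s ^ 2) ^ 3 * (3 + (1 - 4 * c ^ 2) * s ^ 2 - p t ^ 2)).
    + field. split; nra.
    + rewrite speed. ring.
  - transitivity ((4 * c ^ 2 * s ^ 2 + p t ^ 2) / (3 + s ^ 2)).
    + field. split; nra.
    + rewrite speed. field. nra.
Qed.

End Trajectory.

(** * The linearizing time *)

Lemma sqrt3_sq : sqrt 3 * sqrt 3 = 3.
Proof. apply sqrt_sqrt. lra. Qed.

Lemma sqrt3_bounds : 1 < sqrt 3 < 2.
Proof. pose proof sqrt3_sq. pose proof (sqrt_pos 3). split; nra. Qed.

Lemma unit_speed_gap c u p : 1 < u -> unit_speed c u p ->
  0 < sqrt 3 * u + p /\ 0 < sqrt 3 * u - p /\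
  (sqrt 3 * u + p) * (sqrt 3 * u - p) = (3 - lam c) * (u ^ 2 - 1).
Proof.
  intros Hu E. pose proof sqrt3_bounds. pose proof (lam_le_1 c).
  assert (prod : (sqrt 3 * u + p) * (sqrt 3 * u - p) = (3 - lam c) * (u ^ 2 - 1)).
  { transitivity (sqrt 3 * sqrt 3 * u ^ 2 - p ^ 2); [ring|]. rewrite sqrt3_sq, E. ring. }
  assert (0 < (sqrt 3 * u + p) * (sqrt 3 * u - p)).
  { rewrite prod. apply Rmult_lt_0_compat; nra. }
  assert (0 < sqrt 3 * u) by nra. repeat split; auto; apply Rnot_le_lt; intro; nra.
Qed.

Lemma unit_speed_Rabs c u p : 1 < u -> unit_speed c u p -> Rabs p < 2 * u.
Proof.
  intros Hu E. destruct (unit_speed_gap c u p Hu E) as (plus & minus & _).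
  pose proof sqrt3_bounds. apply Rabs_def1; nra.
Qed.

Definition lag (u p : R) : R := ln (sqrt 3 * u + p) - ln (sqrt 3 * u - p).

Lemma is_derive_lag c (u p : R -> R) (t m : R) : is_derive u t (p t * m) ->
  is_derive p t (lam c * u t * m) -> 1 < u t -> unit_speed c (u t) (p t) ->
  is_derive (fun t => lag (u t) (p t)) t (- (2 * sqrt 3) * m / (u t ^ 2 - 1)).
Proof.
  intros Du Dp Hu E. destruct (unit_speed_gap c (u t) (p t) Hu E) as (plus & minus & prod).
  unfold lag.
  apply is_derive_eq with
    ((sqrt 3 * (p t * m) + lam c * u t * m) / (sqrt 3 * u t + p t) -
     (sqrt 3 * (p t * m) - lam c * u t * m) / (sqrt 3 * u t - p t)).
  { apply is_derive_minus_R;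
      [apply (is_derive_ln_comp (fun t => sqrt 3 * u t + p t))
      |apply (is_derive_ln_comp (fun t => sqrt 3 * u t - p t))]; auto; derive_by_rules; ring. }
  transitivity (- (2 * sqrt 3) * m * (p t ^ 2 - lam c * u t ^ 2) /
    ((sqrt 3 * u t + p t) * (sqrt 3 * u t - p t))).
  - field. split; lra.
  - rewrite prod, E. field. split; nra.
Qed.

(* The parameter [s], in closed form along a trajectory. *)
Definition stime (g : R -> R * R) (p : R -> R) (t : R) : R :=
  2 * t + sqrt 3 / 2 * (lag (ucoord g t) (p t) - lag (ucoord g 0) (p 0)).

Lemma stime_0 g p : stime g p 0 = 0.
Proof. unfold stime. ring. Qed.

Section LinearizingTime.

Context {c : R} {g : R -> R * R} {p : R -> R}.
Hypothesis traj : trajectory c g p.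

Lemma p_Rabs t : Rabs (p t) < 2 * ucoord g t.
Proof. exact (unit_speed_Rabs c _ _ (ucoord_gt_1 traj t) (trajectory_unit_speed traj t)). Qed.

Lemma derive_stime (t : R) : is_derive (stime g p) t (srate (ucoord g t)).
Proof.
  pose proof (ucoord_gt_1 traj t) as Hu.
  pose proof (is_derive_lag c (ucoord g) p t _ (derive_ucoord traj t) (derive_p traj t) Hu
    (trajectory_unit_speed traj t)).
  unfold stime. derive_by_rules.
  transitivity (2 - sqrt 3 * sqrt 3 * srate (ucoord g t) / (ucoord g t ^ 2 - 1)); [field; nra|].
  rewrite sqrt3_sq. unfold srate. field. split; nra.
Qed.

Lemma stime_lt t t' : t < t' -> stime g p t < stime g p t'.
Proof.
  intros H. apply (derive_pos_lt (stime g p) (fun t => srate (ucoord g t))); auto.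
  - intros r _. apply derive_stime.
  - intros r _. exact (trajectory_srate_pos traj r).
Qed.

Lemma stime_le t t' : t <= t' -> stime g p t <= stime g p t'.
Proof. intros [H| ->]; [left; now apply stime_lt|lra]. Qed.

Lemma xcoord_stime t : xcoord g t = xcoord g 0 + 2 * c * stime g p t.
Proof.
  enough (xcoord g t - 2 * c * stime g p t = xcoord g 0 - 2 * c * stime g p 0)
    by (rewrite stime_0 in *; lra).
  apply (derive_zero_const (fun t => xcoord g t - 2 * c * stime g p t)). intro r.
  pose proof (derive_xcoord traj r). pose proof (derive_stime r). derive_by_rules. ring.
Qed.

Lemma trajectory_osc t :
  ucoord g t = osc (lam c) (ucoord g 0) (p 0) (stime g p t) /\
  p t = dosc (lam c) (ucoord g 0) (p 0) (stime g p t).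
Proof.
  apply (osc_time_change (lam c) (stime g p) (fun t => srate (ucoord g t))).
  - exact derive_stime.
  - exact (derive_ucoord traj).
  - exact (derive_p traj).
  - apply stime_0.
Qed.

Lemma p_sq_ge_3 t : 0 <= lam c -> 3 <= p t ^ 2.
Proof.
  intros L. rewrite (trajectory_unit_speed traj t). pose proof (ucoord_gt_1 traj t).
  assert (0 <= lam c * (ucoord g t ^ 2 - 1)) by (apply Rmult_le_pos; nra). lra.
Qed.

Lemma p_same_sign t t' : 0 <= lam c -> 0 < p t * p t'.
Proof.
  intros L. apply nonvanishing_same_sign; [exact (continuity_p traj)|]. intros r _ Z.
  pose proof (p_sq_ge_3 r L). rewrite Z in *. lra.
Qed.

Lemma ucoord_exp_bound t : 0 <= t -> ucoord g t <= ucoord g 0 * exp (4 * t).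
Proof.
  intros Ht. replace (4 * t) with (4 * (t - 0)) by ring.
  apply (gronwall _ (fun t => p t * srate (ucoord g t))); auto.
  - intros r _. exact (derive_ucoord traj r).
  - intros r _. pose proof (p_Rabs r) as Hp. apply Rabs_def2 in Hp.
    pose proof (trajectory_srate_pos traj r). pose proof (srate_lt_2 (ucoord g r)).
    nra.
Qed.

End LinearizingTime.

(** * Ascending trajectories *)

Definition ascends (c : R) (p : R -> R) : Prop := 0 <= lam c /\ 0 < p 0.

(* Bounds [s - 2 t] on all ascending trajectories that start at height [u0]. *)
Definition lag_bound (u0 : R) : R := ln (6 * u0 ^ 2 / (u0 ^ 2 - 1)).

Lemma lag_between c u0 u p : 1 < u0 -> u0 <= u -> 0 <= p -> unit_speed c u p ->
  0 <= lag u p <= lag_bound u0.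
Proof.
  intros Hu0 Hu Hp E. destruct (unit_speed_gap c u p ltac:(lra) E) as (plus & minus & prod).
  pose proof (lam_le_1 c). pose proof sqrt3_sq.
  unfold lag, lag_bound. split.
  - assert (ln (sqrt 3 * u - p) <= ln (sqrt 3 * u + p)) by (apply ln_le; lra). lra.
  - rewrite <- ln_div by lra. apply ln_le; [now apply Rdiv_lt_0_compat|].
    apply <- Rle_div_l; auto.
    apply (Rmult_le_reg_r (sqrt 3 * u + p)); auto.
    rewrite Rmult_assoc, (Rmult_comm (sqrt 3 * u - p)), prod.
    assert (numerator : (sqrt 3 * u + p) * (sqrt 3 * u + p) <= 12 * u ^ 2) by nra.
    assert (denominator : 2 * (u ^ 2 - 1) <= (3 - lam c) * (u ^ 2 - 1))
      by (apply Rmult_le_compat_r; nra).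
    assert (monotone : 12 * u ^ 2 <= 6 * u0 ^ 2 / (u0 ^ 2 - 1) * (2 * (u ^ 2 - 1))).
    { replace (6 * u0 ^ 2 / (u0 ^ 2 - 1) * (2 * (u ^ 2 - 1))) with
        (12 * u0 ^ 2 * (u ^ 2 - 1) / (u0 ^ 2 - 1)) by (field; nra).
      apply -> Rle_div_r; nra. }
    assert (0 < 6 * u0 ^ 2 / (u0 ^ 2 - 1)) by (apply Rdiv_lt_0_compat; nra). nra.
Qed.

Lemma lag_bound_nonneg u0 : 1 < u0 -> 0 <= lag_bound u0.
Proof.
  intros H. unfold lag_bound. rewrite <- ln_1. apply ln_le; [lra|]. apply -> Rle_div_r; nra.
Qed.

Section Ascending.

Context {c : R} {g : R -> R * R} {p : R -> R}.
Hypothesis traj : trajectory c g p.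
Hypothesis up : ascends c p.

Lemma ascending_p_gt_1 t : 1 < p t.
Proof.
  destruct up as [L p0_pos]. pose proof (p_sq_ge_3 traj t L). pose proof (p_same_sign traj 0 t L).
  assert (0 < p t) by nra. nra.
Qed.

Lemma ascending_ucoord_le t t' : t <= t' -> ucoord g t <= ucoord g t'.
Proof.
  intros Ht. apply (derive_nonneg_le _ (fun t => p t * srate (ucoord g t))); auto.
  - intros r _. exact (derive_ucoord traj r).
  - intros r _. pose proof (ascending_p_gt_1 r). pose proof (trajectory_srate_pos traj r). nra.
Qed.

Lemma ascending_ycoord_le t t' : t <= t' -> ycoord g t <= ycoord g t'.
Proof.
  intros Ht. rewrite <- !(acosh_ucoord traj). pose proof (ucoord_gt_1 traj t).
  pose proof (ascending_ucoord_le t t' Ht). apply Rnot_lt_le. intro.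
  assert (ucoord g t' < ucoord g t); [|lra].
  rewrite <- (cosh_acosh (ucoord g t')), <- (cosh_acosh (ucoord g t)) by lra.
  apply cosh_lt; auto. rewrite (acosh_ucoord traj). left. apply (ycoord_pos traj).
Qed.

Lemma ascending_ucoord_linear t : 0 <= t -> srate (ucoord g 0) * t <= ucoord g t.
Proof.
  intros Ht. pose proof (ucoord_gt_1 traj 0) as Hu.
  enough (ucoord g 0 - srate (ucoord g 0) * 0 <= ucoord g t - srate (ucoord g 0) * t) by lra.
  apply (derive_nonneg_le (fun t => ucoord g t - srate (ucoord g 0) * t)
    (fun t => p t * srate (ucoord g t) - srate (ucoord g 0))); auto.
  - intros r _. pose proof (derive_ucoord traj r). derive_by_rules. ring.
  - intros r Hr. pose proof (srate_le _ _ Hu (ascending_ucoord_le 0 r ltac:(lra))).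
    pose proof (ascending_p_gt_1 r). pose proof (trajectory_srate_pos traj 0). nra.
Qed.

Lemma ascending_stime t : 0 <= t -> Rabs (stime g p t - 2 * t) <= lag_bound (ucoord g 0).
Proof.
  intros Ht. pose proof (ucoord_gt_1 traj 0) as Hu.
  assert (between : forall r, 0 <= r -> 0 <= lag (ucoord g r) (p r) <= lag_bound (ucoord g 0)).
  { intros r Hr. pose proof (ascending_p_gt_1 r).
    apply (lag_between c); [auto|now apply ascending_ucoord_le|lra|].
    exact (trajectory_unit_speed traj r). }
  pose proof (between 0 ltac:(lra)). pose proof (between t Ht). pose proof sqrt3_bounds.
  unfold stime. apply Rabs_le. nra.
Qed.

Lemma ascending_xcoord t : 0 <= t ->
  Rabs (xcoord g t - 2 * t * (2 * c)) <= Rabs (xcoord g 0) + lag_bound (ucoord g 0).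
Proof.
  intros Ht. rewrite (xcoord_stime traj t).
  replace (xcoord g 0 + 2 * c * stime g p t - 2 * t * (2 * c)) with
    (xcoord g 0 + 2 * c * (stime g p t - 2 * t)) by ring.
  eapply Rle_trans; [apply Rabs_triang|]. apply Rplus_le_compat_l. rewrite Rabs_mult.
  pose proof (ascending_stime t Ht). pose proof (lam_nonneg_Rabs c (proj1 up)).
  pose proof (Rabs_pos (stime g p t - 2 * t)). nra.
Qed.

Lemma log_momentum_stime t : 0 < lam c ->
  ln (p t + sqrt (lam c) * ucoord g t) =
  ln (p 0 + sqrt (lam c) * ucoord g 0) + sqrt (lam c) * stime g p t.
Proof.
  intros L. pose proof (sqrt_lt_R0 _ L). pose proof (sqrt_sqrt (lam c) ltac:(lra)) as E.
  set (k := sqrt (lam c)) in *.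
  enough (ln (p t + k * ucoord g t) - k * stime g p t = ln (p 0 + k * ucoord g 0) - k * stime g p 0)
    by (rewrite stime_0 in *; lra).
  apply (derive_zero_const (fun t => ln (p t + k * ucoord g t) - k * stime g p t)). intro r.
  pose proof (ascending_p_gt_1 r). pose proof (ucoord_gt_1 traj r).
  assert (pos : 0 < p r + k * ucoord g r) by nra.
  assert (Dq : is_derive (fun t => p t + k * ucoord g t) r
    (lam c * ucoord g r * srate (ucoord g r) + k * (p r * srate (ucoord g r)))).
  { pose proof (derive_ucoord traj r). pose proof (derive_p traj r). derive_by_rules. reflexivity. }
  pose proof (is_derive_ln_comp (fun t => p t + k * ucoord g t) r _ pos Dq).
  pose proof (derive_stime traj r). derive_by_rules. rewrite <- E. field. lra.
Qed.

Lemma log_momentum_bounds t : 0 < lam c ->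
  ln (sqrt (lam c)) + ln (ucoord g t) <= ln (p t + sqrt (lam c) * ucoord g t)
    <= ln 3 + ln (ucoord g t).
Proof.
  intros L. pose proof (sqrt_lt_R0 _ L). pose proof (sqrt_lam_le_1 c).
  pose proof (ascending_p_gt_1 t).
  pose proof (p_Rabs traj t) as Hp. apply Rabs_def2 in Hp.
  rewrite <- !ln_mult by lra. split; apply ln_le; nra.
Qed.

Lemma ascending_ycoord t : 0 < lam c -> 0 <= t ->
  Rabs (ycoord g t - 2 * t * sqrt (lam c)) <=
    ln (6 * ucoord g 0) - ln (sqrt (lam c)) + lag_bound (ucoord g 0).
Proof.
  intros L Ht. pose proof (ascending_stime t Ht) as S. apply Rabs_le_between in S.
  pose proof (log_momentum_stime t L). pose proof (log_momentum_bounds t L).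
  pose proof (log_momentum_bounds 0 L). pose proof (ucoord_gt_1 traj t).
  pose proof (acosh_ln_bounds (ucoord g t) ltac:(lra)) as Y. rewrite (acosh_ucoord traj) in Y.
  pose proof (ucoord_gt_1 traj 0). pose proof (sqrt_lt_R0 _ L) as Hk.
  pose proof (sqrt_lam_le_1 c) as k_le_1.
  replace (6 * ucoord g 0) with (2 * (3 * ucoord g 0)) by ring. rewrite !ln_mult by lra.
  pose proof (ln_increasing 1 (ucoord g 0) ltac:(lra) ltac:(lra)).
  rewrite ln_1 in *.
  assert (- lag_bound (ucoord g 0) <= sqrt (lam c) * (stime g p t - 2 * t) <= lag_bound (ucoord g 0))
    by (split; nra).
  apply Rabs_le. lra.
Qed.

Lemma ascending_y_to_infty : y_to_infty g.
Proof.
  intros M. pose proof (trajectory_srate_pos traj 0) as Hs.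
  pose proof (Rmax_l M 0). pose proof (cosh_ge_1 (Rmax M 0)).
  assert (0 <= cosh (Rmax M 0) / srate (ucoord g 0)) by (apply Rdiv_le_0_compat; lra).
  exists (cosh (Rmax M 0) / srate (ucoord g 0) + 1). intros t Ht.
  pose proof (ascending_ucoord_linear t ltac:(lra)).
  assert (cosh (Rmax M 0) < t * srate (ucoord g 0)) by (apply -> Rlt_div_l; lra).
  apply Rle_lt_trans with (Rmax M 0); auto. apply cosh_lt_inv.
  - left. apply (ycoord_pos traj).
  - change (cosh (snd (g t))) with (ucoord g t). lra.
Qed.

End Ascending.

(** * Descending trajectories *)

Definition descends_from (p : R -> R) (t1 d : R) : Prop := 0 <= t1 /\ 0 < d <= 1 /\ p t1 <= - d.

Section Descending.

Context {c : R} {g : R -> R * R} {p : R -> R} {t1 d : R}.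
Hypothesis traj : trajectory c g p.
Hypothesis down : descends_from p t1 d.

Lemma descending_p_le t : t1 <= t -> p t <= - d.
Proof.
  intros Ht. destruct down as (_ & Hd & Hp). destruct (Rle_dec 0 (lam c)) as [L|L].
  - pose proof (p_sq_ge_3 traj t L). pose proof (p_same_sign traj t1 t L).
    assert (p t < 0) by nra. nra.
  - enough (- p t1 <= - p t) by lra.
    apply (derive_nonneg_le (fun t => - p t) (fun t => - (lam c * ucoord g t * srate (ucoord g t)))); auto.
    + intros r _. apply is_derive_opp_R, (derive_p traj).
    + intros r _. pose proof (ucoord_gt_1 traj r). pose proof (trajectory_srate_pos traj r).
      assert (0 < ucoord g r * srate (ucoord g r)) by nra. nra.
Qed.

Lemma descending_ucoord_le t t' : t1 <= t -> t <= t' -> ucoord g t' <= ucoord g t.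
Proof.
  intros Ht Ht'. apply Ropp_le_cancel.
  apply (derive_nonneg_le (fun t => - ucoord g t) (fun t => - (p t * srate (ucoord g t)))); auto.
  - intros r _. apply is_derive_opp_R, (derive_ucoord traj).
  - intros r Hr. pose proof (descending_p_le r ltac:(lra)).
    pose proof (trajectory_srate_pos traj r).
    destruct down as (_ & Hd & _). nra.
Qed.

Lemma descending_stime t t' : t1 <= t -> t <= t' ->
  stime g p t' - stime g p t <= (ucoord g t - ucoord g t') / d.
Proof.
  intros Ht Ht'. destruct down as (_ & Hd & _). apply -> Rle_div_r; [|lra].
  enough (- d * stime g p t - ucoord g t <= - d * stime g p t' - ucoord g t') by lra.
  apply (derive_nonneg_le (fun t => - d * stime g p t - ucoord g t)
    (fun t => (- p t - d) * srate (ucoord g t))); auto.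
  - intros r _. pose proof (derive_stime traj r). pose proof (derive_ucoord traj r).
    derive_by_rules. ring.
  - intros r Hr. pose proof (descending_p_le r ltac:(lra)).
    pose proof (trajectory_srate_pos traj r).
    nra.
Qed.

Lemma descending_xcoord t t' : t1 <= t -> t <= t' ->
  Rabs (xcoord g t' - xcoord g t) <= Rabs (2 * c) * ((ucoord g t - ucoord g t') / d).
Proof.
  intros Ht Ht'. rewrite (xcoord_stime traj t), (xcoord_stime traj t').
  pose proof (descending_stime t t' Ht Ht'). pose proof (stime_le traj t t' Ht').
  replace (xcoord g 0 + 2 * c * stime g p t' - (xcoord g 0 + 2 * c * stime g p t)) with
    (2 * c * (stime g p t' - stime g p t)) by ring.
  rewrite Rabs_mult, (Rabs_right (_ - _)) by lra. apply Rmult_le_compat_l; auto using Rabs_pos.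
Qed.

Lemma descending_ucoord_limit e : 0 < e ->
  exists T, t1 <= T /\ forall t, T <= t -> ucoord g t < 1 + e.
Proof.
  intros He. pose proof (srate_pos (1 + e) ltac:(lra)) as Hs. destruct down as (_ & Hd & _).
  set (speed := d * srate (1 + e)). assert (Hspeed : 0 < speed) by (unfold speed; nra).
  pose proof (ucoord_gt_1 traj t1).
  assert (delay : 0 < ucoord g t1 / speed) by (apply Rdiv_lt_0_compat; lra).
  set (T := t1 + ucoord g t1 / speed). exists T. split; [unfold T; lra|]. intros t Ht.
  apply Rle_lt_trans with (ucoord g T); [apply descending_ucoord_le; unfold T in *; lra|].
  apply Rnot_le_lt. intros high.
  assert (fall : - speed * t1 - ucoord g t1 <= - speed * T - ucoord g T).
  { apply (derive_nonneg_le (fun t => - speed * t - ucoord g t)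
      (fun t => - p t * srate (ucoord g t) - speed)); [unfold T; lra| |].
    - intros r _. pose proof (derive_ucoord traj r). derive_by_rules. ring.
    - intros r Hr. pose proof (descending_p_le r ltac:(lra)).
      pose proof (descending_ucoord_le r T ltac:(lra) ltac:(lra)).
      pose proof (srate_le (1 + e) (ucoord g r) ltac:(lra) ltac:(lra)). unfold speed. nra. }
  assert (speed * (T - t1) = ucoord g t1) by (unfold T; field; lra). lra.
Qed.

End Descending.

Lemma exists_descends_from (p : R -> R) t : 0 <= t -> p t < 0 -> exists d, descends_from p t d.
Proof.
  intros Ht Hp. exists (Rmin (- p t) 1). pose proof (Rmin_l (- p t) 1).
  pose proof (Rmin_r (- p t) 1).
  pose proof (Rmin_pos (- p t) 1 ltac:(lra) ltac:(lra)). unfold descends_from. lra.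
Qed.

Lemma eventually_p_neg {c g p} : trajectory c g p -> lam c < 0 -> exists t, 0 <= t /\ p t < 0.
Proof.
  intros traj L. apply NNPP. intros N.
  assert (Hp : forall t, 0 <= t -> 0 <= p t).
  { intros t Ht. apply Rnot_lt_le. intro. apply N. now exists t. }
  assert (rise : forall t, 0 <= t -> ucoord g 0 <= ucoord g t).
  { intros t Ht. apply (derive_nonneg_le _ (fun t => p t * srate (ucoord g t))); auto.
    - intros r _. exact (derive_ucoord traj r).
    - intros r Hr. apply Rmult_le_pos; [apply Hp; lra|]. left. apply (trajectory_srate_pos traj). }
  pose proof (ucoord_gt_1 traj 0) as Hu. pose proof (trajectory_srate_pos traj 0).
  set (k := - lam c * (ucoord g 0 * srate (ucoord g 0))).
  assert (Hk : 0 < k) by (apply Rmult_lt_0_compat; nra).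
  set (T := (p 0 + 1) / k).
  assert (HT : 0 <= T) by (apply Rdiv_le_0_compat; auto; specialize (Hp 0); lra).
  assert (fall : - p 0 - k * 0 <= - p T - k * T).
  { apply (derive_nonneg_le (fun t => - p t - k * t)
      (fun t => - (lam c * ucoord g t * srate (ucoord g t)) - k)); auto.
    - intros r _. pose proof (derive_p traj r). derive_by_rules. ring.
    - intros r Hr. specialize (rise r ltac:(lra)). pose proof (srate_le _ _ Hu rise).
      assert (ucoord g 0 * srate (ucoord g 0) <= ucoord g r * srate (ucoord g r))
        by (apply Rmult_le_compat; lra).
      unfold k. nra. }
  assert (k * T = p 0 + 1) by (unfold T; field; lra). specialize (Hp T HT). lra.
Qed.

Lemma ascends_or_descends {c g p} : trajectory c g p ->
  ascends c p \/ exists t1 d, descends_from p t1 d.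
Proof.
  intros traj. unfold ascends. destruct (Rle_dec 0 (lam c)) as [L|L].
  - destruct (Rlt_dec 0 (p 0)) as [|N]; [now left|right]. exists 0.
    apply exists_descends_from; [lra|]. pose proof (p_sq_ge_3 traj 0 L). nra.
  - right. destruct (eventually_p_neg traj ltac:(lra)) as (t & Ht & Hp). exists t.
    now apply exists_descends_from.
Qed.

(** * Landing *)

(* The trajectory reaches the line [y = 0] when [s] tends to [se]. *)
Definition lands (g : R -> R * R) (p : R -> R) (se : R) : Prop :=
  exists t1 d, descends_from p t1 d /\
    forall t, t1 <= t -> 0 <= se - stime g p t <= (ucoord g t - 1) / d.

Definition landing_point (c : R) (g : R -> R * R) (se : R) : R := xcoord g 0 + 2 * c * se.

Lemma descending_lands {c g p t1 d} : trajectory c g p -> descends_from p t1 d ->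
  exists se, lands g p se.
Proof.
  intros traj down. assert (Hd : 0 < d) by apply down.
  assert (future : forall t t', t1 <= t -> stime g p t' <= stime g p t + (ucoord g t - 1) / d).
  { intros t t' Ht. pose proof (ucoord_gt_1 traj t). destruct (Rle_dec t t') as [Htt'|].
    - pose proof (descending_stime traj down t t' Ht Htt').
      assert ((ucoord g t - ucoord g t') / d <= (ucoord g t - 1) / d); [|lra].
      apply Rmult_le_compat_r; [left; now apply Rinv_0_lt_compat|].
      pose proof (ucoord_gt_1 traj t'). lra.
    - pose proof (stime_le traj t' t ltac:(lra)).
      assert (0 <= (ucoord g t - 1) / d) by (apply Rdiv_le_0_compat; lra). lra. }
  destruct (completeness (fun s => exists t, s = stime g p t)) as [se [upper least]].
  { exists (stime g p t1 + (ucoord g t1 - 1) / d). intros s [t ->]. apply future. lra. }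
  { now exists (stime g p 0), 0. }
  exists se, t1, d. split; auto. intros t Ht. split.
  - enough (stime g p t <= se) by lra. apply upper. now exists t.
  - enough (se <= stime g p t + (ucoord g t - 1) / d) by lra. apply least. intros s [t' ->]. auto.
Qed.

Lemma ascends_or_lands {c g p} : trajectory c g p -> ascends c p \/ exists se, lands g p se.
Proof.
  intros traj. destruct (ascends_or_descends traj) as [up|(t1 & d & down)]; [now left|right].
  exact (descending_lands traj down).
Qed.

Section Landing.

Context {c : R} {g : R -> R * R} {p : R -> R} {se : R}.
Hypothesis traj : trajectory c g p.
Hypothesis landing : lands g p se.

Lemma landing_xcoord t : xcoord g t - landing_point c g se = - (2 * c * (se - stime g p t)).
Proof. unfold landing_point. rewrite (xcoord_stime traj t). ring. Qed.

Lemma landing_limits e : 0 < e ->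
  exists T, 0 <= T /\ forall t, T <= t -> Rabs (stime g p t - se) < e /\ ucoord g t < 1 + e.
Proof.
  intros He. destruct landing as (t1 & d & down & near). assert (Hd : 0 < d <= 1) by apply down.
  assert (Ht1 : 0 <= t1) by apply down.
  destruct (descending_ucoord_limit traj down (d * e) ltac:(nra)) as (T & HT & low).
  exists T. split; [lra|]. intros t Ht. specialize (near t ltac:(lra)). specialize (low t Ht).
  assert ((ucoord g t - 1) / d < e) by (apply <- Rlt_div_l; lra).
  split; [apply Rabs_def1; lra|nra].
Qed.

Lemma stime_lt_landing t : stime g p t < se.
Proof.
  apply Rlt_le_trans with (stime g p (t + 1)); [apply (stime_lt traj); lra|].
  destruct landing as (t1 & d & _ & near).
  apply Rle_trans with (stime g p (Rmax t1 (t + 1))); [apply (stime_le traj), Rmax_r|].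
  specialize (near _ (Rmax_l t1 (t + 1))). lra.
Qed.

Lemma landing_time_pos : 0 < se.
Proof. rewrite <- (stime_0 g p). apply stime_lt_landing. Qed.

Lemma landing_before r : 0 <= r < se -> exists t, stime g p t = r.
Proof.
  intros Hr. destruct (landing_limits (se - r) ltac:(lra)) as (T & HT & late).
  destruct (late T ltac:(lra)) as [near _]. apply Rabs_def2 in near.
  destruct (IVT_gen (stime g p) 0 T r) as (t & _ & Et); [|rewrite stime_0|now exists t].
  - exact (derive_continuity _ _ (derive_stime traj)).
  - rewrite Rmin_left, Rmax_right; lra.
Qed.

Lemma landing_osc_gt_1 r : 0 <= r < se -> 1 < osc (lam c) (ucoord g 0) (p 0) r.
Proof.
  intros Hr. destruct (landing_before r Hr) as [t <-].
  rewrite <- (proj1 (trajectory_osc traj t)). apply (ucoord_gt_1 traj).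
Qed.

Lemma landing_osc : osc (lam c) (ucoord g 0) (p 0) se = 1.
Proof.
  set (U := osc (lam c) (ucoord g 0) (p 0)). apply cond_eq. intros e He.
  destruct (continuity_at U se (e / 2) (continuity_osc _ _ _) ltac:(lra)) as (h & Hh & cont).
  destruct (landing_limits (Rmin h (e / 2))) as (T & _ & late); [apply Rmin_pos; lra|].
  destruct (late T ltac:(lra)) as [near low]. pose proof (Rmin_l h (e / 2)).
  pose proof (Rmin_r h (e / 2)).
  specialize (cont (stime g p T) ltac:(lra)). fold (U (stime g p T)) in *. unfold U in cont at 1.
  rewrite <- (proj1 (trajectory_osc traj T)) in cont. pose proof (ucoord_gt_1 traj T).
  apply Rabs_def2 in cont. apply Rabs_def1; lra.
Qed.

Lemma landing_dosc : dosc (lam c) (ucoord g 0) (p 0) se = - sqrt 3.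
Proof.
  set (Q := dosc (lam c) (ucoord g 0) (p 0)).
  assert (falling : Q se <= 0).
  { apply Rnot_lt_le. intros pos.
    destruct (continuity_at Q se (Q se) (continuity_dosc _ _ _) pos) as (h & Hh & cont).
    destruct landing as (t1 & d & down & _). destruct (landing_limits h Hh) as (T & HT & late).
    pose proof (Rmax_l t1 T). pose proof (Rmax_r t1 T).
    destruct (late (Rmax t1 T) ltac:(lra)) as [near _]. specialize (cont _ near).
    unfold Q in cont at 1. rewrite <- (proj2 (trajectory_osc traj _)) in cont.
    pose proof (descending_p_le traj down (Rmax t1 T) ltac:(lra)). apply Rabs_def2 in cont.
    destruct down as (_ & Hd & _). lra. }
  pose proof (osc_energy (lam c) (ucoord g 0) (p 0) se) as E. rewrite landing_osc in E. fold Q in E.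
  pose proof (trajectory_unit_speed traj 0) as E0. unfold unit_speed in E0.
  pose proof sqrt3_sq. pose proof sqrt3_bounds. nra.
Qed.

(* Read backwards from the landing point and with the time scaled to the unit interval, [u] solves
   [u'' = k u] with [k = se ^ 2 - (2 * c * se) ^ 2]. *)
Lemma landing_profile : let k := se ^ 2 - (2 * c * se) ^ 2 in
  osc k 1 (sqrt 3 * se) 1 = ucoord g 0 /\ dosc k 1 (sqrt 3 * se) 1 = - se * p 0 /\
  forall r, 0 <= r <= 1 -> 0 < osc k 1 (sqrt 3 * se) r.
Proof.
  intro k. assert (affine := osc_affine (lam c) (ucoord g 0) (p 0) se (- se)).
  rewrite landing_osc, landing_dosc in affine.
  replace ((- se) ^ 2 * lam c) with k in affine by (unfold k, lam; ring).
  replace (- se * - sqrt 3) with (sqrt 3 * se) in affine by ring.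
  destruct (affine 1) as [U1 Q1]. replace (se + - se * 1) with 0 in U1, Q1 by ring.
  rewrite osc_0 in U1. rewrite dosc_0 in Q1. split; [auto|]. split; [auto|].
  intros r Hr. rewrite <- (proj1 (affine r)). pose proof landing_time_pos.
  destruct (Req_dec r 0) as [->|].
  - replace (se + - se * 0) with se by ring. rewrite landing_osc. lra.
  - pose proof (landing_osc_gt_1 (se + - se * r) ltac:(nra)). lra.
Qed.

Lemma landing_conv_to : conv_to g (landing_point c g se, 0).
Proof.
  intros e He. pose proof (cosh_gt_1 e He). pose proof (Rabs_pos (2 * c)).
  set (h := Rmin (cosh e - 1) (e / (Rabs (2 * c) + 1))).
  assert (Hh : 0 < h) by (apply Rmin_pos; [lra|apply Rdiv_lt_0_compat; lra]).
  destruct (landing_limits h Hh) as (T & _ & late). exists T. intros t Ht.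
  destruct (late t Ht) as [near low]. cbn [fst snd].
  change (fst (g t)) with (xcoord g t). change (snd (g t)) with (ycoord g t). split.
  - rewrite landing_xcoord, Rabs_Ropp, Rabs_mult, Rabs_minus_sym.
    assert (Rabs (stime g p t - se) * (Rabs (2 * c) + 1) < e).
    { apply <- Rlt_div_r; [|lra]. eapply Rlt_le_trans; [exact near|apply Rmin_r]. }
    nra.
  - pose proof (ycoord_pos traj t). rewrite Rminus_0_r, Rabs_right by lra.
    apply cosh_lt_inv; [lra|]. change (cosh (ycoord g t)) with (ucoord g t).
    pose proof (Rmin_l (cosh e - 1) (e / (Rabs (2 * c) + 1)) : h <= _). lra.
Qed.

Lemma landing_xcoord_rate : exists T M, 0 < M /\ forall t, T <= t ->
  Rabs (xcoord g t - landing_point c g se) <= M * ycoord g t.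
Proof.
  destruct landing as (t1 & d & down & near). assert (Hd : 0 < d) by apply down.
  set (U := ucoord g t1). pose proof (Rabs_pos (2 * c)).
  assert (ratio : 0 <= Rabs (2 * c) / d) by (apply Rdiv_le_0_compat; lra).
  exists t1, (Rabs (2 * c) / d * U ^ 2 + 1). split; [nra|]. intros t Ht.
  rewrite landing_xcoord, Rabs_Ropp, Rabs_mult, (Rabs_right (se - _)) by (specialize (near t Ht); lra).
  pose proof (ycoord_pos traj t).
  pose proof (cosh_minus_1_le (ycoord g t) U ltac:(auto) (descending_ucoord_le traj down t1 t (Rle_refl _) Ht)).
  apply Rle_trans with (Rabs (2 * c) / d * (ucoord g t - 1)).
  - replace (Rabs (2 * c) / d * (ucoord g t - 1)) with (Rabs (2 * c) * ((ucoord g t - 1) / d))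
      by (field; lra).
    apply Rmult_le_compat_l; auto. apply near, Ht.
  - change (ucoord g t) with (cosh (ycoord g t)).
    assert (Rabs (2 * c) / d * (cosh (ycoord g t) - 1) <= Rabs (2 * c) / d * (U ^ 2 * ycoord g t))
      by (apply Rmult_le_compat_l; auto). nra.
Qed.

Lemma log_depth t : ln (sinh (ycoord g t)) + 2 / sqrt 3 * t =
  ln (sqrt 3 * ucoord g t - p t) + (lag (ucoord g 0) (p 0) - ln (3 - lam c)) / 2 +
  stime g p t / sqrt 3.
Proof.
  pose proof sqrt3_bounds. pose proof (lam_le_1 c). pose proof (sinh_pos _ (ycoord_pos traj t)).
  destruct (unit_speed_gap c (ucoord g t) (p t) (ucoord_gt_1 traj t) (trajectory_unit_speed traj t))
    as (plus & minus & prod).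
  assert (log_prod : ln (sqrt 3 * ucoord g t + p t) + ln (sqrt 3 * ucoord g t - p t) =
    ln (3 - lam c) + 2 * ln (sinh (ycoord g t))).
  { rewrite <- ln_mult, prod by auto. unfold ucoord. rewrite cosh_sq.
    replace (1 + sinh (ycoord g t) ^ 2 - 1) with (sinh (ycoord g t) * sinh (ycoord g t)) by ring.
    rewrite !ln_mult by nra. ring. }
  assert (log_ratio : stime g p t / sqrt 3 = 2 / sqrt 3 * t +
    (ln (sqrt 3 * ucoord g t + p t) - ln (sqrt 3 * ucoord g t - p t) - lag (ucoord g 0) (p 0)) / 2).
  { unfold stime, lag at 1. field. lra. }
  rewrite log_ratio. lra.
Qed.

Lemma landing_log_depth : exists T K U, 0 <= T /\ forall t, T <= t ->
  Rabs (ln (sinh (ycoord g t)) + 2 / sqrt 3 * t) <= K /\ ucoord g t <= U.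
Proof.
  destruct landing as (t1 & d & down & near). pose proof sqrt3_bounds.
  set (offset := (lag (ucoord g 0) (p 0) - ln (3 - lam c)) / 2).
  exists t1, (ln (4 * ucoord g t1) + Rabs offset + se), (ucoord g t1).
  split; [apply down|]. intros t Ht. pose proof (descending_ucoord_le traj down t1 t ltac:(lra) Ht).
  split; [|auto]. rewrite log_depth. fold offset. pose proof (ucoord_gt_1 traj t).
  pose proof (p_Rabs traj t) as Hp. apply Rabs_def2 in Hp.
  pose proof (descending_p_le traj down t Ht). destruct down as (Ht1 & Hd & _).
  assert (0 <= ln (sqrt 3 * ucoord g t - p t) <= ln (4 * ucoord g t1)).
  { rewrite <- ln_1. split; apply ln_le; nra. }
  pose proof (stime_le traj 0 t ltac:(lra)) as s_nonneg. rewrite stime_0 in s_nonneg.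
  assert (0 <= stime g p t / sqrt 3 <= se).
  { pose proof (stime_lt_landing t). split; [apply Rdiv_le_0_compat; lra|].
    apply <- Rle_div_l; [nra|lra]. }
  pose proof (Rle_abs offset). pose proof (Rle_abs (- offset)). rewrite Rabs_Ropp in *.
  apply Rabs_le. lra.
Qed.

End Landing.

Lemma landing_time_not_lt {c1 g1 p1 s1 c2 g2 p2 s2} :
  trajectory c1 g1 p1 -> trajectory c2 g2 p2 -> lands g1 p1 s1 -> lands g2 p2 s2 ->
  ucoord g1 0 = ucoord g2 0 -> 2 * c1 * s1 = 2 * c2 * s2 -> ~ s1 < s2.
Proof.
  intros traj1 traj2 land1 land2 same_height same_distance Hlt.
  destruct (landing_profile traj1 land1) as (end1 & _ & pos1).
  destruct (landing_profile traj2 land2) as (end2 & _ & pos2).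
  pose proof (landing_time_pos traj1 land1). pose proof sqrt3_bounds.
  rewrite <- same_distance in end2, pos2.
  pose proof (sturm_comparison (s1 ^ 2 - (2 * c1 * s1) ^ 2) (s2 ^ 2 - (2 * c1 * s1) ^ 2) 1
    (sqrt 3 * s1) (sqrt 3 * s2) 1 ltac:(nra) ltac:(lra) ltac:(nra) ltac:(lra) pos1 pos2). lra.
Qed.

Lemma landing_direction_unique {c1 g1 p1 s1 c2 g2 p2 s2} :
  trajectory c1 g1 p1 -> trajectory c2 g2 p2 -> lands g1 p1 s1 -> lands g2 p2 s2 ->
  g1 0 = g2 0 -> landing_point c1 g1 s1 = landing_point c2 g2 s2 -> c1 = c2 /\ p1 0 = p2 0.
Proof.
  intros traj1 traj2 land1 land2 same_start same_end.
  destruct (coords_eq _ _ _ same_start) as (same_x & _ & same_height).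
  assert (same_distance : 2 * c1 * s1 = 2 * c2 * s2) by (unfold landing_point in same_end; lra).
  pose proof (landing_time_not_lt traj1 traj2 land1 land2 same_height same_distance).
  pose proof (landing_time_not_lt traj2 traj1 land2 land1 (eq_sym same_height) (eq_sym same_distance)).
  assert (s1 = s2) as <- by lra. pose proof (landing_time_pos traj1 land1).
  assert (c1 = c2) as <- by nra. split; auto.
  destruct (landing_profile traj1 land1) as (_ & slope1 & _).
  destruct (landing_profile traj2 land2) as (_ & slope2 & _). nra.
Qed.

(** * Compactification of the half plane *)

Definition bracket (x y : R) : R := sqrt (1 + x ^ 2 + y ^ 2).

Definition to_disk (q : R * R) : R * R :=
  (fst q / bracket (fst q) (snd q), snd q / bracket (fst q) (snd q)).

Lemma bracket_sq x y : bracket x y ^ 2 = 1 + x ^ 2 + y ^ 2.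
Proof. apply pow2_sqrt. nra. Qed.

Lemma bracket_ge_1 x y : 1 <= bracket x y.
Proof. unfold bracket. rewrite <- sqrt_1 at 1. apply sqrt_le_1_alt. nra. Qed.

Lemma bracket_gt_Rabs x y : Rabs x < bracket x y /\ Rabs y < bracket x y.
Proof.
  pose proof (bracket_ge_1 x y). pose proof (bracket_sq x y).
  split; apply Rabs_def1; apply Rnot_le_lt; intro; nra.
Qed.

Lemma bracket_le_plus x y a b : bracket x y <= bracket a b + (Rabs (x - a) + Rabs (y - b)).
Proof.
  destruct (bracket_gt_Rabs a b) as [Ha Hb]. pose proof (bracket_sq x y).
  pose proof (bracket_sq a b).
  pose proof (bracket_ge_1 a b).
  assert (Hx : x ^ 2 <= (Rabs a + Rabs (x - a)) ^ 2).
  { rewrite <- (pow2_abs x). apply pow_incr. split; [apply Rabs_pos|].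
    replace x with (a + (x - a)) at 1 by ring. apply Rabs_triang. }
  assert (Hy : y ^ 2 <= (Rabs b + Rabs (y - b)) ^ 2).
  { rewrite <- (pow2_abs y). apply pow_incr. split; [apply Rabs_pos|].
    replace y with (b + (y - b)) at 1 by ring. apply Rabs_triang. }
  pose proof (pow2_abs a). pose proof (pow2_abs b).
  pose proof (Rabs_pos (x - a)). pose proof (Rabs_pos (y - b)).
  apply Rnot_lt_le. intro. nra.
Qed.

Lemma to_disk_lipschitz q v d : close_to q v d -> close_to (to_disk q) (to_disk v) (3 * d).
Proof.
  destruct q as [x y], v as [a b]. intros [Hx Hy]. cbn [fst snd] in Hx, Hy.
  pose proof (bracket_le_plus x y a b). pose proof (bracket_le_plus a b x y) as back.
  rewrite (Rabs_minus_sym a x), (Rabs_minus_sym b y) in back.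
  destruct (bracket_gt_Rabs a b) as [Ha Hb].
  pose proof (bracket_ge_1 x y). pose proof (bracket_ge_1 a b).
  unfold to_disk; cbn [fst snd]. set (r := bracket x y) in *. set (q := bracket a b) in *.
  assert (coordinate : forall z w, Rabs (z - w) < d -> Rabs w < q -> Rabs (z / r - w / q) < 3 * d).
  { intros z w Hz Hw.
    replace (z / r - w / q) with (((z - w) + w / q * (q - r)) / r) by (field; lra).
    apply Rle_lt_trans with ((Rabs (z - w) + 1 * (2 * d)) / 1); [|lra].
    apply Rabs_div_le; try lra. eapply Rle_trans; [apply Rabs_triang|]. apply Rplus_le_compat_l.
    rewrite Rabs_mult. apply Rmult_le_compat; auto using Rabs_pos.
    - rewrite Rabs_div, (Rabs_right q) by lra. apply <- Rle_div_l; lra.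
    - apply Rabs_le. lra. }
  split; apply coordinate; auto.
Qed.

Lemma to_disk_reflect x y : to_disk (- x, y) = (- fst (to_disk (x, y)), snd (to_disk (x, y))).
Proof.
  unfold to_disk, bracket; cbn [fst snd]. replace ((- x) ^ 2) with (x ^ 2) by ring.
  f_equal. unfold Rdiv. ring.
Qed.

Lemma to_disk_interior q : in_Sigma q ->
  fst (to_disk q) ^ 2 + snd (to_disk q) ^ 2 < 1 /\ 0 < snd (to_disk q).
Proof.
  destruct q as [x y]. unfold in_Sigma, to_disk; cbn [fst snd]. intros Hy.
  pose proof (bracket_ge_1 x y). pose proof (bracket_sq x y).
  split; [|apply Rdiv_lt_0_compat; lra].
  replace ((x / bracket x y) ^ 2 + (y / bracket x y) ^ 2) with
    ((x ^ 2 + y ^ 2) / bracket x y ^ 2) by (field; lra).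
  apply <- Rlt_div_l; nra.
Qed.

Lemma to_disk_far_direction K e : 0 <= K -> 0 < e -> exists T, 0 <= T /\ forall C L t q, T <= t ->
  C ^ 2 + L ^ 2 = 1 -> Rabs (fst q - 2 * t * C) <= K -> Rabs (snd q - 2 * t * L) <= K ->
  close_to (to_disk q) (C, L) e.
Proof.
  intros HK He. assert (Hq : 0 < (1 + 5 * K) / e) by (apply Rdiv_lt_0_compat; lra).
  exists (2 * K + (1 + 5 * K) / e). split; [lra|]. intros C L t [x y] Ht E HX HY.
  cbn [fst snd] in HX, HY.
  assert (HC : -1 <= C <= 1) by nra. assert (HL : -1 <= L <= 1) by nra.
  apply Rabs_le_between in HX, HY. pose proof (bracket_sq x y) as R2. pose proof (bracket_ge_1 x y).
  set (a := x - 2 * t * C) in *. set (b := y - 2 * t * L) in *.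
  assert (expansion : x ^ 2 + y ^ 2 = 4 * t ^ 2 + 4 * t * (C * a + L * b) + a ^ 2 + b ^ 2).
  { replace x with (2 * t * C + a) by (unfold a; ring).
    replace y with (2 * t * L + b) by (unfold b; ring).
    replace (4 * t ^ 2) with (4 * t ^ 2 * (C ^ 2 + L ^ 2)) by (rewrite E; ring). ring. }
  assert (dot : - (2 * K) <= C * a + L * b <= 2 * K) by (split; nra).
  assert (t * - (2 * K) <= t * (C * a + L * b) <= t * (2 * K))
    by (split; apply Rmult_le_compat_l; lra).
  assert (0 <= a ^ 2 <= K ^ 2) by (split; nra). assert (0 <= b ^ 2 <= K ^ 2) by (split; nra).
  assert (upper : bracket x y <= 1 + 2 * t + 2 * K) by (apply Rnot_lt_le; intro; nra).
  assert (K * (2 * K) <= K * t) by (apply Rmult_le_compat_l; lra).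
  assert (lower : 2 * t - 4 * K <= bracket x y) by (apply Rnot_lt_le; intro; nra).
  assert (late : 1 + 5 * K < (2 * t - 4 * K) * e) by (apply -> Rlt_div_l; lra).
  assert (ratio : (1 + 5 * K) / (2 * t - 4 * K) < e) by (apply <- Rlt_div_l; lra).
  split; unfold to_disk; cbn [fst snd]; (eapply Rle_lt_trans; [|exact ratio]).
  - replace (x / bracket x y - C) with ((a + C * (2 * t - bracket x y)) / bracket x y)
      by (unfold a; field; lra).
    apply Rabs_div_le; [nra|auto|]. apply Rabs_le. nra.
  - replace (y / bracket x y - L) with ((b + L * (2 * t - bracket x y)) / bracket x y)
      by (unfold b; field; lra).
    apply Rabs_div_le; [nra|auto|]. apply Rabs_le. nra.
Qed.

Lemma to_disk_near_corner e x y : 0 < e -> 1 <= e * x -> 0 <= y <= 2 * e * x ->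
  close_to (to_disk (x, y)) (1, 0) (4 * e).
Proof.
  intros He Hx Hy. assert (0 < x) by nra.
  pose proof (bracket_sq x y). pose proof (bracket_ge_1 x y).
  assert (lower : x <= bracket x y) by (apply Rnot_lt_le; intro; nra).
  assert (upper : bracket x y <= 1 + x + y) by (apply Rnot_lt_le; intro; nra).
  unfold to_disk; split; cbn [fst snd]; apply Rle_lt_trans with (3 * e * x / x);
    try (apply <- Rlt_div_l; nra).
  - replace (x / bracket x y - 1) with ((x - bracket x y) / bracket x y) by (field; lra).
    apply Rabs_div_le; auto. apply Rabs_le. lra.
  - rewrite Rminus_0_r. apply Rabs_div_le; auto. rewrite Rabs_right; lra.
Qed.

Definition squash (xi : R) : R := xi / bracket xi 0.

Lemma to_disk_bottom xi : to_disk (xi, 0) = (squash xi, 0).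
Proof. unfold to_disk, squash; cbn [fst snd]. f_equal. unfold Rdiv. ring. Qed.

Lemma squash_bounds xi : -1 < squash xi < 1.
Proof.
  unfold squash. destruct (bracket_gt_Rabs xi 0) as [H _]. apply Rabs_def2 in H.
  split; [apply -> Rlt_div_r|apply <- Rlt_div_l]; lra.
Qed.

Lemma squash_onto u : -1 < u < 1 -> exists xi, squash xi = u.
Proof.
  intros Hu. set (s := sqrt (1 - u ^ 2)). assert (Hs : 0 < s) by (apply sqrt_lt_R0; nra).
  assert (s2 : s ^ 2 = 1 - u ^ 2) by (apply pow2_sqrt; nra).
  exists (u / s). unfold squash, bracket.
  replace (1 + (u / s) ^ 2 + 0 ^ 2) with ((/ s) ^ 2).
  - rewrite sqrt_pow2 by (left; now apply Rinv_0_lt_compat). field. lra.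
  - transitivity ((s ^ 2 + u ^ 2) / s ^ 2); [rewrite s2 at 1|]; field; lra.
Qed.

Lemma continuity_squash : continuity squash.
Proof.
  apply ex_derive_continuity. intro x. unfold squash, bracket. auto_derive.
  assert (pos : 0 < 1 + x * (x * 1) + 0 * (0 * 1)) by nra. pose proof (sqrt_lt_R0 _ pos).
  repeat split; lra.
Qed.

Lemma conv_to_to_disk g w : conv_to g w -> conv_to (fun t => to_disk (g t)) (to_disk w).
Proof.
  intros C e He. destruct (C (e / 3) ltac:(lra)) as [T HT]. exists T. intros t Ht.
  apply (close_to_weaken _ _ (3 * (e / 3))); [|lra]. apply to_disk_lipschitz. exact (HT t Ht).
Qed.

Definition of_disk (w : R * R) : R * R :=
  (fst w * / sqrt (1 - (fst w ^ 2 + snd w ^ 2)), snd w * / sqrt (1 - (fst w ^ 2 + snd w ^ 2))).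

Lemma of_disk_to_disk q : of_disk (to_disk q) = q.
Proof.
  destruct q as [x y]. unfold of_disk, to_disk; cbn [fst snd].
  pose proof (bracket_ge_1 x y). pose proof (bracket_sq x y) as E.
  replace (1 - ((x / bracket x y) ^ 2 + (y / bracket x y) ^ 2)) with ((/ bracket x y) ^ 2).
  - rewrite sqrt_pow2 by (left; apply Rinv_0_lt_compat; lra). f_equal; field; lra.
  - transitivity ((bracket x y ^ 2 - (x ^ 2 + y ^ 2)) / bracket x y ^ 2); [rewrite E at 1|]; field; lra.
Qed.

Lemma to_disk_of_disk w : fst w ^ 2 + snd w ^ 2 < 1 -> to_disk (of_disk w) = w.
Proof.
  destruct w as [a b]. unfold of_disk, to_disk; cbn [fst snd]. intros H.
  set (s := sqrt (1 - (a ^ 2 + b ^ 2))). assert (Hs : 0 < s) by (apply sqrt_lt_R0; lra).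
  assert (s2 : s ^ 2 = 1 - (a ^ 2 + b ^ 2)) by (apply pow2_sqrt; lra).
  assert (E : bracket (a * / s) (b * / s) = / s).
  { unfold bracket. replace (1 + (a * / s) ^ 2 + (b * / s) ^ 2) with ((/ s) ^ 2).
    - apply sqrt_pow2. left. now apply Rinv_0_lt_compat.
    - transitivity ((s ^ 2 + a ^ 2 + b ^ 2) / s ^ 2); [rewrite s2 at 1|]; field; lra. }
  rewrite E. f_equal; field; lra.
Qed.

Lemma squash_inj a b : squash a = squash b -> a = b.
Proof.
  intros E. assert (E' : to_disk (a, 0) = to_disk (b, 0)) by (now rewrite !to_disk_bottom, E).
  apply (f_equal of_disk) in E'. rewrite !of_disk_to_disk in E'. congruence.
Qed.

Lemma to_disk_bottom_inj xi eta : to_disk (xi, 0) = to_disk (eta, 0) -> xi = eta.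
Proof. rewrite !to_disk_bottom. intros E. injection E. apply squash_inj. Qed.

Lemma in_Sigma_of_disk w : fst w ^ 2 + snd w ^ 2 < 1 -> 0 < snd w -> in_Sigma (of_disk w).
Proof.
  intros H Hb. unfold in_Sigma, of_disk; cbn [snd]. apply Rmult_lt_0_compat; auto.
  apply Rinv_0_lt_compat, sqrt_lt_R0. lra.
Qed.

Lemma of_disk_continuous w e : fst w ^ 2 + snd w ^ 2 < 1 -> 0 < e ->
  exists r, 0 < r /\ forall w', close_to w' w r ->
    fst w' ^ 2 + snd w' ^ 2 < 1 /\ close_to (of_disk w') (of_disk w) e.
Proof.
  destruct w as [a b]. cbn [fst snd]. intros H He. set (s := a ^ 2 + b ^ 2) in *.
  set (k := fun s => / sqrt (1 - s)).
  assert (Hs : 0 < sqrt (1 - s)) by (apply sqrt_lt_R0; lra).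
  assert (Hk : 0 < k s) by now apply Rinv_0_lt_compat.
  assert (Ck : continuity_pt k s).
  { apply continuity_pt_filterlim, (ex_derive_continuous k). unfold k. auto_derive.
    replace (1 + - s) with (1 - s) by ring. repeat split; lra. }
  destruct (Ck (e / 2) ltac:(lra)) as (d & Hd & near).
  set (r := Rmin (Rmin (d / 8) ((1 - s) / 8)) (e / (4 * k s))).
  assert (r1 : r <= d / 8) by (eapply Rle_trans; [apply Rmin_l|apply Rmin_l]).
  assert (r2 : r <= (1 - s) / 8) by (eapply Rle_trans; [apply Rmin_l|apply Rmin_r]).
  assert (r3 : k s * r <= e / 4).
  { apply Rle_trans with (k s * (e / (4 * k s))); [|right; field; lra].
    apply Rmult_le_compat_l; [lra|apply Rmin_r]. }
  exists r. split. { repeat apply Rmin_pos; try lra. apply Rdiv_lt_0_compat; lra. }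
  intros [a' b'] [Ha Hb]. cbn [fst snd] in *. set (s' := a' ^ 2 + b' ^ 2).
  assert (Ha' := Ha). assert (Hb' := Hb). apply Rabs_def2 in Ha', Hb'.
  assert (s_nonneg : 0 <= s) by (unfold s; nra).
  assert (-1 <= a <= 1) by (unfold s in H; nra). assert (-1 <= b <= 1) by (unfold s in H; nra).
  assert (Hs' : Rabs (s' - s) < 8 * r).
  { replace (s' - s) with ((a' - a) * (a' + a) + (b' - b) * (b' + b)) by (unfold s', s; ring).
    apply Rabs_def1; nra. }
  assert (Kc : Rabs (k s' - k s) < e / 2).
  { destruct (Req_dec s' s) as [->|N]; [rewrite Rminus_diag, Rabs_R0; lra|].
    apply (near s'). split; [split; [exact I|auto]|]. simpl. unfold R_dist. lra. }
  apply Rabs_def2 in Hs'. split; [lra|].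
  assert (coordinate : forall z z', Rabs (z' - z) < r -> Rabs z' <= 1 -> Rabs (z' * k s' - z * k s) < e).
  { intros z z' Hz Hz'.
    replace (z' * k s' - z * k s) with (z' * (k s' - k s) + (z' - z) * k s) by ring.
    eapply Rle_lt_trans; [apply Rabs_triang|]. rewrite !Rabs_mult, (Rabs_right (k s)) by lra.
    pose proof (Rabs_pos z'). nra. }
  split; unfold of_disk; cbn [fst snd]; apply coordinate; auto; apply Rabs_le; unfold s' in *; nra.
Qed.

(** * Continuous dependence on the initial direction *)

Lemma sq_mult_gap_le x x' y y' :
  (x' * y' - x * y) ^ 2 <= 2 * (x' ^ 2 * (y' - y) ^ 2) + 2 * ((x' - x) ^ 2 * y ^ 2).
Proof. pose proof (pow2_ge_0 (x' * (y' - y) - (x' - x) * y)). nra. Qed.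

Lemma velocity_gap_le N s s' u u' p p' l l' c c' : 1 <= N ->
  u ^ 2 <= N -> p ^ 2 <= N -> l ^ 2 <= N -> l' ^ 2 <= N -> c ^ 2 <= N ->
  0 < s' < 2 -> Rabs (s' - s) <= 2 * Rabs (u' - u) ->
  (p' * s' - p * s) ^ 2 + (l' * u' * s' - l * u * s) ^ 2 + (2 * c' * s' - 2 * c * s) ^ 2 <=
  96 * N ^ 2 * ((u' - u) ^ 2 + (p' - p) ^ 2 + (l' - l) ^ 2 + (c' - c) ^ 2).
Proof.
  intros HN Hu Hp Hl Hl' Hc Hs' Hs.
  assert (rate : s' ^ 2 <= 4) by nra.
  assert (rate_gap : (s' - s) ^ 2 <= 4 * (u' - u) ^ 2).
  { rewrite <- (pow2_abs (s' - s)), <- (pow2_abs (u' - u)). pose proof (Rabs_pos (s' - s)). nra. }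
  assert (gap : forall y y' Y, y ^ 2 <= Y ->
    (y' * s' - y * s) ^ 2 <= 8 * (y' - y) ^ 2 + 8 * (u' - u) ^ 2 * Y).
  { intros y y' Y HY. pose proof (sq_mult_gap_le s s' y y').
    assert (s' ^ 2 * (y' - y) ^ 2 <= 4 * (y' - y) ^ 2)
      by (apply Rmult_le_compat_r; auto; apply pow2_ge_0).
    assert ((s' - s) ^ 2 * y ^ 2 <= 4 * (u' - u) ^ 2 * Y)
      by (apply Rmult_le_compat; auto; apply pow2_ge_0).
    replace (y' * s' - y * s) with (s' * y' - s * y) by ring. lra. }
  pose proof (gap p p' N Hp) as gap_u. pose proof (gap c c' N Hc) as gap_x.
  assert (gap_p := gap (l * u) (l' * u') (N * N)).
  rewrite Rpow_mult_distr in gap_p.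
  specialize (gap_p ltac:(apply Rmult_le_compat; auto; apply pow2_ge_0)).
  assert (gap_lu : (l' * u' - l * u) ^ 2 <= 2 * (N * (u' - u) ^ 2) + 2 * ((l' - l) ^ 2 * N)).
  { eapply Rle_trans; [apply sq_mult_gap_le|].
    apply Rplus_le_compat; apply Rmult_le_compat_l; try lra;
      [apply Rmult_le_compat_r|apply Rmult_le_compat_l]; auto; apply pow2_ge_0. }
  replace ((2 * c' * s' - 2 * c * s) ^ 2) with (4 * (c' * s' - c * s) ^ 2) by ring.
  assert (N_sq : 1 <= N <= N ^ 2) by nra.
  assert (absorb : forall z, 0 <= z ^ 2 <= N ^ 2 * z ^ 2 /\ N * z ^ 2 <= N ^ 2 * z ^ 2).
  { intro z. pose proof (pow2_ge_0 z). split; [split; [auto|]|apply Rmult_le_compat_r; lra].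
    rewrite <- (Rmult_1_l (z ^ 2)) at 1. apply Rmult_le_compat_r; lra. }
  pose proof (absorb (u' - u)). pose proof (absorb (p' - p)). pose proof (absorb (l' - l)).
  pose proof (absorb (c' - c)). lra.
Qed.

Section Dependence.

Variables (c c' : R) (g g' : R -> R * R) (p p' : R -> R) (N t1 : R).
Hypothesis traj : trajectory c g p.
Hypothesis traj' : trajectory c' g' p'.
Hypothesis N_ge_1 : 1 <= N.
Hypothesis c_bound : c ^ 2 <= N.
Hypothesis lam_bound : lam c ^ 2 <= N.
Hypothesis lam_bound' : lam c' ^ 2 <= N.
Hypothesis u_bound : forall t, 0 <= t <= t1 -> ucoord g t ^ 2 <= N.
Hypothesis p_bound : forall t, 0 <= t <= t1 -> p t ^ 2 <= N.

Definition separation (t : R) : R :=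
  (ucoord g' t - ucoord g t) ^ 2 + (p' t - p t) ^ 2 + (xcoord g' t - xcoord g t) ^ 2 +
  (lam c' - lam c) ^ 2 + (c' - c) ^ 2.

Lemma separation_growth : 0 <= t1 ->
  separation t1 <= separation 0 * exp ((1 + 96 * N ^ 2) * t1).
Proof.
  intros Ht1. replace ((1 + 96 * N ^ 2) * t1) with ((1 + 96 * N ^ 2) * (t1 - 0)) by ring.
  set (du := fun t => p' t * srate (ucoord g' t) - p t * srate (ucoord g t)).
  set (dp := fun t => lam c' * ucoord g' t * srate (ucoord g' t) - lam c * ucoord g t * srate (ucoord g t)).
  set (dx := fun t => 2 * c' * srate (ucoord g' t) - 2 * c * srate (ucoord g t)).
  apply (gronwall separation (fun t => 2 * (ucoord g' t - ucoord g t) * du t +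
    2 * (p' t - p t) * dp t + 2 * (xcoord g' t - xcoord g t) * dx t)); auto.
  - intros t _. unfold separation, du, dp, dx.
    pose proof (derive_ucoord traj t). pose proof (derive_ucoord traj' t).
    pose proof (derive_p traj t). pose proof (derive_p traj' t).
    pose proof (derive_xcoord traj t). pose proof (derive_xcoord traj' t). derive_by_rules. ring.
  - intros t Ht. pose proof (velocity_gap_le N (srate (ucoord g t)) (srate (ucoord g' t)) (ucoord g t)
      (ucoord g' t) (p t) (p' t) (lam c) (lam c') c c' N_ge_1 (u_bound t Ht) (p_bound t Ht) lam_bound
      lam_bound' c_bound (conj (trajectory_srate_pos traj' t) (srate_lt_2 _)) (srate_lipschitz _ _)).
    fold (du t) (dp t) (dx t) in H. unfold separation.
    pose proof (pow2_ge_0 (ucoord g' t - ucoord g t - du t)).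
    pose proof (pow2_ge_0 (p' t - p t - dp t)).
    pose proof (pow2_ge_0 (xcoord g' t - xcoord g t - dx t)).
    pose proof (pow2_ge_0 (lam c' - lam c)). pose proof (pow2_ge_0 (c' - c)).
    assert (0 <= 96 * N ^ 2 * (xcoord g' t - xcoord g t) ^ 2).
    { apply Rmult_le_pos; [nra|apply pow2_ge_0]. }
    lra.
Qed.

End Dependence.

Lemma trajectory_dependence {c g p} t1 e : trajectory c g p -> 0 <= t1 -> 0 < e ->
  exists d, 0 < d /\ forall c' g' p', trajectory c' g' p' -> g' 0 = g 0 ->
    Rabs (c' - c) < d -> Rabs (p' 0 - p 0) < d ->
    Rabs (xcoord g' t1 - xcoord g t1) < e /\ Rabs (ucoord g' t1 - ucoord g t1) < e /\
    Rabs (p' t1 - p t1) < e.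
Proof.
  intros traj Ht1 He.
  set (B := 2 * (ucoord g 0 * exp (4 * t1))). set (N := 3 + 2 * lam c ^ 2 + c ^ 2 + B ^ 2).
  pose proof (pow2_ge_0 (lam c)). pose proof (pow2_ge_0 c). pose proof (pow2_ge_0 B).
  assert (bounds : forall t, 0 <= t <= t1 -> ucoord g t ^ 2 <= N /\ p t ^ 2 <= N).
  { intros t Ht. pose proof (ucoord_exp_bound traj t ltac:(lra)).
    pose proof (ucoord_gt_1 traj 0). pose proof (exp_le (4 * t) (4 * t1) ltac:(lra)).
    assert (ucoord g 0 * exp (4 * t) <= ucoord g 0 * exp (4 * t1)) by (apply Rmult_le_compat_l; lra).
    pose proof (p_Rabs traj t) as Hp. apply Rabs_def2 in Hp.
    assert (2 * ucoord g t <= B) by (unfold B; lra). unfold N. split; nra. }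
  set (X := exp ((1 + 96 * N ^ 2) * t1)). assert (HX : 0 < X) by apply exp_pos.
  set (h := Rmin 1 (e ^ 2 / (4 * X))).
  assert (He2 : 0 < e ^ 2) by nra.
  assert (Hh : 0 < h) by (apply Rmin_pos; [lra|apply Rdiv_lt_0_compat; lra]).
  assert (h_le_1 : h <= 1) by apply Rmin_l.
  assert (h_small : 3 * h ^ 2 * X < e ^ 2).
  { assert (h * (4 * X) <= e ^ 2) by (apply <- Rle_div_r; [apply Rmin_r|lra]).
    assert (h ^ 2 * X <= h * X) by (apply Rmult_le_compat_r; nra). nra. }
  destruct (continuity_at lam c h continuity_lam Hh) as (d & Hd & lam_close).
  exists (Rmin d h). split; [now apply Rmin_pos|]. intros c' g' p' traj' start Hc Hp.
  pose proof (Rmin_l d h). pose proof (Rmin_r d h). specialize (lam_close c' ltac:(lra)).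
  apply Rabs_def2 in Hc, Hp, lam_close.
  assert (growth : separation c c' g g' p p' t1 <= separation c c' g g' p p' 0 * X).
  { apply separation_growth; auto; try (intros t Ht; now apply bounds); unfold N; try lra.
    assert ((lam c' - lam c) ^ 2 <= 1) by nra. nra. }
  assert (small : separation c c' g g' p p' 0 * X < e ^ 2).
  { eapply Rle_lt_trans; [|exact h_small]. apply Rmult_le_compat_r; [lra|].
    destruct (coords_eq _ _ _ start) as (x_start & _ & u_start).
    unfold separation. rewrite x_start, u_start. nra. }
  assert (Hlt := Rle_lt_trans _ _ _ growth small). unfold separation in Hlt.
  pose proof (pow2_ge_0 (ucoord g' t1 - ucoord g t1)). pose proof (pow2_ge_0 (p' t1 - p t1)).
  pose proof (pow2_ge_0 (xcoord g' t1 - xcoord g t1)). pose proof (pow2_ge_0 (lam c' - lam c)).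
  pose proof (pow2_ge_0 (c' - c)).
  assert (root : forall r, r ^ 2 < e ^ 2 -> Rabs r < e).
  { intros r Hr. apply Rabs_def1; apply Rnot_le_lt; intro; nra. }
  repeat split; apply root; lra.
Qed.

(** * Ends of trajectories, uniformly in the direction *)

Definition locally_uniform_end (c : R) (g : R -> R * R) (p : R -> R) (w : R * R) : Prop :=
  forall e, 0 < e -> exists d T, 0 < d /\
    forall c' g' p', trajectory c' g' p' -> g' 0 = g 0 ->
      Rabs (c' - c) < d -> Rabs (p' 0 - p 0) < d ->
      forall t, T <= t -> close_to (to_disk (g' t)) w e.

Lemma locally_uniform_end_conv_to {c g p w} : trajectory c g p -> locally_uniform_end c g p w ->
  conv_to (fun t => to_disk (g t)) w.
Proof.
  intros traj uniform e He. destruct (uniform e He) as (d & T & Hd & HT). exists T.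
  apply (HT c g p); auto; rewrite Rminus_diag, Rabs_R0; auto.
Qed.

Definition direction (c : R) : R * R := (2 * c, sqrt (lam c)).

Lemma direction_continuous c e : 0 < lam c -> 0 < e ->
  exists d, 0 < d /\ forall c', Rabs (c' - c) < d -> close_to (direction c') (direction c) e.
Proof.
  intros L He. assert (Cs : continuity_pt (fun c => sqrt (lam c)) c).
  { apply (continuity_pt_comp lam sqrt); [apply continuity_lam|apply continuity_pt_sqrt; lra]. }
  destruct (Cs e He) as (d & Hd & near). exists (Rmin d (e / 2)). split; [apply Rmin_pos; lra|].
  intros c' Hc. pose proof (Rmin_l d (e / 2)). pose proof (Rmin_r d (e / 2)).
  unfold direction. split; cbn [fst snd].
  - replace (2 * c' - 2 * c) with (2 * (c' - c)) by ring.
    rewrite Rabs_mult, (Rabs_right 2) by lra. lra.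
  - destruct (Req_dec c' c) as [->|N]; [rewrite Rminus_diag, Rabs_R0; lra|].
    apply (near c'). split; [split; [exact I|auto]|]. simpl. unfold R_dist. lra.
Qed.

Lemma locally_uniform_end_ascending {c g p} : trajectory c g p -> 0 < lam c -> 0 < p 0 ->
  locally_uniform_end c g p (direction c).
Proof.
  intros traj L Hp e He. pose proof (ucoord_gt_1 traj 0) as Hu.
  set (Y := ln (6 * ucoord g 0) - ln (sqrt (lam c / 2))).
  assert (HY : 0 <= Y).
  { pose proof (ln_le 1 (6 * ucoord g 0) ltac:(lra) ltac:(lra)) as Hu6.
    assert (Hk : ln (sqrt (lam c / 2)) <= ln 1).
    { apply ln_le; [apply sqrt_lt_R0; lra|]. rewrite <- sqrt_1. apply sqrt_le_1_alt.
      pose proof (lam_le_1 c). lra. }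
    rewrite ln_1 in *. unfold Y. lra. }
  set (K := Rabs (xcoord g 0) + Y + lag_bound (ucoord g 0)).
  pose proof (lag_bound_nonneg _ Hu). pose proof (Rabs_pos (xcoord g 0)).
  destruct (to_disk_far_direction K (e / 2)) as (T & HT & far); [unfold K; lra|lra|].
  destruct (continuity_at lam c (lam c / 2) continuity_lam ltac:(lra)) as (d1 & Hd1 & lam_close).
  destruct (direction_continuous c (e / 2) L ltac:(lra)) as (d2 & Hd2 & direction_close).
  exists (Rmin (Rmin d1 d2) (p 0)), T.
  split; [repeat apply Rmin_pos; lra|]. intros c' g' p' traj' start Hc Hp' t Ht.
  pose proof (Rmin_l (Rmin d1 d2) (p 0)). pose proof (Rmin_r (Rmin d1 d2) (p 0)).
  pose proof (Rmin_l d1 d2). pose proof (Rmin_r d1 d2).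
  specialize (lam_close c' ltac:(lra)). apply Rabs_def2 in lam_close, Hp'.
  assert (up : ascends c' p') by (split; lra).
  pose proof (ascending_xcoord traj' up t ltac:(lra)) as x_bound.
  pose proof (ascending_ycoord traj' up t ltac:(lra) ltac:(lra)) as y_bound.
  destruct (coords_eq _ _ _ start) as (x_start & _ & u_start). rewrite x_start, u_start in *.
  assert (ln (sqrt (lam c / 2)) <= ln (sqrt (lam c'))).
  { apply ln_le; [apply sqrt_lt_R0; lra|]. apply sqrt_le_1_alt. lra. }
  replace e with (e / 2 + e / 2) by field.
  apply close_to_trans with (direction c'); [|apply direction_close; lra].
  apply (far _ _ t); auto.
  - rewrite pow2_sqrt by lra. unfold lam. ring.
  - eapply Rle_trans; [exact x_bound|]. unfold K. lra.
  - eapply Rle_trans; [exact y_bound|]. unfold K, Y. lra.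
Qed.

(* Above [crit_height e] every trajectory with [lam] close to 0 has slope at most [e]. *)
Definition crit_height (e : R) : R := arcsinh (4 / e).

Lemma near_critical_slope {c g p} e t : trajectory c g p -> 0 < c -> 0 < e ->
  Rabs (lam c) <= 1 / 2 -> Rabs (lam c) <= e ^ 2 / 4 -> 0 <= t ->
  ycoord g t <= Rmax (crit_height e) (ycoord g 0) + e * (xcoord g t - xcoord g 0).
Proof.
  intros traj Hc He Hlam Hlam' Ht. apply Rabs_le_between in Hlam, Hlam'.
  pose proof (Rmax_l (crit_height e) (ycoord g 0)).
  pose proof (Rmax_r (crit_height e) (ycoord g 0)).
  set (B := Rmax (crit_height e) (ycoord g 0)) in *.
  enough (ycoord g t - e * xcoord g t <= B - e * xcoord g 0) by lra.
  apply (barrier (fun t => ycoord g t - e * xcoord g t)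
    (fun t => (p t / sinh (ycoord g t) - e * (2 * c)) * srate (ucoord g t)) _ 0 t); auto; [| |lra].
  - intro r. pose proof (derive_ycoord traj r). pose proof (derive_xcoord traj r).
    pose proof (sinh_pos _ (ycoord_pos traj r)). derive_by_rules. field. lra.
  - intros r Hr high. pose proof (sinh_pos _ (ycoord_pos traj r)) as Hs.
    assert (xcoord g 0 <= xcoord g r).
    { rewrite (xcoord_stime traj r). pose proof (stime_le traj 0 r ltac:(lra)) as Hsr.
      rewrite stime_0 in Hsr. nra. }
    assert (steep : 4 < e * sinh (ycoord g r)).
    { rewrite Rmult_comm. apply -> Rlt_div_l; auto. rewrite <- (sinh_arcsinh (4 / e)).
      apply sinh_lt. change (arcsinh (4 / e)) with (crit_height e). nra. }
    pose proof (trajectory_unit_speed traj r) as E. unfold unit_speed, ucoord in E.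
    rewrite cosh_sq in E. set (s := sinh (ycoord g r)) in *.
    assert (Hp : p r <= e * (2 * c) * s).
    { apply Rnot_lt_le. intro fast.
      assert (0 < e * (2 * c) * s) by (apply Rmult_lt_0_compat; nra).
      assert (sq_lt : (e * (2 * c) * s) ^ 2 < p r ^ 2).
      { set (v := e * (2 * c) * s) in *. nra. }
      replace ((e * (2 * c) * s) ^ 2) with ((1 - lam c) * (e * s) ^ 2) in sq_lt by (unfold lam; ring).
      assert (lam c * s ^ 2 <= e ^ 2 / 4 * s ^ 2) by (apply Rmult_le_compat_r; nra).
      assert (1 / 2 * (e * s) ^ 2 <= (1 - lam c) * (e * s) ^ 2) by (apply Rmult_le_compat_r; nra).
      nra. }
    assert (p r / s <= e * (2 * c)) by (apply <- Rle_div_l; auto).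
    pose proof (trajectory_srate_pos traj r). nra.
Qed.

Lemma locally_uniform_end_critical_pos {c g p} : trajectory c g p -> lam c = 0 -> 0 < c -> 0 < p 0 ->
  locally_uniform_end c g p (direction c).
Proof.
  intros traj L Hc Hp e He. assert (Ec : c = 1 / 2) by (unfold lam in L; nra).
  set (h := e / 4). assert (Hh : 0 < h) by (unfold h; lra).
  set (B := Rmax (crit_height h) (ycoord g 0)).
  set (X := (1 + Rabs (B - h * xcoord g 0)) / h). pose proof (Rabs_pos (B - h * xcoord g 0)).
  assert (HX : h * X = 1 + Rabs (B - h * xcoord g 0)) by (unfold X; field; lra).
  pose proof (lag_bound_nonneg _ (ucoord_gt_1 traj 0)) as Hlag.
  pose proof (Rabs_pos (X + 1)). pose proof (Rabs_pos (xcoord g 0)).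
  set (t1 := Rabs (X + 1) + Rabs (xcoord g 0) + lag_bound (ucoord g 0)).
  assert (Ht1 : 0 <= t1) by (unfold t1; lra).
  assert (far : X + 1 <= xcoord g t1).
  { pose proof (ascending_xcoord traj (conj (or_intror (eq_sym L)) Hp) t1 Ht1) as bound.
    apply Rabs_le_between in bound. rewrite Ec in bound. pose proof (Rle_abs (X + 1)).
    unfold t1 in *. lra. }
  destruct (trajectory_dependence t1 1 traj Ht1 ltac:(lra)) as (d1 & Hd1 & dependence).
  destruct (continuity_at lam c (Rmin (1 / 2) (h ^ 2 / 4)) continuity_lam)
    as (d2 & Hd2 & lam_close);
    [apply Rmin_pos; nra|].
  exists (Rmin (Rmin d1 d2) (1 / 4)), t1. split; [repeat apply Rmin_pos; lra|].
  intros c' g' p' traj' start Hc' Hp' t Ht.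
  pose proof (Rmin_l (Rmin d1 d2) (1 / 4)). pose proof (Rmin_r (Rmin d1 d2) (1 / 4)).
  pose proof (Rmin_l d1 d2). pose proof (Rmin_r d1 d2).
  destruct (dependence c' g' p' traj' start ltac:(lra) ltac:(lra)) as (Dx & _).
  specialize (lam_close c' ltac:(lra)). rewrite L, Rminus_0_r in lam_close.
  pose proof (Rmin_l (1 / 2) (h ^ 2 / 4)). pose proof (Rmin_r (1 / 2) (h ^ 2 / 4)).
  apply Rabs_def2 in Dx, Hc'.
  pose proof (near_critical_slope h t traj' ltac:(lra) Hh ltac:(lra) ltac:(lra) ltac:(lra)) as slope.
  destruct (coords_eq _ _ _ start) as (x_start & y_start & _). rewrite x_start, y_start in slope.
  fold B in slope.
  pose proof (Rle_abs (B - h * xcoord g 0)). pose proof (ycoord_pos traj' t).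
  assert (xcoord g' t1 <= xcoord g' t).
  { rewrite (xcoord_stime traj' t1), (xcoord_stime traj' t). pose proof (stime_le traj' t1 t Ht).
    nra. }
  assert (h * X <= h * xcoord g' t) by (apply Rmult_le_compat_l; lra).
  replace (direction c) with (1, 0) by (unfold direction; rewrite L, sqrt_0, Ec; f_equal; field).
  replace e with (4 * h) by (unfold h; field). rewrite (surjective_pairing (g' t)).
  apply to_disk_near_corner; auto; unfold xcoord, ycoord in *; lra.
Qed.

Lemma trajectory_reflect {c g p} : trajectory c g p ->
  trajectory (- c) (fun t => (- xcoord g t, ycoord g t)) p.
Proof.
  intros traj t. unfold unit_speed. rewrite lam_opp. destruct (traj t) as (Hy & Dx & rest).
  split; [exact Hy|]. split; [|exact rest].
  replace (2 * - c) with (- (2 * c)) by ring. rewrite Ropp_mult_distr_l_reverse.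
  exact (is_derive_opp_R _ _ _ Dx).
Qed.

Lemma locally_uniform_end_critical {c g p} : trajectory c g p -> lam c = 0 -> 0 < p 0 ->
  locally_uniform_end c g p (direction c).
Proof.
  intros traj L Hp.
  destruct (Rlt_dec 0 c) as [Hc|Hc]; [now apply locally_uniform_end_critical_pos|].
  assert (Hc' : 0 < - c) by (unfold lam in L; nra).
  pose proof (locally_uniform_end_critical_pos (trajectory_reflect traj) ltac:(now rewrite lam_opp) Hc' Hp)
    as mirrored.
  intros e He. destruct (mirrored e He) as (d & T & Hd & HT). exists d, T. split; auto.
  intros c' g' p' traj' start Hcc Hpp t Ht.
  destruct (HT _ _ _ (trajectory_reflect traj')) with (t := t) as [X Y]; auto.
  - now destruct (coords_eq _ _ _ start) as (-> & -> & _).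
  - replace (- c' - - c) with (- (c' - c)) by ring. now rewrite Rabs_Ropp.
  - unfold xcoord, ycoord in X, Y. rewrite to_disk_reflect, <- surjective_pairing in X, Y.
    unfold direction in *. cbn [fst snd] in *. rewrite lam_opp in Y. split; auto.
    rewrite <- Rabs_Ropp. cbn [fst].
    replace (- (fst (to_disk (g' t)) - 2 * c)) with (- fst (to_disk (g' t)) - 2 * - c) by ring.
    auto.
Qed.

Lemma descending_stays_near {c g p t1 d} xi r : trajectory c g p -> descends_from p t1 d -> 0 < r ->
  Rabs (xcoord g t1 - xi) < r / 2 -> ucoord g t1 < cosh r ->
  Rabs (2 * c) * ((ucoord g t1 - 1) / d) <= r / 2 ->
  forall t, t1 <= t -> close_to (g t) (xi, 0) r.
Proof.
  intros traj down Hr near low narrow t Ht. assert (Hd : 0 < d) by apply down. split; cbn [fst snd].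
  - replace (fst (g t) - xi) with ((xcoord g t - xcoord g t1) + (xcoord g t1 - xi)) by (unfold xcoord; ring).
    replace r with (r / 2 + r / 2) by field. eapply Rle_lt_trans; [apply Rabs_triang|].
    apply Rplus_le_lt_compat; auto. eapply Rle_trans; [|exact narrow].
    eapply Rle_trans; [apply (descending_xcoord traj down t1 t); lra|].
    apply Rmult_le_compat_l; [apply Rabs_pos|]. pose proof (ucoord_gt_1 traj t).
    apply Rmult_le_compat_r; [left; now apply Rinv_0_lt_compat|lra].
  - pose proof (ycoord_pos traj t) as Hy.
    pose proof (descending_ucoord_le traj down t1 t ltac:(lra) Ht).
    unfold ycoord in Hy. rewrite Rminus_0_r, Rabs_right by lra.
    apply cosh_lt_inv; [lra|]. change (cosh (snd (g t))) with (ucoord g t). lra.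
Qed.

Lemma locally_uniform_end_landing {c g p se} : trajectory c g p -> lands g p se ->
  locally_uniform_end c g p (to_disk (landing_point c g se, 0)).
Proof.
  intros traj landing e He. set (r := e / 3). assert (Hr : 0 < r) by (unfold r; lra).
  pose proof landing as (t1 & d & down & _).
  assert (Hd : 0 < d <= 1) by apply down. assert (Ht1 : 0 <= t1) by apply down.
  pose proof (Rabs_pos (2 * c)). pose proof (cosh_gt_1 r Hr).
  set (K := (Rabs (2 * c) + 2) * (2 / d)).
  assert (HK : 0 < K) by (apply Rmult_lt_0_compat; [lra|apply Rdiv_lt_0_compat; lra]).
  set (h := Rmin (cosh r - 1) (r / 2 / K)).
  assert (Hh : 0 < h) by (apply Rmin_pos; [lra|apply Rdiv_lt_0_compat; lra]).
  assert (h_cosh : h <= cosh r - 1) by apply Rmin_l.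
  assert (h_narrow : h * K <= r / 2) by (apply <- Rle_div_r; [apply Rmin_r|lra]).
  destruct (descending_ucoord_limit traj down (h / 2) ltac:(lra)) as (T1 & HT1 & low).
  destruct (landing_conv_to traj landing (r / 4) ltac:(lra)) as (T2 & close).
  set (T := Rmax T1 T2). assert (T1 <= T) by apply Rmax_l. assert (T2 <= T) by apply Rmax_r.
  set (small := Rmin (d / 2) (Rmin (h / 2) (r / 4))).
  assert (small <= d / 2) by apply Rmin_l.
  assert (small <= h / 2) by (eapply Rle_trans; [apply Rmin_r|apply Rmin_l]).
  assert (small <= r / 4) by (eapply Rle_trans; [apply Rmin_r|apply Rmin_r]).
  destruct (trajectory_dependence T small traj ltac:(lra)) as (d' & Hd' & dependence).
  { repeat apply Rmin_pos; lra. }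
  exists (Rmin d' 1), T. split; [apply Rmin_pos; lra|]. intros c' g' p' traj' start Hc Hp t Ht.
  pose proof (Rmin_l d' 1). pose proof (Rmin_r d' 1).
  destruct (dependence c' g' p' traj' start ltac:(lra) ltac:(lra)) as (Dx & Du & Dp).
  apply Rabs_def2 in Dx, Du, Dp. pose proof (descending_p_le traj down T ltac:(lra)).
  specialize (low T ltac:(lra)). destruct (close T ltac:(lra)) as [Cx _]. cbn [fst] in Cx.
  apply Rabs_def2 in Cx. fold (xcoord g T) in Cx.
  apply (close_to_weaken _ _ (3 * r)); [apply to_disk_lipschitz|unfold r; lra].
  apply (@descending_stays_near c' g' p' T (d / 2)); auto.
  - unfold descends_from. lra.
  - apply Rabs_def1; lra.
  - lra.
  - assert (Rabs (2 * c') <= Rabs (2 * c) + 2).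
    { replace (2 * c') with (2 * c + 2 * (c' - c)) by ring. eapply Rle_trans; [apply Rabs_triang|].
      rewrite (Rabs_mult 2 (c' - c)), (Rabs_right 2) by lra. lra. }
    eapply Rle_trans; [|exact h_narrow].
    replace (h * K) with ((Rabs (2 * c) + 2) * (h / (d / 2))) by (unfold K; field; lra).
    pose proof (ucoord_gt_1 traj' T).
    apply Rmult_le_compat; auto using Rabs_pos; [apply Rdiv_le_0_compat; lra|].
    apply Rmult_le_compat_r; [left; apply Rinv_0_lt_compat|]; lra.
Qed.

(** * Distance estimates *)

Lemma continuity_pt_speed (c : R -> R * R) (d1 d2 : R -> R) s :
  0 < snd (c s) -> continuity_pt (fun u => snd (c u)) s -> continuity_pt d1 s -> continuity_pt d2 s ->
  continuity_pt (fun s => sqrt (P (snd (c s)) * (d1 s ^ 2 + d2 s ^ 2))) s.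
Proof.
  intros Hy Hc Hd1 Hd2.
  assert (square : forall d, continuity_pt d s -> continuity_pt (fun s => d s ^ 2) s).
  { intros d Hd. apply (continuity_pt_comp d (fun x => x ^ 2)); auto.
    apply derivable_continuous_pt, derivable_pt_pow. }
  apply (continuity_pt_comp (fun s => P (snd (c s)) * (d1 s ^ 2 + d2 s ^ 2)) sqrt).
  - apply (continuity_pt_mult (fun s => P (snd (c s))) (fun s => d1 s ^ 2 + d2 s ^ 2)).
    + apply (continuity_pt_comp (fun s => snd (c s)) P); auto.
      exact (is_derive_continuity_pt _ _ _ (is_derive_P _ Hy)).
    + apply (continuity_pt_plus (fun s => d1 s ^ 2) (fun s => d2 s ^ 2)); auto.
  - apply continuity_pt_sqrt. pose proof (P_ge_quarter _ Hy). apply Rmult_le_pos; nra.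
Qed.

Lemma increment_le_integral (f phi dphi : R -> R) (pr : Riemann_integrable f 0 1) :
  (forall s, 0 <= s <= 1 -> continuity_pt f s) ->
  (forall s : R, 0 <= s <= 1 -> is_derive phi s (dphi s) /\ dphi s <= f s) ->
  phi 1 - phi 0 <= RiemannInt pr.
Proof.
  intros Cf Hphi.
  destruct (C0_extension_le (T := R_UniformSpace) f 0 1) as [h [Ch Eh]].
  { intros s Hs. apply continuity_pt_filterlim. auto. }
  rewrite <- RInt_Reals, (RInt_ext f h 0 1).
  2:{ intros s Hs. rewrite Rmin_left, Rmax_right in Hs by lra. symmetry. apply Eh; lra. }
  assert (DI : forall s : R, is_derive (fun s => RInt h 0 s) s (h s)).
  { intro s. apply (is_derive_RInt h (fun s => RInt h 0 s) 0 s); [|apply Ch].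
    apply filter_forall. intro b. apply (@RInt_correct R_CompleteNormedModule).
    apply (@ex_RInt_continuous R_CompleteNormedModule). intros z _. apply Ch. }
  assert (increment : RInt h 0 0 - phi 0 <= RInt h 0 1 - phi 1).
  { apply (derive_nonneg_le (fun s => RInt h 0 s - phi s) (fun s => h s - dphi s)); [lra| |].
    - intros t Ht. apply is_derive_minus_R; [apply DI|apply Hphi, Ht].
    - intros t Ht. rewrite (Eh t ltac:(lra)). pose proof (proj2 (Hphi t ltac:(lra))). lra. }
  rewrite (RInt_point 0 h : RInt h 0 0 = 0) in increment. lra.
Qed.

(* 1-Lipschitz for the metric, tested along curves. *)
Definition nonexpanding (F : R * R -> R) : Prop :=
  forall (c : R -> R * R) (s d1 d2 : R), 0 < snd (c s) ->
    is_derive (fun u => fst (c u)) s d1 -> is_derive (fun u => snd (c u)) s d2 ->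
    exists A B, is_derive (fun u => F (c u)) s (A * d1 + B * d2) /\ A ^ 2 + B ^ 2 <= P (snd (c s)).

Lemma nonexpanding_dist F q1 q2 r : nonexpanding F -> dist_le q1 q2 r -> F q2 - F q1 <= r.
Proof.
  intros HF dist. apply le_epsilon. intros e He.
  destruct (dist e He) as (c & d1 & d2 & E0 & E1 & Hc & pr & Hpr).
  eapply Rle_trans; [|exact Hpr]. rewrite <- E0, <- E1.
  apply (increment_le_integral _ (fun s => F (c s)) (fun s => Derive (fun s => F (c s)) s)).
  - intros s Hs. destruct (Hc s Hs) as (Hy & _ & D2 & C1 & C2). apply continuity_pt_speed; auto.
    apply derivable_continuous_pt. now exists (d2 s).
  - intros s Hs. destruct (Hc s Hs) as (Hy & D1 & D2 & _ & _). apply is_derive_Reals in D1, D2.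
    destruct (HF c s (d1 s) (d2 s) Hy D1 D2) as (A & B & DF & gradient).
    replace (Derive (fun s => F (c s)) s) with (A * d1 s + B * d2 s)
      by (symmetry; now apply is_derive_unique).
    split; [exact DF|]. eapply Rle_trans; [apply Rle_abs|].
    rewrite <- sqrt_Rsqr_abs. apply sqrt_le_1_alt. unfold Rsqr.
    pose proof (pow2_ge_0 (A * d2 s - B * d1 s)).
    assert ((A ^ 2 + B ^ 2) * (d1 s ^ 2 + d2 s ^ 2) <= P (snd (c s)) * (d1 s ^ 2 + d2 s ^ 2))
      by (apply Rmult_le_compat_r; nra). nra.
Qed.

Lemma dist_le_Rabs f q1 q2 r : (forall k, k ^ 2 = 1 / 4 -> nonexpanding (fun q => k * f q)) ->
  dist_le q1 q2 r -> Rabs (f q2 - f q1) <= 2 * r.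
Proof.
  intros Hf dist. pose proof (nonexpanding_dist _ _ _ _ (Hf (1 / 2) ltac:(lra)) dist).
  pose proof (nonexpanding_dist _ _ _ _ (Hf (- (1 / 2)) ltac:(lra)) dist).
  apply Rabs_le. simpl in *. lra.
Qed.

Lemma dist_le_x q1 q2 r : dist_le q1 q2 r -> Rabs (fst q2 - fst q1) <= 2 * r.
Proof.
  apply dist_le_Rabs. intros k Hk c s d1 d2 Hy D1 D2. exists k, 0. split.
  - derive_by_rules. ring.
  - pose proof (P_ge_quarter _ Hy). lra.
Qed.

Lemma dist_le_y q1 q2 r : dist_le q1 q2 r -> Rabs (snd q2 - snd q1) <= 2 * r.
Proof.
  apply dist_le_Rabs. intros k Hk c s d1 d2 Hy D1 D2. exists 0, k. split.
  - derive_by_rules. ring.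
  - pose proof (P_ge_quarter _ Hy). lra.
Qed.

Lemma dist_le_ln_y q1 q2 r : dist_le q1 q2 r -> Rabs (ln (snd q2) - ln (snd q1)) <= 2 * r.
Proof.
  apply (dist_le_Rabs (fun q => ln (snd q))). intros k Hk c s d1 d2 Hy D1 D2.
  exists 0, (k / snd (c s)). split.
  - pose proof (is_derive_ln_comp (fun u => snd (c u)) s d2 Hy D2). derive_by_rules. field. lra.
  - eapply Rle_trans; [|now apply P_ge_hyperbolic]. right.
    replace (0 ^ 2 + (k / snd (c s)) ^ 2) with (k ^ 2 * / snd (c s) ^ 2) by (field; lra).
    rewrite Hk. field. lra.
Qed.

(* Half the Busemann function of the hyperbolic half plane at the boundary point [(xi, 0)]. *)
Definition busemann (xi : R) (q : R * R) : R :=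
  1 / 2 * (ln ((fst q - xi) ^ 2 + snd q ^ 2) - ln (snd q)).

Lemma nonexpanding_busemann xi : nonexpanding (busemann xi).
Proof.
  intros c s d1 d2 Hy D1 D2.
  exists ((fst (c s) - xi) / ((fst (c s) - xi) ^ 2 + snd (c s) ^ 2)),
    (snd (c s) / ((fst (c s) - xi) ^ 2 + snd (c s) ^ 2) - 1 / 2 * / snd (c s)).
  assert (Hr : 0 < (fst (c s) - xi) ^ 2 + snd (c s) ^ 2).
  { apply Rplus_le_lt_0_compat; [apply pow2_ge_0|now apply pow_lt]. }
  split.
  - assert (Dr : is_derive (fun u => (fst (c u) - xi) ^ 2 + snd (c u) ^ 2) s
      (2 * (fst (c s) - xi) * d1 + 2 * snd (c s) * d2)) by (derive_by_rules; ring).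
    pose proof (is_derive_ln_comp (fun u => (fst (c u) - xi) ^ 2 + snd (c u) ^ 2) s _ Hr Dr).
    pose proof (is_derive_ln_comp (fun u => snd (c u)) s d2 Hy D2).
    unfold busemann. derive_by_rules. field. split; lra.
  - eapply Rle_trans; [|now apply P_ge_hyperbolic]. right. field. split; lra.
Qed.

Lemma RiemannInt_le_const (f : R -> R) (L : R) (pr : Riemann_integrable f 0 1) :
  (forall s, 0 < s < 1 -> f s <= L) -> RiemannInt pr <= L.
Proof.
  intros H. assert (pr' : Riemann_integrable (fct_cte L) 0 1) by apply RiemannInt_P14.
  apply Rle_trans with (RiemannInt pr'); [apply RiemannInt_P19; auto; lra|].
  rewrite RiemannInt_P15. lra.
Qed.

Lemma dist_le_mono q1 q2 r r' : dist_le q1 q2 r -> r <= r' -> dist_le q1 q2 r'.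
Proof.
  intros dist Hr e He. destruct (dist e He) as (c & d1 & d2 & E0 & E1 & Hc & pr & Hpr).
  exists c, d1, d2. repeat (split; auto). exists pr. lra.
Qed.

Lemma curve_dist_le (c : R -> R * R) (d1 d2 : R -> R) L :
  (forall s, 0 <= s <= 1 -> 0 < snd (c s) /\ derivable_pt_lim (fun u => fst (c u)) s (d1 s) /\
     derivable_pt_lim (fun u => snd (c u)) s (d2 s) /\ continuity_pt d1 s /\ continuity_pt d2 s) ->
  (forall s, 0 < s < 1 -> P (snd (c s)) * (d1 s ^ 2 + d2 s ^ 2) <= L ^ 2) -> 0 <= L ->
  dist_le (c 0) (c 1) L.
Proof.
  intros Hc speed HL e He. exists c, d1, d2. repeat (split; auto).
  assert (pr : Riemann_integrable (fun s => sqrt (P (snd (c s)) * (d1 s ^ 2 + d2 s ^ 2))) 0 1).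
  { apply continuity_implies_RiemannInt; [lra|]. intros s Hs.
    destruct (Hc s Hs) as (Hy & _ & D2 & C1 & C2). apply continuity_pt_speed; auto.
    apply derivable_continuous_pt. now exists (d2 s). }
  exists pr. apply Rle_trans with L; [|lra]. apply RiemannInt_le_const. intros s Hs.
  rewrite <- (sqrt_pow2 L) by auto. apply sqrt_le_1_alt. auto.
Qed.

Lemma segment_dist q1 q2 m : 0 < m -> m <= snd q1 -> m <= snd q2 ->
  dist_le q1 q2 ((1 / 2 + / m) * (Rabs (fst q2 - fst q1) + Rabs (snd q2 - snd q1))).
Proof.
  destruct q1 as [x1 y1], q2 as [x2 y2]. cbn [fst snd]. intros Hm Hy1 Hy2.
  pose proof (Rinv_0_lt_compat m Hm). pose proof (Rabs_pos (x2 - x1)).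
  pose proof (Rabs_pos (y2 - y1)).
  set (c := fun s => (x1 + s * (x2 - x1), y1 + s * (y2 - y1))).
  replace (x1, y1) with (c 0) by (unfold c; f_equal; ring).
  replace (x2, y2) with (c 1) by (unfold c; f_equal; ring).
  assert (Hy : forall s, 0 <= s <= 1 -> m <= snd (c s)) by (intros s Hs; unfold c; cbn [snd]; nra).
  apply (curve_dist_le c (fun _ => x2 - x1) (fun _ => y2 - y1)).
  - intros s Hs. split; [specialize (Hy s Hs); lra|].
    split; [|split; [|split; apply continuity_pt_const; intros a b; reflexivity]];
      apply is_derive_Reals; unfold c; cbn [fst snd]; auto_derive; auto; ring.
  - intros s Hs. specialize (Hy s ltac:(lra)). set (y := snd (c s)) in *.
    pose proof (Rinv_le_contravar m y Hm Hy). pose proof (Rinv_0_lt_compat y ltac:(lra)).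
    rewrite Rpow_mult_distr. pose proof (P_ge_quarter y ltac:(lra)).
    apply Rmult_le_compat; [lra|apply Rplus_le_le_0_compat; apply pow2_ge_0| |].
    + apply Rle_trans with ((1 / 2 + / y) ^ 2); [apply P_le_sq; lra|apply pow_incr; lra].
    + rewrite <- (pow2_abs (x2 - x1)), <- (pow2_abs (y2 - y1)). nra.
  - apply Rmult_le_pos; lra.
Qed.

Lemma dist_le_refl q r : in_Sigma q -> 0 <= r -> dist_le q q r.
Proof.
  intros Hq Hr. eapply dist_le_mono; [apply (segment_dist q q (snd q)); auto; lra|].
  rewrite !Rminus_diag, Rabs_R0. lra.
Qed.

Lemma comparable_dist q1 q2 A Y : 0 < snd q1 -> 0 < snd q2 -> 0 <= A ->
  Rabs (fst q2 - fst q1) + Rabs (snd q2 - snd q1) <= A * Rmin (snd q1) (snd q2) ->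
  snd q1 <= Y -> dist_le q1 q2 (A * (Y / 2 + 1)).
Proof.
  intros Hy1 Hy2 HA near HY. set (m := Rmin (snd q1) (snd q2)) in *.
  assert (Hm : 0 < m) by now apply Rmin_pos. assert (m <= snd q1) by apply Rmin_l.
  eapply dist_le_mono; [apply (segment_dist q1 q2 m); auto; apply Rmin_r|].
  pose proof (Rinv_0_lt_compat m Hm).
  apply Rle_trans with ((1 / 2 + / m) * (A * m)); [apply Rmult_le_compat_l; lra|].
  replace ((1 / 2 + / m) * (A * m)) with (A * (m / 2 + 1)) by (field; lra).
  apply Rmult_le_compat_l; lra.
Qed.

Lemma geodesic_dist g T : geodesic g -> 0 <= T -> dist_le (g 0) (g T) T.
Proof.
  intros (dP & vx & vy & ax & ay & _ & eqs) HT.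
  assert (scaled : forall (f df : R -> R) s, (forall t, derivable_pt_lim f t (df t)) ->
     derivable_pt_lim (fun s => f (T * s)) s (T * df (T * s))).
  { intros f df s Df. apply is_derive_Reals.
    apply (is_derive_comp_R f (fun s => T * s)); [apply is_derive_Reals, Df|]. derive_by_rules.
    ring. }
  assert (scaled_continuity : forall v a s, (forall t, derivable_pt_lim v t (a t)) ->
      continuity_pt (fun s => T * v (T * s)) s).
  { intros v a s Dv. apply derivable_continuous_pt. exists (T * (T * a (T * s))).
    apply (derivable_pt_lim_scal (fun s => v (T * s))). now apply scaled. }
  replace (g 0) with (g (T * 0)) by (f_equal; ring).
  replace (g T) with (g (T * 1)) by (f_equal; ring).
  apply (curve_dist_le (fun s => g (T * s)) (fun s => T * vx (T * s)) (fun s => T * vy (T * s))); auto.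
  - intros s _. split; [apply eqs|].
    split; [apply (scaled (fun t => fst (g t))); apply eqs|].
    split; [apply (scaled (fun t => snd (g t))); apply eqs|].
    split; [apply (scaled_continuity vx ax)|apply (scaled_continuity vy ay)]; apply eqs.
  - intros s _. destruct (eqs (T * s)) as (_ & _ & _ & _ & _ & _ & _ & unit). right.
    transitivity (T ^ 2 * (P (snd (g (T * s))) * (vx (T * s) ^ 2 + vy (T * s) ^ 2))); [ring|].
    rewrite unit. ring.
Qed.

Lemma geodesic_stays_near g T t : geodesic g -> 0 <= t <= T ->
  Rabs (xcoord g t - xcoord g 0) <= 2 * T /\ Rabs (ycoord g t - ycoord g 0) <= 2 * T /\
  ycoord g 0 * exp (- (2 * T)) <= ycoord g t.
Proof.
  intros H Ht. pose proof (geodesic_dist g t H ltac:(lra)) as dist.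
  destruct (geodesic_trajectory g H) as (c & p & traj).
  pose proof (dist_le_x _ _ _ dist). pose proof (dist_le_y _ _ _ dist).
  pose proof (dist_le_ln_y _ _ _ dist) as log_y. unfold xcoord, ycoord in *.
  split; [lra|]. split; [lra|]. apply Rabs_le_between in log_y.
  pose proof (ycoord_pos traj 0) as Hy0. pose proof (ycoord_pos traj t) as Hyt. unfold ycoord in *.
  apply ln_le_inv; auto; [apply Rmult_lt_0_compat; auto; apply exp_pos|].
  rewrite ln_mult, ln_exp by auto using exp_pos. lra.
Qed.

(** * Asymptotic rays *)

Lemma asymptotic_ultimately g1 g2 B : geodesic g1 -> geodesic g2 ->
  ultimately (fun t => dist_le (g1 t) (g2 t) B) -> asymptotic g1 g2.
Proof.
  intros H1 H2 [T late].
  destruct (geodesic_trajectory g1 H1) as (c1 & p1 & traj1).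
  destruct (geodesic_trajectory g2 H2) as (c2 & p2 & traj2).
  pose proof (exp_pos (- (2 * T))) as decay. pose proof (ycoord_pos traj1 0).
  pose proof (ycoord_pos traj2 0).
  set (m := Rmin (ycoord g1 0) (ycoord g2 0) * exp (- (2 * T))).
  assert (Hm : 0 < m). { apply Rmult_lt_0_compat; auto. now apply Rmin_pos. }
  set (early_bound := (1 / 2 + / m) * ((Rabs (xcoord g2 0 - xcoord g1 0) + 4 * T) +
     (Rabs (ycoord g2 0 - ycoord g1 0) + 4 * T))).
  exists (Rmax B early_bound). intros t Ht. destruct (Rle_dec T t) as [HTt|HTt].
  - apply dist_le_mono with B; auto. apply Rmax_l.
  - apply dist_le_mono with early_bound; [|apply Rmax_r].
    destruct (geodesic_stays_near g1 T t H1 ltac:(lra)) as (x1 & y1 & low1).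
    destruct (geodesic_stays_near g2 T t H2 ltac:(lra)) as (x2 & y2 & low2).
    assert (gap : forall a b a0 b0, Rabs (a - a0) <= 2 * T -> Rabs (b - b0) <= 2 * T ->
      Rabs (b - a) <= Rabs (b0 - a0) + 4 * T).
    { intros a b a0 b0 Ha Hb. pose proof (Rle_abs (b0 - a0)). pose proof (Rle_abs (- (b0 - a0))).
      rewrite Rabs_Ropp in *. apply Rabs_le_between in Ha, Hb. apply Rabs_le. lra. }
    eapply dist_le_mono; [apply (segment_dist _ _ m Hm)|].
    + eapply Rle_trans; [|exact low1]. apply Rmult_le_compat_r; [lra|apply Rmin_l].
    + eapply Rle_trans; [|exact low2]. apply Rmult_le_compat_r; [lra|apply Rmin_r].
    + pose proof (Rinv_0_lt_compat m Hm). apply Rmult_le_compat_l; [lra|].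
      pose proof (gap _ _ _ _ x1 x2). pose proof (gap _ _ _ _ y1 y2).
      unfold xcoord, ycoord in *. lra.
Qed.

Lemma ascending_asymptotic_c {c1 g1 p1 c2 g2 p2} : trajectory c1 g1 p1 -> trajectory c2 g2 p2 ->
  ascends c1 p1 -> ascends c2 p2 -> asymptotic g1 g2 -> c1 = c2.
Proof.
  intros traj1 traj2 up1 up2 [B bounded]. enough (4 * c1 = 4 * c2) by lra.
  apply (linear_diff_eq _ _ (2 * B + (Rabs (xcoord g1 0) + lag_bound (ucoord g1 0)) +
     (Rabs (xcoord g2 0) + lag_bound (ucoord g2 0)))).
  intros t Ht. pose proof (ascending_xcoord traj1 up1 t Ht) as x1.
  pose proof (ascending_xcoord traj2 up2 t Ht) as x2.
  pose proof (dist_le_x _ _ _ (bounded t Ht)) as gap. unfold xcoord in *.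
  apply Rabs_le_between in x1, x2, gap. apply Rabs_le. lra.
Qed.

Lemma y_to_infty_not_asymptotic g1 g2 xi : y_to_infty g1 -> conv_to g2 (xi, 0) ->
  (exists B, forall t, 0 <= t -> Rabs (snd (g1 t) - snd (g2 t)) <= B) -> False.
Proof.
  intros unbounded conv [B bounded].
  destruct (ultimately_exists _ 0 (ultimately_and _ _ (unbounded (B + 1)) (conv 1 ltac:(lra))))
    as (t & Ht & high & _ & low).
  specialize (bounded t Ht). cbn [snd] in low. apply Rabs_def2 in low.
  apply Rabs_le_between in bounded. lra.
Qed.

Lemma ascending_landing_not_asymptotic {c1 g1 p1 c2 g2 p2 se} : trajectory c1 g1 p1 ->
  trajectory c2 g2 p2 -> ascends c1 p1 -> lands g2 p2 se -> ~ asymptotic g1 g2 /\ ~ asymptotic g2 g1.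
Proof.
  intros traj1 traj2 up landing. pose proof (ascending_y_to_infty traj1 up) as unbounded.
  pose proof (landing_conv_to traj2 landing) as conv.
  split; intros [B bounded]; apply (y_to_infty_not_asymptotic _ _ _ unbounded conv);
    exists (2 * B); intros t Ht; [rewrite Rabs_minus_sym|]; exact (dist_le_y _ _ _ (bounded t Ht)).
Qed.

Lemma busemann_bounded_at_landing {c g p se} : trajectory c g p -> lands g p se ->
  exists B, ultimately (fun t => busemann (landing_point c g se) (g t) <= B).
Proof.
  intros traj landing. destruct (landing_xcoord_rate traj landing) as (T & M & HM & rate).
  assert (HM2 : 0 < M ^ 2 + 1) by nra.
  exists (1 / 2 * ln (M ^ 2 + 1)).
  destruct (ultimately_and _ _ (ex_intro _ T rate) (landing_conv_to traj landing 1 ltac:(lra)))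
    as [T' late].
  exists T'. intros t Ht. destruct (late t Ht) as [near [_ low]].
  pose proof (ycoord_pos traj t) as Hy. cbn [snd] in low.
  unfold xcoord, ycoord, busemann in *. set (x := fst (g t)) in *. set (y := snd (g t)) in *.
  apply Rabs_def2 in low. apply Rabs_le_between in near. apply Rmult_le_compat_l; [lra|].
  assert (0 < (x - landing_point c g se) ^ 2 + y ^ 2).
  { apply Rplus_le_lt_0_compat; [apply pow2_ge_0|now apply pow_lt]. }
  rewrite <- ln_div by auto. apply ln_le; [now apply Rdiv_lt_0_compat|]. apply <- Rle_div_l; auto.
  assert ((x - landing_point c g se) ^ 2 <= (M * y) ^ 2) by nra.
  assert ((M ^ 2 + 1) * y ^ 2 <= (M ^ 2 + 1) * y) by (apply Rmult_le_compat_l; nra). lra.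
Qed.

Lemma busemann_diverges g xi eta B : conv_to g (eta, 0) -> eta <> xi -> (forall t, 0 < snd (g t)) ->
  ultimately (fun t => B < busemann xi (g t)).
Proof.
  intros conv N Hy. set (D := Rabs (eta - xi)). assert (HD : 0 < D) by (apply Rabs_pos_lt; lra).
  pose proof (exp_pos (2 * B)) as Hexp.
  assert (HK : 0 < D ^ 2 / 4) by nra.
  destruct (conv (Rmin (D / 2) (D ^ 2 / 4 / exp (2 * B)))) as [T late].
  { apply Rmin_pos; [lra|]. now apply Rdiv_lt_0_compat. }
  exists T. intros t Ht. specialize (late t Ht). specialize (Hy t).
  pose proof (Rmin_l (D / 2) (D ^ 2 / 4 / exp (2 * B))).
  pose proof (Rmin_r (D / 2) (D ^ 2 / 4 / exp (2 * B))). cbn [fst snd] in late.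
  unfold busemann. set (x := fst (g t)) in *. set (y := snd (g t)) in *.
  destruct late as [near low].
  apply Rabs_def2 in low.
  assert (away : D / 2 <= Rabs (x - xi)).
  { assert (D <= Rabs (x - eta) + Rabs (x - xi)); [|lra].
    unfold D. replace (eta - xi) with (- (x - eta) + (x - xi)) by ring.
    eapply Rle_trans; [apply Rabs_triang|]. rewrite Rabs_Ropp. lra. }
  assert (away_sq : D ^ 2 / 4 <= (x - xi) ^ 2 + y ^ 2).
  { rewrite <- (pow2_abs (x - xi)). nra. }
  assert (Hlow : y * exp (2 * B) < D ^ 2 / 4) by (apply <- Rlt_div_r; lra).
  assert (logs : ln (y * exp (2 * B)) < ln ((x - xi) ^ 2 + y ^ 2)).
  { apply ln_increasing; [now apply Rmult_lt_0_compat|lra]. }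
  rewrite ln_mult, ln_exp in logs by auto. lra.
Qed.

Lemma landing_asymptotic_point {c1 g1 p1 s1 c2 g2 p2 s2} : trajectory c1 g1 p1 ->
  trajectory c2 g2 p2 -> lands g1 p1 s1 -> lands g2 p2 s2 -> asymptotic g1 g2 ->
  landing_point c1 g1 s1 = landing_point c2 g2 s2.
Proof.
  intros traj1 traj2 land1 land2 [D close]. apply NNPP. intros N.
  destruct (busemann_bounded_at_landing traj1 land1) as [B bounded].
  pose proof (busemann_diverges g2 _ _ (B + D) (landing_conv_to traj2 land2) (not_eq_sym N)
    (ycoord_pos traj2)) as diverges.
  destruct (ultimately_exists _ 0 (ultimately_and _ _ bounded diverges)) as (t & Ht & low & high).
  pose proof (nonexpanding_dist _ _ _ _ (nonexpanding_busemann (landing_point c1 g1 s1)) (close t Ht)).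
  lra.
Qed.

Lemma osc_growth l a b s D : 0 <= l <= 1 -> 0 < a -> l * a <= b <= 2 * a -> 0 <= s -> 0 <= D ->
  osc l a b (s + D) <= osc l a b s * exp (2 * D).
Proof.
  intros Hl Ha Hb Hs HD. replace (2 * D) with (2 * (s + D - s)) by ring.
  apply (gronwall _ (dosc l a b)); [lra|intros; apply is_derive_osc|]. intros t Ht.
  pose proof (gcos_nonneg l t ltac:(lra)) as C.
  pose proof (gsin_nonneg l t ltac:(lra) ltac:(lra)) as S.
  unfold osc, dosc. assert (b * gcos l t <= 2 * a * gcos l t) by (apply Rmult_le_compat_r; lra).
  assert (l * a * gsin l t <= b * gsin l t) by (apply Rmult_le_compat_r; lra).
  assert (0 <= b * gsin l t) by (apply Rmult_le_pos; nra). lra.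
Qed.

Lemma osc_comparison l a b a' b' s s' : 0 <= l -> 0 < a' -> 0 < b' -> 0 <= a -> 0 <= b ->
  0 <= s <= s' -> osc l a b s <= (a / a' + b / b') * osc l a' b' s'.
Proof.
  intros Hl Ha' Hb' Ha Hb Hs.
  pose proof (gcos_nonneg l s Hl). pose proof (gsin_nonneg l s Hl ltac:(lra)).
  assert (0 <= a / a') by now apply Rdiv_le_0_compat.
  assert (0 <= b / b') by now apply Rdiv_le_0_compat.
  apply Rle_trans with ((a / a' + b / b') * osc l a' b' s).
  - unfold osc.
    replace ((a / a' + b / b') * (a' * gcos l s + b' * gsin l s)) with
      (a * gcos l s + b * gsin l s + (b / b' * a' * gcos l s + a / a' * b' * gsin l s)) by (field; lra).
    assert (0 <= b / b' * a' * gcos l s) by (apply Rmult_le_pos; [apply Rmult_le_pos|]; lra).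
    assert (0 <= a / a' * b' * gsin l s) by (apply Rmult_le_pos; [apply Rmult_le_pos|]; lra). lra.
  - apply Rmult_le_compat_l; [lra|].
    apply (derive_nonneg_le _ (dosc l a' b')); [lra|intros; apply is_derive_osc|].
    intros t Ht. pose proof (gcos_nonneg l t Hl). pose proof (gsin_nonneg l t Hl ltac:(lra)).
    unfold dosc. apply Rplus_le_le_0_compat; repeat apply Rmult_le_pos; lra.
Qed.

Lemma ascending_ucoord_ratio {c g1 p1 g2 p2} : trajectory c g1 p1 -> trajectory c g2 p2 ->
  ascends c p1 -> ascends c p2 ->
  exists M, 0 < M /\ forall t, 0 <= t -> ucoord g1 t <= M * ucoord g2 t.
Proof.
  intros traj1 traj2 up1 up2. pose proof (ucoord_gt_1 traj1 0). pose proof (ucoord_gt_1 traj2 0).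
  pose proof (ascending_p_gt_1 traj1 up1 0). pose proof (ascending_p_gt_1 traj2 up2 0).
  set (K := ucoord g1 0 / ucoord g2 0 + p1 0 / p2 0).
  assert (HK : 0 < K) by (apply Rplus_lt_0_compat; apply Rdiv_lt_0_compat; lra).
  set (D := lag_bound (ucoord g1 0) + lag_bound (ucoord g2 0)).
  assert (HD : 0 <= D) by (apply Rplus_le_le_0_compat; now apply lag_bound_nonneg).
  pose proof (exp_pos (2 * D)).
  exists (K * exp (2 * D)). split; [now apply Rmult_lt_0_compat|]. intros t Ht.
  pose proof (ascending_stime traj1 up1 t Ht) as S1.
  pose proof (ascending_stime traj2 up2 t Ht) as S2.
  apply Rabs_le_between in S1, S2.
  pose proof (stime_le traj1 0 t Ht) as s1_nonneg. pose proof (stime_le traj2 0 t Ht) as s2_nonneg.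
  rewrite stime_0 in s1_nonneg, s2_nonneg. destruct up1 as [L _]. pose proof (lam_le_1 c).
  pose proof (p_Rabs traj2 0) as Hp. apply Rabs_def2 in Hp.
  assert (slope : lam c * ucoord g2 0 <= p2 0).
  { pose proof (trajectory_unit_speed traj2 0) as E. unfold unit_speed in E.
    assert (lam c * (lam c * ucoord g2 0 ^ 2) <= 1 * (lam c * ucoord g2 0 ^ 2))
      by (apply Rmult_le_compat_r; nra).
    apply Rnot_lt_le. intro. nra. }
  rewrite (proj1 (trajectory_osc traj1 t)), (proj1 (trajectory_osc traj2 t)).
  eapply Rle_trans; [apply (osc_comparison _ _ _ (ucoord g2 0) (p2 0) _ (stime g2 p2 t + D)); try lra|].
  { unfold D. lra. }
  fold K. rewrite Rmult_assoc, (Rmult_comm (exp _)). apply Rmult_le_compat_l; [lra|].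
  apply osc_growth; lra.
Qed.

Lemma ascending_ycoord_gap {c g1 p1 g2 p2} : trajectory c g1 p1 -> trajectory c g2 p2 ->
  ascends c p1 -> ascends c p2 ->
  exists K, forall t, 0 <= t -> ycoord g1 t - ycoord g2 t <= K.
Proof.
  intros traj1 traj2 up1 up2.
  destruct (ascending_ucoord_ratio traj1 traj2 up1 up2) as (M & HM & ratio).
  exists (ln 2 + ln M). intros t Ht. specialize (ratio t Ht).
  pose proof (ucoord_gt_1 traj1 t). pose proof (ucoord_gt_1 traj2 t).
  pose proof (acosh_ln_bounds (ucoord g1 t) ltac:(lra)) as Y1.
  pose proof (acosh_ln_bounds (ucoord g2 t) ltac:(lra)) as Y2.
  rewrite (acosh_ucoord traj1) in Y1. rewrite (acosh_ucoord traj2) in Y2.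
  pose proof (ln_le (ucoord g1 t) (M * ucoord g2 t) ltac:(lra) ratio) as L.
  rewrite ln_mult in L by lra. lra.
Qed.

Lemma ascending_asymptotic {c g1 p1 g2 p2} : trajectory c g1 p1 -> trajectory c g2 p2 ->
  ascends c p1 -> ascends c p2 -> asymptotic g1 g2.
Proof.
  intros traj1 traj2 up1 up2.
  destruct (ascending_ycoord_gap traj1 traj2 up1 up2) as [K1 gap1].
  destruct (ascending_ycoord_gap traj2 traj1 up2 up1) as [K2 gap2].
  set (m := Rmin (ycoord g1 0) (ycoord g2 0)). pose proof (ycoord_pos traj1 0).
  pose proof (ycoord_pos traj2 0).
  assert (Hm : 0 < m) by now apply Rmin_pos. pose proof (Rinv_0_lt_compat m Hm).
  set (X := (Rabs (xcoord g1 0) + lag_bound (ucoord g1 0)) + (Rabs (xcoord g2 0) + lag_bound (ucoord g2 0))).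
  exists ((1 / 2 + / m) * (X + (Rabs K1 + Rabs K2))). intros t Ht.
  eapply dist_le_mono; [apply (segment_dist _ _ m Hm)|].
  - eapply Rle_trans; [apply Rmin_l|]. now apply (ascending_ycoord_le traj1 up1).
  - eapply Rle_trans; [apply Rmin_r|]. now apply (ascending_ycoord_le traj2 up2).
  - apply Rmult_le_compat_l; [lra|]. specialize (gap1 t Ht). specialize (gap2 t Ht).
    pose proof (ascending_xcoord traj1 up1 t Ht) as X1.
    pose proof (ascending_xcoord traj2 up2 t Ht) as X2.
    pose proof (Rle_abs K1). pose proof (Rle_abs K2). pose proof (Rabs_pos K1).
    pose proof (Rabs_pos K2).
    apply Rabs_le_between in X1, X2. unfold xcoord, ycoord in *.
    apply Rplus_le_compat; apply Rabs_le; unfold X; lra.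
Qed.

Lemma log_sinh_comparable a b K U : 0 < a -> 0 < b -> cosh b <= U ->
  ln (sinh a) <= ln (sinh b) + K -> a <= exp K * U * b.
Proof.
  intros Ha Hb HU logs. pose proof (sinh_pos a Ha). pose proof (sinh_pos b Hb).
  pose proof (exp_pos K).
  pose proof (sinh_ge_id a ltac:(lra)). pose proof (sinh_le_id_cosh b ltac:(lra)).
  assert (sinh a <= sinh b * exp K).
  { apply ln_le_inv; auto; [now apply Rmult_lt_0_compat|]. now rewrite ln_mult, ln_exp. }
  assert (b * cosh b <= b * U) by (apply Rmult_le_compat_l; lra).
  assert (sinh b * exp K <= b * U * exp K) by (apply Rmult_le_compat_r; lra). lra.
Qed.

Lemma landing_asymptotic {c1 g1 p1 s1 c2 g2 p2 s2} : trajectory c1 g1 p1 -> trajectory c2 g2 p2 ->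
  lands g1 p1 s1 -> lands g2 p2 s2 -> landing_point c1 g1 s1 = landing_point c2 g2 s2 ->
  asymptotic g1 g2.
Proof.
  intros traj1 traj2 land1 land2 same_point.
  destruct (landing_xcoord_rate traj1 land1) as (T1 & M1 & HM1 & rate1).
  destruct (landing_xcoord_rate traj2 land2) as (T2 & M2 & HM2 & rate2).
  destruct (landing_log_depth traj1 land1) as (T3 & K1 & U1 & HT3 & depth1).
  destruct (landing_log_depth traj2 land2) as (T4 & K2 & U2 & HT4 & depth2).
  set (E := exp (K1 + K2)). assert (HE : 0 < E) by apply exp_pos.
  set (R := 1 + E * Rabs U1 + E * Rabs U2). pose proof (Rabs_pos U1). pose proof (Rabs_pos U2).
  pose proof (Rle_abs U1). pose proof (Rle_abs U2).
  assert (HR : 1 <= R /\ E * U1 <= R /\ E * U2 <= R) by (unfold R; repeat split; nra).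
  apply (asymptotic_ultimately g1 g2 ((M1 + M2 + 1) * R * (U1 / 2 + 1)));
    [exact (trajectory_geodesic traj1)|exact (trajectory_geodesic traj2)|].
  destruct (ultimately_and _ _
    (ultimately_and _ _ (ex_intro _ T1 rate1) (ex_intro _ T2 rate2))
    (ultimately_and _ _ (ex_intro _ T3 depth1) (ex_intro _ T4 depth2))) as [T late].
  exists T. intros t Ht. destruct (late t Ht) as ((x1 & x2) & (d1 & u1) & (d2 & u2)).
  pose proof (ycoord_pos traj1 t) as y1_pos. pose proof (ycoord_pos traj2 t) as y2_pos.
  rewrite same_point in x1. apply Rabs_le_between in x1, x2, d1, d2.
  pose proof (log_sinh_comparable _ _ (K1 + K2) U2 y1_pos y2_pos u2 ltac:(lra)) as y12.
  pose proof (log_sinh_comparable _ _ (K1 + K2) U1 y2_pos y1_pos u1 ltac:(lra)) as y21.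
  fold E in y12, y21.
  assert (y1_le : ycoord g1 t <= U1).
  { pose proof (sinh_ge_id (ycoord g1 t) ltac:(lra)). pose proof (sinh_le_cosh (ycoord g1 t)).
    change (ucoord g1 t) with (cosh (ycoord g1 t)) in u1. lra. }
  assert (comparable : ycoord g1 t <= R * Rmin (ycoord g1 t) (ycoord g2 t) /\
                       ycoord g2 t <= R * Rmin (ycoord g1 t) (ycoord g2 t)).
  { unfold Rmin. destruct (Rle_dec (ycoord g1 t) (ycoord g2 t)); split; nra. }
  unfold xcoord, ycoord in *. apply comparable_dist; auto; [apply Rmult_le_pos; lra|].
  set (m := Rmin (snd (g1 t)) (snd (g2 t))) in *.
  assert (dx : Rabs (fst (g2 t) - fst (g1 t)) <= (M1 + M2) * (R * m)).
  { assert (M1 * snd (g1 t) <= M1 * (R * m)) by (apply Rmult_le_compat_l; lra).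
    assert (M2 * snd (g2 t) <= M2 * (R * m)) by (apply Rmult_le_compat_l; lra). apply Rabs_le. lra.
    }
  assert (dy : Rabs (snd (g2 t) - snd (g1 t)) <= R * m) by (apply Rabs_le; lra). lra.
Qed.

(** * Existence of geodesics *)

Lemma unit_speed_osc c u q s : unit_speed c u q ->
  unit_speed c (osc (lam c) u q s) (dosc (lam c) u q s).
Proof. unfold unit_speed. intros E. pose proof (osc_energy (lam c) u q s). lra. Qed.

Lemma osc_opp l a b s : osc l a (- b) s = osc l a b (- s) /\ dosc l a (- b) s = - dosc l a b (- s).
Proof.
  destruct (osc_affine l a b 0 (-1) s) as [E1 E2]. rewrite osc_0, dosc_0 in E1, E2.
  replace ((-1) ^ 2 * l) with l in E1, E2 by ring. replace (-1 * b) with (- b) in E1, E2 by ring.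
  replace (0 + -1 * s) with (- s) in E1, E2 by ring. split; [|rewrite <- E2]; auto. ring.
Qed.

Lemma lag_opp u p : lag u (- p) = - lag u p.
Proof.
  unfold lag. replace (sqrt 3 * u - - p) with (sqrt 3 * u + p) by ring. rewrite <- Rminus_def. ring.
Qed.

(* The inverse of [stime]: the arc length spent by the trajectory up to linearized time [s]. *)
Definition clock (c u0 q0 s : R) : R :=
  1 / 2 * s - sqrt 3 / 4 * (lag (osc (lam c) u0 q0 s) (dosc (lam c) u0 q0 s) - lag u0 q0).

Definition reachable (c u0 q0 s : R) : Prop :=
  forall r, Rmin 0 s <= r <= Rmax 0 s -> 1 < osc (lam c) u0 q0 r.

Lemma reachable_forward c u0 q0 s : 0 <= s ->
  (reachable c u0 q0 s <-> forall r, 0 <= r <= s -> 1 < osc (lam c) u0 q0 r).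
Proof. intros Hs. unfold reachable. now rewrite Rmin_left, Rmax_right. Qed.

Lemma reachable_between c u0 q0 a b r : reachable c u0 q0 a -> reachable c u0 q0 b -> a <= r <= b ->
  1 < osc (lam c) u0 q0 r.
Proof.
  intros Ha Hb Hr. pose proof (Rmin_r 0 a). pose proof (Rmax_l 0 a).
  pose proof (Rmin_l 0 b). pose proof (Rmax_r 0 b).
  destruct (Rle_dec 0 r); [apply Hb|apply Ha]; lra.
Qed.

Lemma reachable_self c u0 q0 s : reachable c u0 q0 s -> 1 < osc (lam c) u0 q0 s.
Proof. intros H. apply H. split; [apply Rmin_r|apply Rmax_r]. Qed.

Lemma reachable_opp c u0 q0 s : reachable c u0 (- q0) s -> reachable c u0 q0 (- s).
Proof.
  intros H r Hr. replace r with (- - r) by ring. rewrite <- (proj1 (osc_opp _ _ _ _)). apply H.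
  unfold Rmin, Rmax in *. destruct (Rle_dec 0 s), (Rle_dec 0 (- s)); lra.
Qed.

Lemma clock_opp c u0 q0 s : clock c u0 (- q0) s = - clock c u0 q0 (- s).
Proof.
  unfold clock. destruct (osc_opp (lam c) u0 q0 s) as [-> ->]. rewrite !lag_opp. field.
Qed.

Section Clock.

Variables c u0 q0 : R.
Hypothesis u0_gt_1 : 1 < u0.
Hypothesis initial_speed : unit_speed c u0 q0.

Let U := osc (lam c) u0 q0.
Let Q := dosc (lam c) u0 q0.

Lemma derive_clock (s : R) : 1 < U s -> is_derive (clock c u0 q0) s (/ srate (U s)).
Proof.
  intros HU. assert (D : is_derive (fun s => lag (U s) (Q s)) s (- (2 * sqrt 3) * 1 / (U s ^ 2 - 1))).
  { apply (is_derive_lag c); auto; [| |now apply unit_speed_osc].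
    - rewrite Rmult_1_r. apply is_derive_osc.
    - rewrite Rmult_1_r. apply is_derive_dosc. }
  unfold clock. fold U Q. derive_by_rules. unfold srate.
  transitivity (1 / 2 + sqrt 3 * sqrt 3 / 2 / (U s ^ 2 - 1)); [field; nra|].
  rewrite sqrt3_sq. field. nra.
Qed.

Lemma clock_increases a b : reachable c u0 q0 a -> reachable c u0 q0 b -> a <= b ->
  b - a <= 2 * (clock c u0 q0 b - clock c u0 q0 a).
Proof.
  intros Ha Hb Hab. enough (clock c u0 q0 a - 1 / 2 * a <= clock c u0 q0 b - 1 / 2 * b) by lra.
  apply (derive_nonneg_le (fun s => clock c u0 q0 s - 1 / 2 * s) (fun s => / srate (U s) - 1 / 2)); auto.
  - intros r Hr. pose proof (derive_clock r (reachable_between c u0 q0 a b r Ha Hb Hr)).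
    derive_by_rules. ring.
  - intros r Hr. assert (HU : 1 < U r) by (apply (reachable_between c u0 q0 a b); auto; lra).
    pose proof (srate_pos _ HU). pose proof (srate_lt_2 (U r)).
    assert (/ 2 <= / srate (U r)) by (apply Rinv_le_contravar; lra). lra.
Qed.

Lemma clock_expands a b : reachable c u0 q0 a -> reachable c u0 q0 b ->
  Rabs (b - a) <= 2 * Rabs (clock c u0 q0 b - clock c u0 q0 a).
Proof.
  intros Ha Hb. destruct (Rle_dec a b).
  - pose proof (clock_increases a b Ha Hb ltac:(lra)). rewrite !Rabs_right; lra.
  - pose proof (clock_increases b a Hb Ha ltac:(lra)). rewrite !Rabs_left1; lra.
Qed.

Lemma reachable_0 : reachable c u0 q0 0.
Proof.
  apply reachable_forward; [lra|]. intros r Hr. replace r with 0 by lra. now rewrite osc_0.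
Qed.

Lemma clock_0 : clock c u0 q0 0 = 0.
Proof. unfold clock. rewrite osc_0, dosc_0. field. Qed.

(* Has the sign of [clock s - t] (see [clock_gap_clock]), but stays continuous where [U = 1]. *)
Definition clock_gap (t s : R) : R :=
  exp (2 / sqrt 3 * s + (lag u0 q0 - 4 / sqrt 3 * t)) * (sqrt 3 * U s - Q s) - (sqrt 3 * U s + Q s).

Lemma continuity_clock_gap t : continuity (clock_gap t).
Proof.
  unfold clock_gap. intro s. apply continuity_pt_minus; [apply continuity_pt_mult|].
  - apply (is_derive_continuity_pt _ _
      (2 / sqrt 3 * exp (2 / sqrt 3 * s + (lag u0 q0 - 4 / sqrt 3 * t)))).
    auto_derive; auto. ring.
  - pose proof (is_derive_osc (lam c) u0 q0). pose proof (is_derive_dosc (lam c) u0 q0).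
    eapply is_derive_continuity_pt. unfold U, Q. derive_by_rules. reflexivity.
  - pose proof (is_derive_osc (lam c) u0 q0). pose proof (is_derive_dosc (lam c) u0 q0).
    eapply is_derive_continuity_pt. unfold U, Q. derive_by_rules. reflexivity.
Qed.

Lemma clock_gap_clock t s : 1 < U s -> exists k, 0 < k /\
  clock_gap t s = k * (exp (4 / sqrt 3 * (clock c u0 q0 s - t)) - 1).
Proof.
  intros HU. pose proof sqrt3_bounds.
  destruct (unit_speed_gap c (U s) (Q s) HU (unit_speed_osc _ _ _ s initial_speed))
    as (plus & minus & _).
  exists (sqrt 3 * U s + Q s). split; auto. unfold clock_gap.
  replace (2 / sqrt 3 * s + (lag u0 q0 - 4 / sqrt 3 * t)) with
    (4 / sqrt 3 * (clock c u0 q0 s - t) + lag (U s) (Q s)) by (unfold clock, U, Q; field; lra).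
  unfold lag at 1. rewrite exp_plus, <- ln_div, exp_ln by (auto; now apply Rdiv_lt_0_compat).
  field. lra.
Qed.

Lemma clock_onto_before t b : 0 < t -> 0 <= b -> 0 <= clock_gap t b ->
  (forall r, 0 <= r <= b -> 1 < U r \/ 0 < clock_gap t r) ->
  exists s, reachable c u0 q0 s /\ clock c u0 q0 s = t.
Proof.
  intros Ht Hb gap_b alternative.
  assert (rate : 0 < 4 / sqrt 3) by (pose proof sqrt3_bounds; apply Rdiv_lt_0_compat; lra).
  destruct (first_zero (fun s => - clock_gap t s) 0 b) as (s & Hs & gap_s & before); auto; try lra.
  - intro r. apply continuity_pt_opp, continuity_clock_gap.
  - destruct (clock_gap_clock t 0) as (k & Hk & ->); [unfold U; now rewrite osc_0|].
    rewrite clock_0. assert (exp (4 / sqrt 3 * (0 - t)) < 1); [|nra].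
    rewrite <- exp_0. apply exp_increasing. nra.
  - assert (above : forall r, 0 <= r <= s -> 1 < U r).
    { intros r Hr. destruct (alternative r ltac:(lra)) as [|gap_r]; auto.
      destruct (Req_dec r s) as [->|]; [lra|]. specialize (before r ltac:(lra)). lra. }
    exists s. split; [apply reachable_forward; [lra|auto]|].
    destruct (clock_gap_clock t s (above s ltac:(lra))) as (k & Hk & gap_eq).
    assert (E : exp (4 / sqrt 3 * (clock c u0 q0 s - t)) = exp 0) by (rewrite exp_0; nra).
    apply exp_inv in E. nra.
Qed.

Lemma first_exit b : 0 <= b -> U b <= 1 ->
  exists m, 0 < m /\ U m = 1 /\ Q m = - sqrt 3 /\ forall r, 0 <= r < m -> 1 < U r.
Proof.
  intros Hb HU.
  destruct (first_zero (fun s => U s - 1) 0 b) as (m & Hm & Um & before); auto; try lra.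
  - intro r. apply continuity_pt_minus; [apply continuity_osc|].
    apply continuity_pt_const. intros x y. reflexivity.
  - unfold U. rewrite osc_0. lra.
  - exists m. split; [lra|]. split; [lra|]. split; [|intros r Hr; specialize (before r Hr); lra].
    assert (Qm : Q m <= 0).
    { apply (derive_nonpos_at_zero (fun s => U s - 1) 0 m); auto; [|lra].
      pose proof (is_derive_osc (lam c) u0 q0). unfold U, Q. derive_by_rules. ring. }
    pose proof (unit_speed_osc c u0 q0 m initial_speed) as E. unfold unit_speed in E.
    fold (U m) (Q m) in E. replace (U m) with 1 in E by lra.
    pose proof sqrt3_sq. pose proof sqrt3_bounds. nra.
Qed.

Lemma clock_onto_pos t : 0 < t -> exists s, reachable c u0 q0 s /\ clock c u0 q0 s = t.
Proof.
  intros Ht. destruct (classic (exists b, 0 <= b /\ U b <= 1)) as [(b & Hb & HU)|never].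
  - destruct (first_exit b Hb HU) as (m & Hm & Um & Qm & before). pose proof sqrt3_bounds.
    assert (gap_m : 0 < clock_gap t m).
    { unfold clock_gap. rewrite Um, Qm.
      pose proof (exp_pos (2 / sqrt 3 * m + (lag u0 q0 - 4 / sqrt 3 * t))).
      nra. }
    apply (clock_onto_before t m); auto; try lra. intros r Hr.
    destruct (Req_dec r m) as [->|]; [now right|left; apply before; lra].
  - assert (above : forall r, 0 <= r -> 1 < U r).
    { intros r Hr. apply Rnot_le_lt. intro. apply never. now exists r. }
    apply (clock_onto_before t (2 * t)); auto; try lra; [|intros r Hr; left; apply above; lra].
    destruct (clock_gap_clock t (2 * t)) as (k & Hk & ->); [apply above; lra|].
    assert (late : reachable c u0 q0 (2 * t)).
    { apply reachable_forward; [lra|]. intros r Hr. apply above. lra. }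
    pose proof (clock_increases 0 (2 * t) reachable_0 late ltac:(lra)) as increase.
    rewrite clock_0 in increase. pose proof sqrt3_bounds.
    assert (exp 0 <= exp (4 / sqrt 3 * (clock c u0 q0 (2 * t) - t))); [|rewrite exp_0 in *; nra].
    apply exp_le, Rmult_le_pos; [apply Rdiv_le_0_compat|]; lra.
Qed.

End Clock.

Lemma unit_speed_opp c u q : unit_speed c u q -> unit_speed c u (- q).
Proof. unfold unit_speed. intros E. rewrite <- E. ring. Qed.

Lemma clock_onto c u0 q0 t : 1 < u0 -> unit_speed c u0 q0 ->
  exists s, reachable c u0 q0 s /\ clock c u0 q0 s = t.
Proof.
  intros Hu speed. destruct (Rtotal_order t 0) as [Ht|[->|Ht]].
  - destruct (clock_onto_pos c u0 (- q0) Hu (unit_speed_opp _ _ _ speed) (- t) ltac:(lra))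
      as (s & Hs & E).
    exists (- s). split; [now apply reachable_opp|]. rewrite clock_opp in E. lra.
  - exists 0. split; [now apply reachable_0|apply clock_0].
  - now apply clock_onto_pos.
Qed.

Lemma exists_inverse_clock c u0 q0 : 1 < u0 -> unit_speed c u0 q0 ->
  exists s, (forall a, reachable c u0 q0 a -> s (clock c u0 q0 a) = a) /\
    forall t : R, 1 < osc (lam c) u0 q0 (s t) /\ is_derive s t (srate (osc (lam c) u0 q0 (s t))).
Proof.
  intros Hu speed.
  set (inverse := fun t => constructive_indefinite_description _ (clock_onto c u0 q0 t Hu speed)).
  set (s := fun t => proj1_sig (inverse t)).
  assert (Hs : forall t, reachable c u0 q0 (s t) /\ clock c u0 q0 (s t) = t)
    by (intro t; exact (proj2_sig (inverse t))).
  clearbody s. clear inverse. exists s. split.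
  - intros a Ha. destruct (Hs (clock c u0 q0 a)) as [R E].
    pose proof (clock_expands c u0 q0 speed _ _ Ha R) as close.
    rewrite E, Rminus_diag, Rabs_R0, Rmult_0_r in close.
    apply Rminus_diag_uniq, Rabs_eq_0. pose proof (Rabs_pos (s (clock c u0 q0 a) - a)). lra.
  - intro t. pose proof (reachable_self _ _ _ _ (proj1 (Hs t))) as above. split; auto.
    rewrite <- (Rinv_inv (srate _)). pose proof (srate_pos _ above).
    apply (is_derive_inverse (clock c u0 q0)).
    + now apply derive_clock.
    + now apply Rgt_not_eq, Rinv_0_lt_compat.
    + intro r. apply Hs.
    + apply lipschitz_on_bounded_continuity. intros K. exists 2. intros r r' _ _.
      destruct (Hs r) as [Rr Er], (Hs r') as [Rr' Er'].
      rewrite <- Er at 2. rewrite <- Er' at 2. now apply clock_expands.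
Qed.

Theorem trajectory_exists c q0 q : in_Sigma q -> unit_speed c (cosh (snd q)) q0 ->
  exists g p, trajectory c g p /\ g 0 = q /\ p 0 = q0 /\
    forall s, 0 <= s -> (forall r, 0 <= r <= s -> 1 < osc (lam c) (cosh (snd q)) q0 r) ->
      exists T, 0 <= T /\
        g T = (fst q + 2 * c * s, acosh (osc (lam c) (cosh (snd q)) q0 s)).
Proof.
  destruct q as [x0 y0]. unfold in_Sigma. cbn [fst snd]. intros Hy speed.
  pose proof (cosh_gt_1 y0 Hy) as Hu. set (u0 := cosh y0) in *.
  set (U := osc (lam c) u0 q0). set (Q := dosc (lam c) u0 q0).
  destruct (exists_inverse_clock c u0 q0 Hu speed) as (s & s_clock & Hs).
  assert (s_0 : s 0 = 0) by (rewrite <- (clock_0 c u0 q0) at 1; apply s_clock, reachable_0; auto).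
  assert (HU : forall t, 1 < U (s t)) by (intro; apply Hs).
  assert (Ds : forall t : R, is_derive s t (srate (U (s t)))) by (intro; apply Hs).
  assert (cosh_U : forall t, cosh (acosh (U (s t))) = U (s t)).
  { intro t. apply cosh_acosh. specialize (HU t). lra. }
  exists (fun t => (x0 + 2 * c * s t, acosh (U (s t)))), (fun t => Q (s t)).
  split; [|split; [|split]].
  - intro t. unfold xcoord, ucoord, ycoord. cbn [fst snd]. rewrite cosh_U.
    split; [now apply acosh_pos|]. split; [derive_by_rules; ring|]. split; [|split].
    + apply is_derive_ext with (fun t => U (s t)); [intro r; now rewrite cosh_U|].
      rewrite Rmult_comm. apply (is_derive_comp_R U s); auto. apply is_derive_osc.
    + rewrite Rmult_comm. apply (is_derive_comp_R Q s); auto. apply is_derive_dosc.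
    + now apply unit_speed_osc.
  - rewrite s_0. unfold U. rewrite osc_0. unfold u0. rewrite acosh_cosh by lra. f_equal. ring.
  - rewrite s_0. apply dosc_0.
  - intros a Ha above. assert (Ra : reachable c u0 q0 a) by (apply reachable_forward; auto).
    exists (clock c u0 q0 a). rewrite s_clock by auto. split; auto.
    pose proof (clock_increases c u0 q0 speed 0 a (reachable_0 c u0 q0 Hu) Ra Ha) as increase.
    rewrite clock_0 in increase. lra.
Qed.

(** * Ends *)

Definition has_end (c : R) (g : R -> R * R) (p : R -> R) (w : R * R) : Prop :=
  ascends c p /\ w = direction c \/ exists se, lands g p se /\ w = to_disk (landing_point c g se, 0).

Lemma exists_end {c g p} : trajectory c g p -> exists w, has_end c g p w.
Proof.
  intros traj. destruct (ascends_or_lands traj) as [up|[se landing]].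
  - exists (direction c). now left.
  - exists (to_disk (landing_point c g se, 0)). right. now exists se.
Qed.

Lemma has_end_locally_uniform {c g p w} : trajectory c g p -> has_end c g p w ->
  locally_uniform_end c g p w.
Proof.
  intros traj [[[L Hp] ->]|(se & landing & ->)]; [|now apply locally_uniform_end_landing].
  destruct L
    as [L|L]; [now apply locally_uniform_end_ascending|now apply locally_uniform_end_critical].
Qed.

Lemma has_end_conv_to {c g p w} : trajectory c g p -> has_end c g p w ->
  conv_to (fun t => to_disk (g t)) w.
Proof. intros traj ends. now apply (locally_uniform_end_conv_to traj), has_end_locally_uniform. Qed.

Lemma direction_unit c : 0 <= lam c -> fst (direction c) ^ 2 + snd (direction c) ^ 2 = 1.
Proof. intros L. unfold direction. cbn [fst snd]. rewrite pow2_sqrt by auto. unfold lam. ring. Qed.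

Lemma direction_inj c1 c2 : direction c1 = direction c2 -> c1 = c2.
Proof. unfold direction. intros E. injection E. lra. Qed.

Lemma direction_not_bottom c xi : 0 <= lam c -> direction c <> to_disk (xi, 0).
Proof.
  intros L E. pose proof (direction_unit c L) as unit. rewrite E, to_disk_bottom in unit.
  cbn [fst snd] in unit. pose proof (squash_bounds xi). nra.
Qed.

Lemma has_end_bdD {c g p w} : has_end c g p w -> bdD w.
Proof.
  intros [[[L _] ->]|(se & _ & ->)].
  - left. split; [now apply direction_unit|apply sqrt_pos].
  - right. rewrite to_disk_bottom. cbn [fst snd].
    pose proof (squash_bounds (landing_point c g se)). lra.
Qed.

Lemma asymptotic_iff_same_end {c1 g1 p1 w1 c2 g2 p2 w2} : trajectory c1 g1 p1 -> trajectory c2 g2 p2 ->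
  has_end c1 g1 p1 w1 -> has_end c2 g2 p2 w2 -> (asymptotic g1 g2 <-> w1 = w2).
Proof.
  intros traj1 traj2 [[up1 ->]|(s1 & land1 & ->)] [[up2 ->]|(s2 & land2 & ->)].
  - split; [intros; f_equal; now apply (ascending_asymptotic_c traj1 traj2)|].
    intros E. apply direction_inj in E. subst c2. now apply (ascending_asymptotic traj1 traj2).
  - split; [|intros E; exfalso; apply (direction_not_bottom _ _ (proj1 up1) E)].
    intros close. exfalso.
    exact (proj1 (ascending_landing_not_asymptotic traj1 traj2 up1 land2) close).
  - split; [|intros E; exfalso; apply (direction_not_bottom _ _ (proj1 up2) (eq_sym E))].
    intros close. exfalso.
    exact (proj2 (ascending_landing_not_asymptotic traj2 traj1 up2 land1) close).
  - split.
    + intros. now rewrite (landing_asymptotic_point traj1 traj2 land1 land2).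
    + intros E. now apply (landing_asymptotic traj1 traj2 land1 land2), to_disk_bottom_inj.
Qed.

Lemma end_determines_direction {c1 g1 p1 c2 g2 p2 w} : trajectory c1 g1 p1 -> trajectory c2 g2 p2 ->
  has_end c1 g1 p1 w -> has_end c2 g2 p2 w -> g1 0 = g2 0 -> c1 = c2 /\ p1 0 = p2 0.
Proof.
  intros traj1 traj2 [[up1 ->]|(s1 & land1 & ->)] [[up2 E]|(s2 & land2 & E)] start.
  - apply direction_inj in E. subst c2. split; auto.
    pose proof (trajectory_unit_speed traj1 0) as E1.
    pose proof (trajectory_unit_speed traj2 0) as E2.
    destruct (coords_eq _ _ _ start) as (_ & _ & u_eq). rewrite u_eq in E1.
    unfold unit_speed in E1, E2. destruct up1, up2. nra.
  - exfalso. apply (direction_not_bottom _ _ (proj1 up1) E).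
  - exfalso. apply (direction_not_bottom _ _ (proj1 up2) (eq_sym E)).
  - apply (landing_direction_unique traj1 traj2 land1 land2 start). now apply to_disk_bottom_inj.
Qed.

(** * Geodesics from a point to a point or to an end *)

Lemma connecting_osc a b x : 1 < a -> 1 <= b -> (x, b) <> (0, a) ->
  exists c q s1, unit_speed c a q /\ 0 < s1 /\ 2 * c * s1 = x /\ osc (lam c) a q s1 = b /\
    forall r, 0 <= r < s1 -> 1 < osc (lam c) a q r.
Proof.
  intros Ha Hb distinct.
  destruct (boundary_value_problem a b x Ha Hb distinct) as (k & v & Hk & Hv & end_value & above).
  set (s1 := sqrt (x ^ 2 + k)). assert (Hs : 0 < s1) by (apply sqrt_lt_R0; lra).
  assert (s1_sq : s1 ^ 2 = x ^ 2 + k) by (apply pow2_sqrt; lra).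
  set (c := x / (2 * s1)).
  assert (Ek : s1 ^ 2 * lam c = k).
  { transitivity (s1 ^ 2 - x ^ 2); [|lra]. unfold lam, c. field. lra. }
  assert (rescale : forall r, osc (lam c) a (v / s1) (s1 * r) = osc k a v r).
  { intro r. pose proof (proj1 (osc_affine (lam c) a (v / s1) 0 s1 r)) as E.
    rewrite Rplus_0_l, osc_0, dosc_0, Ek in E. rewrite E. f_equal. field. lra. }
  exists c, (v / s1), s1. split; [|split; [auto|split; [|split]]].
  - unfold unit_speed. apply (Rmult_eq_reg_l (s1 ^ 2)); [|nra].
    replace (s1 ^ 2 * (v / s1) ^ 2) with (v ^ 2) by (field; lra).
    replace (s1 ^ 2 * (3 + lam c * (a ^ 2 - 1))) with (3 * s1 ^ 2 + s1 ^ 2 * lam c * (a ^ 2 - 1)) by ring.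
    rewrite Ek, Hv, s1_sq. ring.
  - unfold c. field. lra.
  - now rewrite <- (rescale 1), Rmult_1_r in end_value.
  - intros r Hr. replace r with (s1 * (r / s1)) by (field; lra). rewrite rescale. apply above.
    split; [apply Rdiv_le_0_compat; lra|]. apply -> Rdiv_lt_1; lra.
Qed.

Theorem geodesic_through q1 q2 : in_Sigma q1 -> in_Sigma q2 -> q1 <> q2 ->
  exists g T, geodesic g /\ g 0 = q1 /\ 0 < T /\ g T = q2.
Proof.
  destruct q1 as [x1 y1], q2 as [x2 y2]. intros H1 H2 distinct. pose proof H1 as Hy1.
  pose proof H2 as Hy2.
  unfold in_Sigma in Hy1, Hy2. cbn [snd] in Hy1, Hy2. pose proof (cosh_gt_1 y1 Hy1).
  pose proof (cosh_gt_1 y2 Hy2).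
  destruct (connecting_osc (cosh y1) (cosh y2) (x2 - x1))
    as (c & q & s1 & speed & Hs & Ex & Eu & above);
    try lra.
  { intros E. injection E as Ex Ey. apply distinct. apply cosh_inj in Ey; [|lra|lra]. f_equal; lra.
    }
  destruct (trajectory_exists c q (x1, y1) H1 speed) as (g & p & traj & start & _ & reach).
  destruct (reach s1 ltac:(lra)) as (T & HT & E).
  { intros r Hr. cbn [snd]. destruct (Req_dec r s1) as [->|]; [rewrite Eu; auto|apply above; lra]. }
  assert (E2 : g T = (x2, y2)).
  { rewrite E. cbn [fst snd]. rewrite Eu, Ex, acosh_cosh by lra. f_equal. ring. }
  exists g, T. split; [exact (trajectory_geodesic traj)|]. split; [auto|]. split; [|auto].
  destruct HT as [|<-]; [auto|]. exfalso. apply distinct. now rewrite <- E2.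
Qed.

Lemma trajectory_landing_at q xi : in_Sigma q ->
  exists c g p se, trajectory c g p /\ g 0 = q /\ lands g p se /\ landing_point c g se = xi.
Proof.
  destruct q as [x0 y0]. intros Hq. pose proof Hq as Hy. unfold in_Sigma in Hy. cbn [snd] in Hy.
  pose proof (cosh_gt_1 y0 Hy).
  destruct (connecting_osc (cosh y0) 1 (xi - x0))
    as (c & q & s1 & speed & Hs & Ex & Eu & above); try lra.
  { intros E. injection E. lra. }
  destruct (trajectory_exists c q (x0, y0) Hq speed) as (g & p & traj & start & p_start & reach).
  assert (u_start : ucoord g 0 = cosh y0) by (unfold ucoord, ycoord; now rewrite start).
  exists c, g, p. destruct (ascends_or_lands traj) as [up|[se landing]].
  - exfalso.
    destruct (continuity_at _ s1 (cosh y0 - 1) (continuity_osc (lam c) (cosh y0) q) ltac:(lra))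
      as (d & Hd & near).
    set (s := Rmax 0 (s1 - d / 2)). assert (0 <= s) by apply Rmax_l.
    assert (s1 - d / 2 <= s) by apply Rmax_r. assert (s < s1) by (apply Rmax_lub_lt; lra).
    specialize (near s ltac:(apply Rabs_def1; lra)). apply Rabs_def2 in near. rewrite Eu in near.
    destruct (reach s ltac:(lra)) as (T & HT & E); [intros r Hr; apply above; lra|].
    pose proof (ascending_ucoord_le traj up 0 T HT) as low. rewrite u_start in low.
    unfold ucoord, ycoord in low. rewrite E in low. cbn [fst snd] in low.
    pose proof (above s ltac:(lra)). rewrite cosh_acosh in low by lra. lra.
  - exists se. split; [auto|]. split; [auto|]. split; [auto|].
    pose proof (landing_osc traj landing) as at_landing.
    pose proof (landing_osc_gt_1 traj landing) as before. rewrite u_start, p_start in *.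
    assert (se = s1) as ->.
    { destruct (Rtotal_order se s1) as [lt|[|gt]]; auto; exfalso.
      - pose proof (landing_time_pos traj landing). pose proof (above se ltac:(lra)). lra.
      - pose proof (before s1 ltac:(lra)). lra. }
    unfold landing_point, xcoord. rewrite start, Ex. cbn [fst]. ring.
Qed.

Theorem trajectory_to_end q w : in_Sigma q -> bdD w ->
  exists c g p, trajectory c g p /\ g 0 = q /\ has_end c g p w.
Proof.
  intros Hq Hw. destruct w as [a b].
  assert (cases : (a ^ 2 + b ^ 2 = 1 /\ 0 <= b) \/ (b = 0 /\ -1 < a < 1)).
  { unfold bdD in Hw. cbn [fst snd] in Hw. destruct Hw as [|[Hb Ha]]; [now left|].
    destruct (Req_dec a 1); [left; split; nra|]. destruct (Req_dec a (-1)); [left; split; nra|].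
    right. lra. }
  destruct cases as [[unit Hb]|[-> Ha]].
  - set (c := a / 2). assert (L : lam c = b ^ 2) by (unfold lam, c; lra).
    assert (speed_sq : 0 < 3 + lam c * (cosh (snd q) ^ 2 - 1)).
    { rewrite L. nra. }
    destruct (trajectory_exists c (sqrt (3 + lam c * (cosh (snd q) ^ 2 - 1))) q Hq)
      as (g & p & traj & start & p_start & _).
    { unfold unit_speed. now rewrite pow2_sqrt by lra. }
    exists c, g, p. split; [auto|]. split; [auto|]. left. split.
    + split; [rewrite L; apply pow2_ge_0|]. rewrite p_start. now apply sqrt_lt_R0.
    + unfold direction. rewrite L, sqrt_pow2 by auto. unfold c. f_equal. field.
  - destruct (squash_onto a Ha) as [xi <-].
    destruct (trajectory_landing_at q xi Hq) as (c & g & p & se & traj & start & landing & E).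
    exists c, g, p. split; [auto|]. split; [auto|]. right. exists se. split; [auto|].
    now rewrite E, to_disk_bottom.
Qed.

(** * The compactification map *)

Definition Phi (z : cpt) : R * R :=
  match z with
  | Pt q => to_disk q
  | Inf g => (real (Lim (fun t => fst (to_disk (g t))) p_infty),
              real (Lim (fun t => snd (to_disk (g t))) p_infty))
  end.

Lemma Phi_conv_to g w : conv_to (fun t => to_disk (g t)) w -> Phi (Inf g) = w.
Proof.
  intros conv. destruct w as [a b].
  assert (limit : forall (f : R -> R) l,
     (forall e, 0 < e -> exists T, forall t, T <= t -> Rabs (f t - l) < e) -> real (Lim f p_infty) = l).
  { intros f l H. rewrite (is_lim_unique f p_infty (Finite l)); [reflexivity|].
    apply is_lim_spec. intro e. destruct (H e (cond_pos e)) as [T HT]. exists T. intros t Ht.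
    apply HT. lra. }
  cbn [Phi]. f_equal; apply limit; intros e He; destruct (conv e He)
    as [T HT]; exists T; intros t Ht;
    now apply HT.
Qed.

Lemma has_end_Phi {c g p} : trajectory c g p -> has_end c g p (Phi (Inf g)).
Proof.
  intros traj. destruct (exists_end traj) as [w ends].
  now rewrite (Phi_conv_to g w (has_end_conv_to traj ends)).
Qed.

Lemma Phi_has_end {c g p w} : trajectory c g p -> has_end c g p w -> Phi (Inf g) = w.
Proof. intros traj ends. apply Phi_conv_to, (has_end_conv_to traj ends). Qed.

Lemma Phi_Inf_eq g1 g2 : geodesic g1 -> geodesic g2 ->
  (Phi (Inf g1) = Phi (Inf g2) <-> asymptotic g1 g2).
Proof.
  intros H1 H2. destruct (geodesic_trajectory g1 H1) as (c1 & p1 & traj1).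
  destruct (geodesic_trajectory g2 H2) as (c2 & p2 & traj2).
  symmetry. exact (asymptotic_iff_same_end traj1 traj2 (has_end_Phi traj1) (has_end_Phi traj2)).
Qed.

Lemma Phi_Inf_bdD g : geodesic g -> bdD (Phi (Inf g)).
Proof.
  intros H. destruct (geodesic_trajectory g H) as (c & p & traj).
  exact (has_end_bdD (has_end_Phi traj)).
Qed.

Lemma inD_cases w : inD w <-> bdD w \/ (fst w ^ 2 + snd w ^ 2 < 1 /\ 0 < snd w).
Proof.
  unfold inD, bdD. split; [|intros [[|]|]; split; nra]. intros [[H1|H1] H2]; [|now left; left].
  destruct H2 as [H2|H2]; [now right|left; right]. rewrite <- H2 in H1. split; [auto|nra].
Qed.

Lemma Phi_inD z : valid z -> inD (Phi z).
Proof.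
  intros Hz. apply inD_cases. destruct z as [q|g]; [right; now apply to_disk_interior|left].
  now apply Phi_Inf_bdD.
Qed.

Lemma Phi_onto w : inD w -> exists z, valid z /\ Phi z = w.
Proof.
  intros Hw. apply inD_cases in Hw. destruct Hw as [boundary|[inside Hy]].
  - destruct (trajectory_to_end p0 w ltac:(unfold in_Sigma, p0; cbn; lra) boundary)
      as (c & g & p & traj & _ & ends).
    exists (Inf g). split; [exact (trajectory_geodesic traj)|exact (Phi_has_end traj ends)].
  - exists (Pt (of_disk w)). split; [now apply in_Sigma_of_disk|now apply to_disk_of_disk].
Qed.

Lemma Phi_bdD z : valid z -> (is_inf z <-> bdD (Phi z)).
Proof.
  intros Hz. destruct z as [q|g]; split; simpl is_inf; try tauto.
  - destruct (to_disk_interior q Hz). intros [boundary|boundary]; simpl Phi in boundary; lra.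
  - intros _. now apply Phi_Inf_bdD.
Qed.

Lemma Phi_same z1 z2 : valid z1 -> valid z2 -> (Phi z1 = Phi z2 <-> same z1 z2).
Proof.
  intros H1 H2. pose proof (Phi_bdD z1 H1) as bd1. pose proof (Phi_bdD z2 H2) as bd2.
  destruct z1 as [q1|g1], z2 as [q2|g2]; cbn [same is_inf] in *.
  - cbn [Phi]. split; [|congruence]. intros E.
    now rewrite <- (of_disk_to_disk q1), E, of_disk_to_disk.
  - split; [|tauto]. intros E. rewrite E in bd1. tauto.
  - split; [|tauto]. intros E. rewrite E in bd1. tauto.
  - now apply Phi_Inf_eq.
Qed.

(** * Angles *)

Definition unit_vector (u : R * R) : Prop := fst u ^ 2 + snd u ^ 2 = 1.

Definition cos_angle (v u : R * R) : R :=
  (fst v * fst u + snd v * snd u) / sqrt (fst v ^ 2 + snd v ^ 2).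

Lemma norm_pos v : v <> (0, 0) -> 0 < sqrt (fst v ^ 2 + snd v ^ 2).
Proof.
  intros Hv. apply sqrt_lt_R0. destruct v as [a b]. cbn [fst snd].
  destruct (Req_dec a 0) as [->|]; [|nra]. destruct (Req_dec b 0) as [->|]; [|nra].
  now contradict Hv.
Qed.

Lemma angle_unit v u m : 0 < m -> unit_vector u ->
  angle v (m * fst u, m * snd u) = acos (cos_angle v u).
Proof.
  intros Hm Hu. unfold angle, cos_angle. cbn [fst snd]. f_equal.
  replace ((m * fst u) ^ 2 + (m * snd u) ^ 2) with (m ^ 2 * (fst u ^ 2 + snd u ^ 2)) by ring.
  rewrite Hu, Rmult_1_r, sqrt_pow2 by lra. unfold Rdiv. rewrite Rinv_mult.
  set (k := / sqrt (fst v ^ 2 + snd v ^ 2)). field. lra.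
Qed.

Lemma cos_angle_bounds v u : v <> (0, 0) -> unit_vector u -> -1 <= cos_angle v u <= 1.
Proof.
  intros Hv Hu. pose proof (norm_pos v Hv) as Hn. unfold cos_angle. unfold unit_vector in Hu.
  assert (n_sq : sqrt (fst v ^ 2 + snd v ^ 2) ^ 2 = fst v ^ 2 + snd v ^ 2) by (apply pow2_sqrt; nra).
  set (n := sqrt (fst v ^ 2 + snd v ^ 2)) in *.
  pose proof (pow2_ge_0 (fst v * snd u - snd v * fst u)).
  assert (cauchy_schwarz : (fst v * fst u + snd v * snd u) ^ 2 <= n ^ 2).
  { assert ((fst v ^ 2 + snd v ^ 2) * (fst u ^ 2 + snd u ^ 2) = n ^ 2) by (rewrite Hu; lra). nra. }
  split; [apply -> Rle_div_r|apply <- Rle_div_l]; auto; nra.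
Qed.

Lemma acos_lt_iff x e : -1 <= x <= 1 -> 0 < e <= PI -> (acos x < e <-> cos e < x).
Proof.
  intros Hx He. pose proof (acos_bound x). rewrite <- (cos_acos x) at 2 by auto.
  split; intros lt; [apply cos_decreasing_1|apply cos_decreasing_0]; lra.
Qed.

Lemma one_minus_sq_le_cos x : 0 < x <= PI -> 1 - x ^ 2 / 2 <= cos x.
Proof.
  intros Hx. replace x with (2 * (x / 2)) at 2 by field. rewrite cos_2a_sin.
  pose proof (sin_lt_x (x / 2) ltac:(lra)). pose proof (sin_ge_0 (x / 2) ltac:(lra) ltac:(lra)).
  nra.
Qed.

Lemma close_to_of_small_angle v u e : unit_vector v -> unit_vector u -> 0 < e <= 1 ->
  acos (cos_angle v u) < e -> close_to u v e.
Proof.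
  intros Hv Hu He small. pose proof PI2_1.
  apply acos_lt_iff in small; [|apply cos_angle_bounds; auto|lra].
  - pose proof (one_minus_sq_le_cos e ltac:(lra)). apply close_to_of_sq; [lra|].
    unfold cos_angle in small. unfold unit_vector in *. rewrite Hv, sqrt_1, Rdiv_1_r in small. nra.
  - intros ->. unfold unit_vector in Hv. cbn [fst snd] in Hv. lra.
Qed.

Lemma angle_continuous v u e : v <> (0, 0) -> unit_vector u -> 0 < e -> acos (cos_angle v u) < e ->
  exists h, 0 < h /\ forall u', unit_vector u' -> close_to u' u h -> acos (cos_angle v u') < e.
Proof.
  intros Hv Hu He small. destruct (Rle_dec e PI) as [Hpi|Hpi].
  2:{ exists 1. split; [lra|]. intros u' _ _. pose proof (acos_bound (cos_angle v u')). lra. }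
  apply acos_lt_iff in small; auto using cos_angle_bounds. pose proof (norm_pos v Hv) as Hn.
  set (n := sqrt (fst v ^ 2 + snd v ^ 2)) in *. set (S := Rabs (fst v) + Rabs (snd v) + n).
  pose proof (Rabs_pos (fst v)). pose proof (Rabs_pos (snd v)).
  set (gap := n * (cos_angle v u - cos e)).
  assert (Hgap : 0 < gap) by (apply Rmult_lt_0_compat; lra).
  assert (HS : 0 < S) by (unfold S; lra). exists (gap / S). split; [now apply Rdiv_lt_0_compat|].
  intros u' Hu' [near1 near2]. apply acos_lt_iff; auto using cos_angle_bounds.
  assert (change : Rabs (fst v * (fst u' - fst u) + snd v * (snd u' - snd u)) < gap).
  { eapply Rle_lt_trans; [apply Rabs_triang|]. rewrite !Rabs_mult.
    replace gap with (S * (gap / S)) by (field; lra). set (h := gap / S) in *.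
    assert (0 < h) by now apply Rdiv_lt_0_compat.
    assert (Rabs (fst v) * Rabs (fst u' - fst u) <= Rabs (fst v) * h) by (apply Rmult_le_compat_l; lra).
    assert (Rabs (snd v) * Rabs (snd u' - snd u) <= Rabs (snd v) * h) by (apply Rmult_le_compat_l; lra).
    assert (0 < n * h) by now apply Rmult_lt_0_compat. unfold S. lra. }
  apply (Rmult_lt_reg_l n); auto. unfold gap, cos_angle in *. fold n in change |- *.
  replace (n * ((fst v * fst u' + snd v * snd u') / n)) with (fst v * fst u' + snd v * snd u') by (field; lra).
  replace (n * ((fst v * fst u + snd v * snd u) / n - cos e)) with
    (fst v * fst u + snd v * snd u - n * cos e) in change by (field; lra).
  apply Rabs_def2 in change. lra.
Qed.

Lemma unit_vector_angle u : unit_vector u -> exists al, - PI <= al <= PI /\ u = (cos al, sin al).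
Proof.
  destruct u as [x y]. unfold unit_vector. cbn [fst snd]. intros E.
  assert (Hx : -1 <= x <= 1) by nra. pose proof (acos_bound x).
  assert (S : sin (acos x) = sqrt (y ^ 2)).
  { rewrite sin_acos by auto. unfold Rsqr. f_equal. lra. }
  destruct (Rle_dec 0 y) as [Hy|Hy].
  - exists (acos x). split; [lra|]. rewrite cos_acos, S, sqrt_pow2; auto.
  - exists (- acos x). split; [lra|]. rewrite cos_neg, sin_neg, cos_acos, S by auto.
    replace (y ^ 2) with ((- y) ^ 2) by ring. rewrite sqrt_pow2 by lra. f_equal. ring.
Qed.

Lemma unit_vector_cos_sin al : unit_vector (cos al, sin al).
Proof. unfold unit_vector. cbn [fst snd]. pose proof (sin2_cos2 al). unfold Rsqr in *. lra. Qed.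

Lemma cos_sin_continuous al e : 0 < e -> exists h, 0 < h /\ forall be, Rabs (be - al) < h ->
  close_to (cos be, sin be) (cos al, sin al) e.
Proof.
  intros He. destruct (continuity_at cos al e continuity_cos He) as (h1 & H1 & near1).
  destruct (continuity_at sin al e continuity_sin He) as (h2 & H2 & near2).
  exists (Rmin h1 h2). split; [now apply Rmin_pos|]. intros be Hbe.
  pose proof (Rmin_l h1 h2). pose proof (Rmin_r h1 h2).
  split; cbn [fst snd]; [apply near1|apply near2]; lra.
Qed.

Lemma circle_cluster (Q : R -> R * R -> Prop) :
  (forall d d' u, d <= d' -> Q d u -> Q d' u) ->
  (forall d, 0 < d -> exists u, unit_vector u /\ Q d u) ->
  exists u, unit_vector u /\
    forall d e, 0 < d -> 0 < e -> exists u', unit_vector u' /\ close_to u' u e /\ Q d u'.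
Proof.
  intros mono inhabited.
  assert (angles : forall n : nat, exists al, - PI <= al <= PI /\ Q (/ (INR n + 1)) (cos al, sin al)).
  { intro n. pose proof (pos_INR n).
    destruct (inhabited (/ (INR n + 1))) as (u & Hu & HQ); [apply Rinv_0_lt_compat; lra|].
    destruct (unit_vector_angle u Hu) as (al & Hal & ->). now exists al. }
  set (al := fun n => proj1_sig (constructive_indefinite_description _ (angles n))).
  assert (Hal : forall n, - PI <= al n <= PI /\ Q (/ (INR n + 1)) (cos (al n), sin (al n)))
    by (intro n; exact (proj2_sig (constructive_indefinite_description _ (angles n)))).
  clearbody al.
  destruct (Bolzano_Weierstrass al (fun x => - PI <= x <= PI) (compact_P3 (- PI) PI))
    as [a cluster];
    [intro n; apply Hal|].
  exists (cos a, sin a). split; [apply unit_vector_cos_sin|]. intros d e Hd He.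
  destruct (cos_sin_continuous a e He) as (h & Hh & near). destruct (INR_unbounded (/ d)) as [N HN].
  destruct (cluster (fun x => Rabs (x - a) < h) N) as (n & Hn & close).
  { exists (mkposreal h Hh). intros x Hx. exact Hx. }
  exists (cos (al n), sin (al n)). split; [apply unit_vector_cos_sin|]. split; [now apply near|].
  apply (mono (/ (INR n + 1))); [|apply Hal]. apply le_INR in Hn.
  rewrite <- (Rinv_inv d). pose proof (Rinv_0_lt_compat d Hd). apply Rinv_le_contravar; lra.
Qed.

(** * Rays from the base point *)

Lemma in_Sigma_p0 : in_Sigma p0.
Proof. unfold in_Sigma, p0. cbn [snd]. lra. Qed.

Definition rho : R := sqrt (3 + sinh 1 ^ 2).

Lemma rho_pos : 0 < rho.
Proof. apply sqrt_lt_R0. nra. Qed.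

Lemma rho_sq : rho ^ 2 = 3 + sinh 1 ^ 2.
Proof. apply pow2_sqrt. nra. Qed.

(* The initial velocity is a positive multiple of [(2 c sinh 1, p 0)]. *)
Definition aims (u : R * R) (c : R) (g : R -> R * R) (p : R -> R) : Prop :=
  trajectory c g p /\ g 0 = p0 /\ 2 * c * sinh 1 = rho * fst u /\ p 0 = rho * snd u.

Lemma exists_aim {c g p} : trajectory c g p -> g 0 = p0 -> exists u, unit_vector u /\ aims u c g p.
Proof.
  intros traj start. pose proof rho_pos. exists (2 * c * sinh 1 / rho, p 0 / rho). split.
  - pose proof (trajectory_unit_speed traj 0) as E. unfold unit_speed, ucoord, ycoord in E.
    rewrite start in E. unfold p0 in E. cbn [snd] in E. rewrite cosh_sq in E.
    unfold unit_vector. cbn [fst snd].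
    replace ((2 * c * sinh 1 / rho) ^ 2 + (p 0 / rho) ^ 2) with
      (((2 * c * sinh 1) ^ 2 + p 0 ^ 2) / rho ^ 2) by (field; lra).
    rewrite E. replace ((2 * c * sinh 1) ^ 2 + (3 + lam c * (1 + sinh 1 ^ 2 - 1))) with (rho ^ 2)
      by (rewrite rho_sq; unfold lam; ring). field. lra.
  - split; [auto|]. split; [auto|]. cbn [fst snd]. split; field; lra.
Qed.

Lemma aims_exists u : unit_vector u -> exists c g p, aims u c g p.
Proof.
  intros Hu. pose proof (sinh_pos 1 ltac:(lra)). set (c := rho * fst u / (2 * sinh 1)).
  assert (Ec : 2 * c * sinh 1 = rho * fst u) by (unfold c; field; lra).
  destruct (trajectory_exists c (rho * snd u) p0 in_Sigma_p0)
    as (g & p & traj & start & p_start & _).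
  { unfold unit_speed, p0. cbn [snd]. rewrite cosh_sq. unfold unit_vector in Hu.
    assert (E : (rho * fst u) ^ 2 + (rho * snd u) ^ 2 = rho ^ 2).
    { replace ((rho * fst u) ^ 2 + (rho * snd u) ^ 2) with (rho ^ 2 * (fst u ^ 2 + snd u ^ 2)) by ring.
      rewrite Hu. ring. }
    rewrite <- Ec, rho_sq in E. unfold lam. lra. }
  exists c, g, p. now split.
Qed.

Lemma aims_velocity {u c g p} : aims u c g p -> exists m, 0 < m /\
  is_derive (xcoord g) 0 (m * fst u) /\ is_derive (ycoord g) 0 (m * snd u).
Proof.
  intros (traj & start & aim_x & aim_y). pose proof rho_pos. pose proof (sinh_pos 1 ltac:(lra)).
  pose proof (trajectory_srate_pos traj 0) as rate.
  pose proof (derive_xcoord traj 0) as Dx. pose proof (derive_ycoord traj 0) as Dy.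
  assert (y_start : ycoord g 0 = 1) by (unfold ycoord; now rewrite start).
  exists (rho * srate (ucoord g 0) / sinh 1).
  split; [apply Rdiv_lt_0_compat; auto; now apply Rmult_lt_0_compat|]. split.
  - eapply is_derive_eq; [exact Dx|]. apply (Rmult_eq_reg_r (sinh 1)); [|lra].
    replace (2 * c * srate (ucoord g 0) * sinh 1) with (2 * c * sinh 1 * srate (ucoord g 0)) by ring.
    rewrite aim_x. field. lra.
  - eapply is_derive_eq; [exact Dy|]. rewrite y_start, aim_y. field. lra.
Qed.

Lemma starts_in_cone_iff {u c g p} v e : unit_vector u -> aims u c g p ->
  (starts_in_cone v e g <-> acos (cos_angle v u) < e).
Proof.
  intros Hu aim. destruct (aims_velocity aim) as (m & Hm & Dx & Dy).
  destruct aim as (traj & start & _).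
  rewrite <- (angle_unit v u m Hm Hu). split.
  - intros (_ & _ & w1 & w2 & D1 & D2 & small). apply is_derive_Reals in D1, D2.
    replace (m * fst u) with w1; [replace (m * snd u) with w2; [exact small|]|].
    + exact (eq_trans (eq_sym (is_derive_unique _ _ _ D2)) (is_derive_unique _ _ _ Dy)).
    + exact (eq_trans (eq_sym (is_derive_unique _ _ _ D1)) (is_derive_unique _ _ _ Dx)).
  - intros small. split; [exact (trajectory_geodesic traj)|]. split; [auto|].
    exists (m * fst u), (m * snd u). split; [now apply is_derive_Reals|].
    split; [now apply is_derive_Reals|auto].
Qed.

Lemma end_determines_aim {u1 c1 g1 p1 u2 c2 g2 p2} : aims u1 c1 g1 p1 -> aims u2 c2 g2 p2 ->
  Phi (Inf g1) = Phi (Inf g2) -> u1 = u2.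
Proof.
  intros (traj1 & start1 & x1 & y1) (traj2 & start2 & x2 & y2) same_end. pose proof rho_pos.
  pose proof (has_end_Phi traj1) as end1. rewrite same_end in end1.
  destruct (end_determines_direction traj1 traj2 end1 (has_end_Phi traj2))
    as [Ec Ep]; [congruence|].
  rewrite (surjective_pairing u1), (surjective_pairing u2).
  f_equal; apply (Rmult_eq_reg_l rho); try lra.
  now rewrite <- x1, <- x2, Ec.
Qed.

Definition on_ray (u : R * R) (z : cpt) : Prop :=
  exists c g p, aims u c g p /\
    match z with
    | Pt q => exists T, 0 < T /\ g T = q
    | Inf g' => asymptotic g g'
    end.

Definition beyond (M : R) (z : cpt) : Prop :=
  match z with
  | Pt q => ~ dist_le p0 q M
  | Inf _ => True
  end.

Lemma in_trunc_cone_iff v e M z :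
  in_trunc_cone v e M z <->
    beyond M z /\ exists u, unit_vector u /\ on_ray u z /\ acos (cos_angle v u) < e.
Proof.
  assert (aim : forall g, starts_in_cone v e g -> exists u c p, unit_vector u /\ aims u c g p).
  { intros g (Hg & start & _). destruct (geodesic_trajectory g Hg) as (c & p & traj).
    destruct (exists_aim traj start) as (u & Hu & aim). now exists u, c, p. }
  destruct z as [q|g']; simpl in_trunc_cone; simpl beyond; split.
  - intros (far & g & T & HT & E & cone). split; [auto|].
    destruct (aim g cone) as (u & c & p & Hu & Ha).
    exists u. split; [auto|]. split; [exists c, g, p; split; [auto|now exists T]|].
    now apply (starts_in_cone_iff v e Hu Ha).
  - intros (far & u & Hu & (c & g & p & Ha & T & HT & E) & small). split; [auto|].
    exists g, T. split; [auto|]. split; [auto|]. now apply (starts_in_cone_iff v e Hu Ha).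
  - intros (g & close & cone). split; [auto|]. destruct (aim g cone) as (u & c & p & Hu & Ha).
    exists u. split; [auto|]. split; [now exists c, g, p|].
    now apply (starts_in_cone_iff v e Hu Ha).
  - intros (_ & u & Hu & (c & g & p & Ha & close) & small). exists g. split; [auto|].
    now apply (starts_in_cone_iff v e Hu Ha).
Qed.

Lemma exists_on_ray z : valid z -> z <> Pt p0 -> exists u, unit_vector u /\ on_ray u z.
Proof.
  intros Hz distinct. destruct z as [q|g'].
  - destruct (geodesic_through p0 q in_Sigma_p0 Hz) as (g & T & Hg & start & HT & E); [congruence|].
    destruct (geodesic_trajectory g Hg) as (c & p & traj).
    destruct (exists_aim traj start) as (u & Hu & aim). exists u. split; [auto|].
    exists c, g, p. split; [auto|now exists T].
  - destruct (trajectory_to_end p0 _ in_Sigma_p0 (Phi_Inf_bdD g' Hz))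
      as (c & g & p & traj & start & ends).
    destruct (exists_aim traj start) as (u & Hu & aim). exists u. split; [auto|].
    exists c, g, p. split; [auto|]. apply Phi_Inf_eq; [exact (trajectory_geodesic traj)|exact Hz|].
    exact (Phi_has_end traj ends).
Qed.

(** * The cone topology *)

(* Vanishes exactly on the boundary of the half disk. *)
Definition depth (w : R * R) : R := (1 - (fst w ^ 2 + snd w ^ 2)) * snd w.

Lemma depth_bdD w : bdD w -> depth w = 0.
Proof. unfold depth. intros [[E _]|[E _]]; rewrite E; ring. Qed.

Lemma depth_le v w r : inD v -> inD w -> close_to v w r -> depth v <= depth w + 5 * r.
Proof.
  destruct v as [a b], w as [a' b']. unfold inD, close_to, depth. cbn [fst snd].
  intros [v1 v2] [w1 w2] [near1 near2]. apply Rabs_def2 in near1, near2.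
  assert (Ha : -1 <= a <= 1 /\ -1 <= a' <= 1) by (split; nra).
  assert (Hb : b <= 1 /\ b' <= 1) by (split; nra).
  assert (norms : Rabs ((a ^ 2 + b ^ 2) - (a' ^ 2 + b' ^ 2)) <= 4 * r).
  { replace ((a ^ 2 + b ^ 2) - (a' ^ 2 + b' ^ 2)) with ((a - a') * (a + a') + (b - b') * (b + b')) by ring.
    apply Rabs_le. split; nra. }
  apply Rabs_le_between in norms. nra.
Qed.

Lemma depth_to_disk q : depth (to_disk q) = snd q / bracket (fst q) (snd q) ^ 3.
Proof.
  unfold depth, to_disk. cbn [fst snd]. pose proof (bracket_ge_1 (fst q) (snd q)).
  pose proof (bracket_sq (fst q) (snd q)) as E. set (n := bracket (fst q) (snd q)) in *.
  transitivity ((n ^ 2 - (fst q ^ 2 + snd q ^ 2)) * snd q / n ^ 3); [field; lra|].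
  rewrite E. field. lra.
Qed.

Lemma depth_ball M :
  exists m, 0 < m /\ forall q, in_Sigma q -> dist_le p0 q M -> m <= depth (to_disk q).
Proof.
  set (K := bracket 0 1 + 4 * Rabs M). pose proof (bracket_ge_1 0 1). pose proof (Rabs_pos M).
  assert (HK : 0 < K) by (unfold K; lra).
  exists (exp (- (2 * M)) / K ^ 3).
  split; [apply Rdiv_lt_0_compat; [apply exp_pos|now apply pow_lt]|].
  intros q Hq dist. pose proof (dist_le_x _ _ _ dist) as dx.
  pose proof (dist_le_y _ _ _ dist) as dy.
  pose proof (dist_le_ln_y _ _ _ dist) as dl. unfold p0 in dx, dy, dl. cbn [fst snd] in dx, dy, dl.
  rewrite ln_1, Rminus_0_r in dl. rewrite depth_to_disk.
  pose proof (bracket_le_plus (fst q) (snd q) 0 1). pose proof (bracket_ge_1 (fst q) (snd q)).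
  pose proof (Rle_abs M). apply Rabs_le_between in dl.
  apply Rmult_le_compat; [left; apply exp_pos|left; apply Rinv_0_lt_compat, pow_lt; auto| |].
  - rewrite <- (exp_ln (snd q)) by auto. apply exp_le. lra.
  - apply Rinv_le_contravar; [apply pow_lt; lra|]. apply pow_incr. unfold K. lra.
Qed.

Lemma beyond_near_boundary w M : bdD w ->
  exists r, 0 < r /\ forall z, valid z -> close_to (Phi z) w r -> beyond M z.
Proof.
  intros boundary. destruct (depth_ball M) as (m & Hm & deep). exists (m / 6). split; [lra|].
  intros z Hz near. destruct z as [q|g]; simpl beyond; auto. intros dist.
  specialize (deep q Hz dist). pose proof (Phi_inD _ Hz) as inside.
  assert (Hw : inD w) by (apply inD_cases; auto).
  pose proof (depth_le _ _ _ inside Hw near) as gap. rewrite (depth_bdD w boundary) in gap.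
  cbn [Phi] in gap. lra.
Qed.

Lemma near_ray_close_end {u c g p w} e : aims u c g p -> has_end c g p w -> 0 < e ->
  exists h M, 0 < h /\ 0 < M /\ forall u' z, valid z -> on_ray u' z -> close_to u' u h -> beyond M z ->
    close_to (Phi z) w e.
Proof.
  intros (traj & start & aim_x & aim_y) ends He. pose proof rho_pos.
  pose proof (sinh_pos 1 ltac:(lra)).
  destruct (has_end_locally_uniform traj ends (e / 2) ltac:(lra)) as (d & T & Hd & uniform).
  set (h := Rmin (d * (2 * sinh 1) / rho) (d / rho)).
  assert (Hh : 0 < h) by (apply Rmin_pos; apply Rdiv_lt_0_compat; auto; apply Rmult_lt_0_compat; lra).
  exists h, (Rmax 1 T). pose proof (Rmax_l 1 T). pose proof (Rmax_r 1 T).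
  split; [auto|]. split; [lra|].
  intros u' z Hz (c' & g' & p' & (traj' & start' & aim_x' & aim_y') & Hray)
    [near1 near2] far.
  assert (h1 : h <= d * (2 * sinh 1) / rho) by apply Rmin_l.
  assert (h2 : h <= d / rho) by apply Rmin_r.
  assert (late : forall t, T <= t -> close_to (to_disk (g' t)) w (e / 2)).
  { apply (uniform c' g' p' traj'); [congruence| |].
    - apply (Rmult_lt_reg_l (2 * sinh 1)); [lra|].
      rewrite <- (Rabs_right (2 * sinh 1)) at 1 by lra. rewrite <- Rabs_mult.
      replace (2 * sinh 1 * (c' - c)) with (rho * (fst u' - fst u)) by lra.
      rewrite Rabs_mult, (Rabs_right rho), Rmult_comm by lra.
      rewrite (Rmult_comm (2 * sinh 1)). apply <- Rlt_div_r; auto. lra.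
    - replace (p' 0 - p 0) with (rho * (snd u' - snd u)) by lra.
      rewrite Rabs_mult, (Rabs_right rho), Rmult_comm by lra. apply <- Rlt_div_r; auto. lra. }
  destruct z as [q|g''].
  - destruct Hray as (t & Ht & <-). apply (close_to_weaken _ _ (e / 2)); [|lra]. apply late.
    apply Rnot_lt_le. intros early. apply far. rewrite <- start'.
    apply dist_le_mono with t; [|lra]. apply geodesic_dist; [exact (trajectory_geodesic traj')|lra].
  - rewrite <- (proj2 (Phi_Inf_eq g' g'' (trajectory_geodesic traj') Hz) Hray).
    apply (conv_to_close (fun t => to_disk (g' t)) _ w (e / 2) e T); auto; [|lra].
    exact (has_end_conv_to traj' (has_end_Phi traj')).
Qed.

Lemma cos_angle_self u : unit_vector u -> cos_angle u u = 1.
Proof.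
  unfold unit_vector, cos_angle. intros Hu. rewrite Hu, sqrt_1, Rdiv_1_r. lra.
Qed.

Theorem open_to_cone V : open_in_D V -> cone_open (fun z => valid z /\ V (Phi z)).
Proof.
  intros HV z Hz [_ Vz]. destruct (HV (Phi z) (Phi_inD z Hz) Vz) as (r & Hr & ball).
  assert (close_V : forall z', valid z' -> close_to (Phi z') (Phi z) (r / 2) -> V (Phi z')).
  { intros z' Hz' near. apply ball; [now apply Phi_inD|now apply sq_lt_of_close_to]. }
  destruct z as [q|g].
  - exists (r / 6). split; [lra|]. intros q' Hq' near. split; [auto|]. apply close_V; [auto|].
    apply (close_to_weaken _ _ (3 * (r / 6))); [|lra].
    apply to_disk_lipschitz, close_to_of_sq; [lra|auto].
  - destruct (exists_on_ray (Inf g) Hz ltac:(discriminate)) as (u & Hu & ray).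
    pose proof ray as (c & g0 & p & aim & close).
    destruct (near_ray_close_end (r / 2) aim (has_end_Phi (proj1 aim)) ltac:(lra))
      as (h & M & Hh & HM & near_end).
    rewrite (proj2 (Phi_Inf_eq g0 g (trajectory_geodesic (proj1 aim)) Hz) close) in near_end.
    pose proof (Rmin_l 1 h). pose proof (Rmin_r 1 h).
    assert (He : 0 < Rmin 1 h) by (apply Rmin_pos; lra).
    exists u, (Rmin 1 h), M. split; [|split; [auto|split; [auto|split]]].
    + intros ->. unfold unit_vector in Hu. cbn [fst snd] in Hu. lra.
    + apply in_trunc_cone_iff. split; [exact I|]. exists u. split; [auto|]. split; [auto|].
      now rewrite cos_angle_self, acos_1.
    + intros z' Hz' cone. split; [auto|]. apply in_trunc_cone_iff in cone.
      destruct cone as (far & u' & Hu' & ray' & small). apply close_V; [auto|].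
      apply (near_end u'); auto. apply (close_to_weaken _ _ (Rmin 1 h)); [|lra].
      now apply close_to_of_small_angle.
Qed.

Lemma cluster_end {u c g p w} : aims u c g p -> bdD w ->
  (forall d h, 0 < d -> 0 < h -> exists u' z, valid z /\ on_ray u' z /\ close_to u' u h /\
     close_to (Phi z) w d) ->
  Phi (Inf g) = w.
Proof.
  intros aim boundary clusters. apply close_to_eq. intros e He.
  destruct (near_ray_close_end (e / 2) aim (has_end_Phi (proj1 aim)) ltac:(lra))
    as (h & M & Hh & _ & near_end).
  destruct (beyond_near_boundary w M boundary) as (r & Hr & far).
  pose proof (Rmin_l (e / 2) r). pose proof (Rmin_r (e / 2) r).
  destruct (clusters (Rmin (e / 2) r) h) as (u' & z & Hz & ray & near_u & near_w); auto;
    [apply Rmin_pos; lra|].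
  replace e with (e / 2 + e / 2) by field. apply close_to_trans with (Phi z).
  - apply close_to_sym, (near_end u'); auto. apply far; auto.
    now apply close_to_weaken with (Rmin (e / 2) r).
  - now apply close_to_weaken with (Rmin (e / 2) r).
Qed.

(* By contradiction: rays to points outside the cone that converge to the end of [g] cluster at a ray
   with the same end; by uniqueness this is the ray asymptotic to [g], which lies in the open cone. *)
Lemma near_end_in_cone v e M g : v <> (0, 0) -> 0 < e -> 0 < M -> geodesic g ->
  in_trunc_cone v e M (Inf g) -> exists r, 0 < r /\
    forall z, valid z -> close_to (Phi z) (Phi (Inf g)) r -> in_trunc_cone v e M z.
Proof.
  intros Hv He HM Hg cone. pose proof (Phi_Inf_bdD g Hg) as boundary. set (w := Phi (Inf g)) in *.
  apply in_trunc_cone_iff in cone.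
  destruct cone as (_ & u0 & Hu0 & (c0 & g0 & p0' & aim0 & close0) & small).
  apply (Phi_Inf_eq g0 g (trajectory_geodesic (proj1 aim0)) Hg) in close0. fold w in close0.
  destruct (angle_continuous v u0 e Hv Hu0 He small) as (h0 & Hh0 & small_near).
  destruct (beyond_near_boundary w M boundary) as (r0 & Hr0 & far).
  apply NNPP. intros escape.
  destruct (circle_cluster (fun d u => exists z, valid z /\ on_ray u z /\
    close_to (Phi z) w (Rmin d r0) /\ ~ in_trunc_cone v e M z)) as (u & Hu & clusters).
  - intros d d' u Hd (z & Hz & ray & near & out). exists z. split; [auto|]. split; [auto|].
    split; [|auto].
    apply (close_to_weaken _ _ (Rmin d r0)); auto. apply Rle_min_compat_r, Hd.
  - intros d Hd. apply NNPP. intros none. apply escape. exists (Rmin d r0).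
    split; [now apply Rmin_pos|]. intros z Hz near. apply NNPP. intros out. apply none.
    destruct (exists_on_ray z Hz) as (u & Hu & ray); [|exists u; split; [auto|now exists z]].
    intros ->. apply (far (Pt p0) Hz); [|apply dist_le_refl; [exact Hz|lra]].
    apply (close_to_weaken _ _ (Rmin d r0)); auto. apply Rmin_r.
  - destruct (aims_exists u Hu) as (c & g' & p & aim).
    assert (same_end : Phi (Inf g') = w).
    { apply (cluster_end aim boundary). intros d h Hd Hh.
      destruct (clusters d h Hd Hh) as (u' & _ & near_u & z & Hz & ray & near & _). exists u', z.
      split; [auto|]. split; [auto|]. split; [auto|].
      apply (close_to_weaken _ _ (Rmin d r0)); auto. apply Rmin_l. }
    rewrite <- (end_determines_aim aim0 aim ltac:(congruence)) in clusters.
    destruct (clusters 1 h0 ltac:(lra) Hh0) as (u' & Hu' & near_u & z & Hz & ray & near & out).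
    apply out, in_trunc_cone_iff. split; [|exists u'; auto].
    apply far; auto. apply (close_to_weaken _ _ (Rmin 1 r0)); auto. apply Rmin_r.
Qed.

Theorem cone_to_open V : cone_open (fun z => valid z /\ V (Phi z)) -> open_in_D V.
Proof.
  intros HV w Hw Vw. destruct (Phi_onto w Hw) as (z & Hz & <-). specialize (HV z Hz (conj Hz Vw)).
  destruct z as [q|g].
  - destruct HV as (r & Hr & ball). destruct (to_disk_interior q Hz) as [inside above].
    destruct (of_disk_continuous (to_disk q) (r / 2) inside ltac:(lra)) as (d & Hd & near_q).
    rewrite of_disk_to_disk in near_q. set (h := Rmin d (snd (to_disk q))).
    assert (Hh : 0 < h) by now apply Rmin_pos. exists h. split; [auto|]. intros w' Hw' near.
    apply close_to_of_sq in near; auto. cbn [Phi] in near.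
    assert (h <= d) by apply Rmin_l. assert (h <= snd (to_disk q)) by apply Rmin_r.
    destruct (near_q w' (close_to_weaken _ _ h d near ltac:(lra))) as [inside' close].
    assert (Hy : 0 < snd w') by (destruct near as [_ near]; apply Rabs_def2 in near; lra).
    destruct (ball (of_disk w') (in_Sigma_of_disk w' inside' Hy) (sq_lt_of_close_to _ _ _ close))
      as [_ Hv].
    cbn [Phi] in Hv. now rewrite to_disk_of_disk in Hv.
  - destruct HV as (v & e & M & Hv & He & HM & cone & inside).
    destruct (near_end_in_cone v e M g Hv He HM Hz cone) as (r & Hr & near_cone).
    exists r. split; [auto|]. intros w' Hw' near. apply close_to_of_sq in near; auto.
    destruct (Phi_onto w' Hw') as (z' & Hz' & <-). now apply inside, near_cone.
Qed.

(** * Distinguished classes *)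

Lemma Phi_of_conv_to g xi : conv_to g (xi, 0) -> Phi (Inf g) = (squash xi, 0).
Proof. intros conv. rewrite <- to_disk_bottom. now apply Phi_conv_to, conv_to_to_disk. Qed.

Lemma bottom_class_conv_to g : geodesic g -> snd (Phi (Inf g)) = 0 -> -1 < fst (Phi (Inf g)) < 1 ->
  exists xi, conv_to g (xi, 0).
Proof.
  intros Hg on_axis inside. destruct (geodesic_trajectory g Hg) as (c & p & traj).
  destruct (has_end_Phi traj) as [[[L _] E]|(se & landing & _)].
  - pose proof (direction_unit c L) as unit. rewrite <- E, on_axis in unit. nra.
  - exists (landing_point c g se). exact (landing_conv_to traj landing).
Qed.

Lemma y_to_infty_ascends g : geodesic g -> y_to_infty g ->
  exists c p, trajectory c g p /\ ascends c p /\ Phi (Inf g) = direction c.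
Proof.
  intros Hg unbounded. destruct (geodesic_trajectory g Hg) as (c & p & traj). exists c, p.
  split; [auto|].
  destruct (has_end_Phi traj) as [up|(se & landing & _)]; [auto|].
  exfalso. apply (y_to_infty_not_asymptotic g g _ unbounded (landing_conv_to traj landing)).
  exists 0. intros t _. rewrite Rminus_diag, Rabs_R0. lra.
Qed.

Lemma eventually_on_slope {c g p} x0 f df : trajectory c g p -> eventually_on g x0 f ->
  (forall y : R, 0 < y -> is_derive f y (df y)) ->
  exists t, 2 * c * sinh (ycoord g t) = df (ycoord g t) * p t.
Proof.
  intros traj [T graph] Df. exists (T + 1). set (t := T + 1). pose proof (ycoord_pos traj t) as Hy.
  pose proof (sinh_pos _ Hy). pose proof (trajectory_srate_pos traj t).
  assert (Dx : is_derive (xcoord g) t (df (ycoord g t) * (p t * srate (ucoord g t) / sinh (ycoord g t)))).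
  { apply is_derive_ext_loc with (fun t => x0 + f (ycoord g t)).
    - exists (mkposreal 1 Rlt_0_1). intros r Hr. symmetry. apply graph.
      apply Rabs_def2 in Hr. cbn in Hr. unfold minus, plus, opp in Hr. cbn in Hr. unfold t in Hr.
      lra.
    - pose proof (is_derive_comp_R f (ycoord g) t _ _ (Df _ Hy) (derive_ycoord traj t)).
      derive_by_rules. ring. }
  pose proof (is_derive_unique _ _ _ Dx) as E.
  rewrite (is_derive_unique _ _ _ (derive_xcoord traj t)) in E.
  apply (Rmult_eq_reg_r (srate (ucoord g t) / sinh (ycoord g t))).
  - transitivity (2 * c * srate (ucoord g t)); [field; lra|]. rewrite E. field. lra.
  - apply Rgt_not_eq. now apply Rdiv_lt_0_compat.
Qed.

(* The slope is that of the unit speed curves with Clairaut constant [a / 2]. *)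
Lemma Phi_of_slope g x0 f a b : geodesic g -> y_to_infty g -> eventually_on g x0 f ->
  a ^ 2 + b ^ 2 = 1 -> 0 <= b ->
  (forall y : R, 0 < y -> is_derive f y (a * sinh y / sqrt (b ^ 2 * sinh y ^ 2 + 3))) ->
  Phi (Inf g) = (a, b).
Proof.
  intros Hg unbounded graph unit Hb Df.
  destruct (y_to_infty_ascends g Hg unbounded) as (c & p & traj & up & ->).
  destruct (eventually_on_slope x0 f _ traj graph Df) as [t slope].
  pose proof (sinh_pos _ (ycoord_pos traj t)). pose proof (ascending_p_gt_1 traj up t) as Hp.
  pose proof (trajectory_unit_speed traj t) as speed. unfold unit_speed, ucoord in speed.
  rewrite cosh_sq in speed. set (S := sinh (ycoord g t)) in *.
  assert (Hq : 0 < b ^ 2 * S ^ 2 + 3) by (pose proof (pow2_ge_0 (b * S)); nra).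
  pose proof (pow2_sqrt _ (Rlt_le _ _ Hq)) as q_sq. apply sqrt_lt_R0 in Hq.
  set (q := sqrt (b ^ 2 * S ^ 2 + 3)) in *.
  assert (E : 2 * c * q = a * p t).
  { apply (Rmult_eq_reg_r (S / q)); [|apply Rgt_not_eq; now apply Rdiv_lt_0_compat].
    transitivity (2 * c * S); [field; lra|]. rewrite slope. field. lra. }
  assert (E_sq : (2 * c) ^ 2 = a ^ 2).
  { assert (sq : (2 * c) ^ 2 * q ^ 2 = a ^ 2 * p t ^ 2) by (rewrite <- !Rpow_mult_distr; now rewrite E).
    rewrite q_sq, speed in sq. unfold lam in sq. apply (Rmult_eq_reg_r (S ^ 2 + 3)); nra. }
  assert (Ec : 2 * c = a).
  { assert (Z : (2 * c - a) * (2 * c + a) = 0) by lra. apply Rmult_integral in Z.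
    destruct Z as [Z|Z]; [lra|]. assert (a * (p t + q) = 0) by nra. nra. }
  unfold direction. rewrite Ec. replace (lam c) with (b ^ 2) by (unfold lam; nra).
  now rewrite sqrt_pow2.
Qed.

Lemma vertical_class g x0 : geodesic g -> eventually_on g x0 (fun _ => 0) -> y_to_infty g ->
  Phi (Inf g) = (0, 1).
Proof.
  intros Hg graph unbounded. apply (Phi_of_slope g x0 (fun _ => 0)); auto; try lra.
  intros y _. unfold Rdiv. rewrite !Rmult_0_l. apply is_derive_const_R.
Qed.

Lemma critical_class g x0 a s : geodesic g -> s = 1 \/ s = -1 ->
  eventually_on g x0 (fun y => s * / sqrt 3 * (cosh y - cosh a)) -> y_to_infty g ->
  Phi (Inf g) = (s, 0).
Proof.
  intros Hg Hs graph unbounded. apply (Phi_of_slope g x0 _ s 0 Hg unbounded graph); try lra.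
  - destruct Hs as [-> | ->]; ring.
  - intros y _. pose proof (is_derive_cosh y). derive_by_rules.
    replace (0 ^ 2 * sinh y ^ 2 + 3) with 3 by ring. field. pose proof sqrt3_bounds. lra.
Qed.

Lemma is_derive_Fm a m y : 0 < m ^ 2 * sinh a ^ 2 - 3 ->
  is_derive (Fm a m) y (sqrt (3 + sinh a ^ 2) * sinh y /
    sqrt ((m ^ 2 * sinh a ^ 2 - 3) * sinh y ^ 2 + 3 * (sinh a ^ 2 + m ^ 2 * sinh a ^ 2))).
Proof.
  intros HB. unfold Fm. set (A := sqrt (3 + sinh a ^ 2)). set (B2 := m ^ 2 * sinh a ^ 2 - 3) in *.
  pose proof (sqrt_lt_R0 B2 HB) as Bp. pose proof (sqrt_sqrt B2 ltac:(lra)) as B_sq.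
  set (B := sqrt B2) in *. pose proof (cosh_ge_1 y) as Cy. pose proof (pow2_ge_0 (sinh a)).
  set (Q := fun y => B2 * cosh y ^ 2 + 3 * cosh a ^ 2 + 2 * m ^ 2 * sinh a ^ 2).
  replace (B2 * sinh y ^ 2 + 3 * (sinh a ^ 2 + m ^ 2 * sinh a ^ 2)) with (Q y)
    by (unfold Q; rewrite !cosh_sq; unfold B2; ring).
  assert (HQ : 0 < Q y).
  { unfold Q. pose proof (cosh_sq a).
    assert (0 < B2 * cosh y ^ 2) by (apply Rmult_lt_0_compat; nra).
    unfold B2 in HB. lra. }
  pose proof (sqrt_lt_R0 _ HQ) as Wp. set (W := sqrt (Q y)) in *.
  pose proof (is_derive_cosh y) as Dc.
  assert (DQ : is_derive Q y (B2 * (2 * cosh y * sinh y))) by (unfold Q; derive_by_rules; ring).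
  assert (DW : is_derive (fun y => sqrt (Q y)) y (B2 * cosh y * sinh y / W)).
  { eapply is_derive_eq; [exact (is_derive_sqrt Q y _ DQ HQ)|]. fold W. field. lra. }
  assert (Hlog : 0 < B2 * cosh y + B * W).
  { apply Rplus_lt_0_compat; apply Rmult_lt_0_compat; lra. }
  assert (Dlog : is_derive (fun y => B2 * cosh y + B * sqrt (Q y)) y
    (B2 * sinh y + B * (B2 * cosh y * sinh y / W))) by (derive_by_rules; ring).
  eapply is_derive_eq; [exact (is_derive_scal_R _ (A / B) y _ (is_derive_ln_comp _ y _ Hlog Dlog))|].
  cbv beta. fold W. rewrite <- B_sq in *. field. repeat split; lra.
Qed.

Lemma oblique_class g x0 a m s theta : geodesic g -> 0 < a -> sqrt 3 / sinh a < m ->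
  s = 1 \/ s = -1 -> eventually_on g x0 (fun y => s * (Fm a m y - Fm a m a)) -> y_to_infty g ->
  0 < theta < PI -> theta <> PI / 2 ->
  tan theta = s * sqrt (m ^ 2 * sinh a ^ 2 - 3) / sqrt (3 + sinh a ^ 2) ->
  Phi (Inf g) = (cos theta, sin theta).
Proof.
  intros Hg Ha Hm Hs graph unbounded Htheta not_vertical slope.
  pose proof sqrt3_bounds. pose proof sqrt3_sq. pose proof (sinh_pos a Ha) as Sa.
  assert (HB : 0 < m ^ 2 * sinh a ^ 2 - 3).
  { assert (sqrt 3 < m * sinh a) by (apply -> Rlt_div_l; auto).
    rewrite <- Rpow_mult_distr. nra. }
  assert (s_sq : s * s = 1) by (destruct Hs as [-> | ->]; ring).
  pose proof (pow2_ge_0 (sinh a)) as HA.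
  pose proof (sqrt_lt_R0 (3 + sinh a ^ 2) ltac:(lra)) as Ap. pose proof (sqrt_lt_R0 _ HB) as Bp.
  pose proof (pow2_sqrt (3 + sinh a ^ 2) ltac:(lra)) as A_sq.
  pose proof (pow2_sqrt _ (Rlt_le _ _ HB)) as B_sq.
  assert (Dm := is_derive_Fm a m).
  set (A := sqrt (3 + sinh a ^ 2)) in *. set (B := sqrt (m ^ 2 * sinh a ^ 2 - 3)) in *.
  assert (Hsin : 0 < sin theta) by (apply sin_gt_0; lra).
  assert (Hcos : cos theta <> 0).
  { intros Z. apply not_vertical. apply cos_inj; [lra|lra|]. now rewrite cos_PI2. }
  set (D := B / sin theta). assert (HD : 0 < D) by now apply Rdiv_lt_0_compat.
  assert (EB : B = sin theta * D) by (unfold D; field; lra).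
  assert (EA : A = s * cos theta * D).
  { apply (f_equal (fun z => z * (cos theta * A))) in slope. unfold tan in slope.
    replace (sin theta / cos theta * (cos theta * A)) with (sin theta * A) in slope by (field; auto).
    replace (s * B / A * (cos theta * A)) with (s * cos theta * B) in slope by (field; lra).
    apply (Rmult_eq_reg_l (sin theta)); [|lra]. rewrite slope, EB. ring. }
  pose proof (sin2_cos2 theta) as unit. unfold Rsqr in unit.
  apply (Phi_of_slope g x0 _ _ _ Hg unbounded graph); [lra|lra|]. intros y _. specialize (Dm y HB).
  assert (D_sq : D ^ 2 = sinh a ^ 2 + m ^ 2 * sinh a ^ 2).
  { transitivity (A ^ 2 + B ^ 2); [|lra]. rewrite EA, EB.
    transitivity (D ^ 2 * (sin theta * sin theta + s * s * (cos theta * cos theta))); [|ring].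
    rewrite s_sq, Rmult_1_l, unit. ring. }
  replace ((m ^ 2 * sinh a ^ 2 - 3) * sinh y ^ 2 + 3 * (sinh a ^ 2 + m ^ 2 * sinh a ^ 2)) with
    (D ^ 2 * (sin theta ^ 2 * sinh y ^ 2 + 3)) in Dm
    by (rewrite <- B_sq, EB, <- D_sq; ring).
  assert (Hq : 0 < sin theta ^ 2 * sinh y ^ 2 + 3) by (pose proof (pow2_ge_0 (sin theta * sinh y)); nra).
  rewrite sqrt_mult, sqrt_pow2 in Dm by (try apply pow2_ge_0; lra). apply sqrt_lt_R0 in Hq.
  derive_by_rules. rewrite EA.
  transitivity (s * s * (cos theta * sinh y / sqrt (sin theta ^ 2 * sinh y ^ 2 + 3))).
  - field. lra.
  - rewrite s_sq. ring.
Qed.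

Theorem theorem3p3 :
  exists Phi : cpt -> R * R,
    (* Phi is a bijection of Sigma u S_oo(Sigma) onto D *)
    (forall z, valid z -> inD (Phi z)) /\
    (forall w, inD w -> exists z, valid z /\ Phi z = w) /\
    (forall z1 z2, valid z1 -> valid z2 -> (Phi z1 = Phi z2 <-> same z1 z2)) /\
    (* Phi is a homeomorphism (cone topology vs. Euclidean topology of D) *)
    (forall V : R * R -> Prop,
        open_in_D V <-> cone_open (fun z => valid z /\ V (Phi z))) /\
    (* S_oo(Sigma) corresponds to the boundary of D *)
    (forall z, valid z -> (is_inf z <-> bdD (Phi z))) /\
    (* (1) *)
    (exists h : R -> R,
        continuity h /\ (forall s1 s2, h s1 = h s2 -> s1 = s2) /\
        (forall u, -1 < u < 1 <-> exists xi, h xi = u) /\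
        forall g, geodesic g ->
          (forall xi, conv_to g (xi, 0) -> Phi (Inf g) = (h xi, 0)) /\
          (snd (Phi (Inf g)) = 0 -> -1 < fst (Phi (Inf g)) < 1 ->
             exists xi, conv_to g (xi, 0))) /\
    (* (2) *)
    (forall g x0, geodesic g -> eventually_on g x0 (fun _ => 0) -> y_to_infty g ->
        Phi (Inf g) = (0, 1)) /\
    (* (3) *)
    (forall g x0 a (s : R), geodesic g -> 0 < a -> (s = 1 \/ s = -1) ->
        eventually_on g x0 (fun y => s * / sqrt 3 * (cosh y - cosh a)) ->
        y_to_infty g ->
        Phi (Inf g) = (s, 0)) /\
    (* (4) *)
    (forall g x0 a m (s : R), geodesic g -> 0 < a -> sqrt 3 / sinh a < m ->
        (s = 1 \/ s = -1) ->
        eventually_on g x0 (fun y => s * (Fm a m y - Fm a m a)) ->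
        y_to_infty g ->
        forall theta, 0 < theta < PI -> theta <> PI / 2 ->
          tan theta = s * sqrt (m ^ 2 * sinh a ^ 2 - 3) / sqrt (3 + sinh a ^ 2) ->
          Phi (Inf g) = (cos theta, sin theta)).
Proof.
  exists Phi. split; [exact Phi_inD|]. split; [exact Phi_onto|]. split; [exact Phi_same|].
  split; [intro V; split; [apply open_to_cone|apply cone_to_open]|]. split; [exact Phi_bdD|].
  split; [|split; [exact vertical_class|split]].
  - exists squash. split; [exact continuity_squash|]. split; [exact squash_inj|]. split.
    + intro u. split; [apply squash_onto|]. intros [xi <-]. apply squash_bounds.
    + intros g Hg. split; [exact (Phi_of_conv_to g)|exact (bottom_class_conv_to g Hg)].
  - intros g x0 a s Hg _. exact (critical_class g x0 a s Hg).
  - intros g x0 a m s Hg Ha Hm Hs graph unbounded theta.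
    exact (oblique_class g x0 a m s theta Hg Ha Hm Hs graph unbounded).
Qed.
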